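(* Assume (C1) and simple randomization. Let $\hat b_1,\dots,\hat b_k$ be $p$-dimensional (possibly data-dependent) vectors with $\hat b_t\to b_t$ in probability as $n\to\infty$ for fixed vectors $b_t$, $t=1,\dots,k$, and put $B=(b_1,\dots,b_k)$. (i) As $n\to\infty$, $$\sqrt n\{\hat\theta(\hat b_1,\dots,\hat b_k)-\theta\}\to N(0,V_{\rm SR}(B))\quad\text{in distribution},$$ where $$V_{\rm SR}(B)=\mathrm{diag}\{\pi_t^{-1}\mathrm{var}(Y^{(t)}-b_t^\top X)\}+\mathscr B^\top\Sigma_X B+B^\top\Sigma_X\mathscr B-B^\top\Sigma_X B .$$ In particular this holds for $\hat\theta_{\rm AN}$ (with $b_t=0$), $\hat\theta_{\rm ANC}$ (with $b_t=\beta$) and $\hat\theta_{\rm ANHC}$ (with $b_t=\beta_t$). (ii) $V_{\rm SR}(B)-V_{\rm SR}(\mathscr B)$ is positive semidefinite for every $p\times k$ matrix $B$.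
   Context: Setup: a trial with $k$ treatment arms. For each patient there are potential responses $Y^{(1)},\dots,Y^{(k)}$ (real-valued), a discrete baseline covariate vector $Z$ and a $p$-dimensional baseline covariate vector $X$. Condition (C1): $(Y_i^{(1)},\dots,Y_i^{(k)},Z_i,X_i)$, $i=1,\dots,n$, are i.i.d. with finite second moments, the distribution of baseline covariates is not affected by treatment, and $\Sigma_X=\mathrm{var}(X_i)$ is positive definite. Let $\pi_1,\dots,\pi_k\in(0,1)$ with $\sum_t\pi_t=1$ be fixed assignment proportions. $a_t$ denotes the $t$-th standard basis vector of $\mathbb R^k$; $A_i\in\{a_1,\dots,a_k\}$ is patient $i$'s treatment indicator and the observed response is $Y_i=Y_i^{(t)}$ iff $A_i=a_t$. Simple randomization: $A_1,\dots,A_n$ are i.i.d., independent of all $(Y_i^{(1)},\dots,Y_i^{(k)},Z_i,X_i)$, with $P(A_i=a_t)=\pi_t$. Notation: $\theta=(\theta_1,\dots,\theta_k)^\top$ with $\theta_t=E(Y^{(t)})$; $\mu_X=E(X)$; $\beta_t=\Sigma_X^{-1}\mathrm{cov}(X,Y^{(t)})$; $\beta=\sum_t\pi_t\beta_t$; $\mathscr B=(\beta_1,\dots,\beta_k)$ (a $p\times k$ matrix); $\mathrm{diag}(d_t)$ is the $k\times k$ diagonal matrix with $t$-th diagonal entry $d_t$. $n_t$ is the number of patients with $A_i=a_t$; $\bar Y_t,\bar X_t$ are the sample means of $Y_i$, $X_i$ over patients with $A_i=a_t$; $\bar X$ is the mean of all $X_i$. For $p$-vectors $\hat b_1,\dots,\hat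 b_k$, $\hat\theta(\hat b_1,\dots,\hat b_k)=(\bar Y_1-\hat b_1^\top(\bar X_1-\bar X),\dots,\bar Y_k-\hat b_k^\top(\bar X_k-\bar X))^\top$. $\hat\theta_{\rm AN}$ takes $\hat b_t=0$; $\hat\theta_{\rm ANC}$ takes $\hat b_t=\hat\beta=\{\sum_t\sum_{i:A_i=a_t}(X_i-\bar X_t)(X_i-\bar X_t)^\top\}^{-1}\sum_t\sum_{i:A_i=a_t}(X_i-\bar X_t)Y_i$ for all $t$; $\hat\theta_{\rm ANHC}$ takes $\hat b_t=\hat\beta_t=\{\sum_{i:A_i=a_t}(X_i-\bar X_t)(X_i-\bar X_t)^\top\}^{-1}\sum_{i:A_i=a_t}(X_i-\bar X_t)Y_i$, or alternatively $\hat\beta_t=\frac{n}{n_t}\{\sum_{i=1}^n(X_i-\bar X)(X_i-\bar X)^\top\}^{-1}\sum_{i:A_i=a_t}(X_i-\bar X_t)Y_i$. *)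

(* Defs.v *)
From HB Require Import structures.
From mathcomp Require Import all_boot all_order all_algebra.
From mathcomp Require Import all_classical all_reals all_analysis.

Set Implicit Arguments.
Unset Strict Implicit.
Unset Printing Implicit Defensive.

Import Order.TTheory GRing.Theory Num.Theory.
Import numFieldNormedType.Exports.

Local Open Scope classical_set_scope.
Local Open Scope ring_scope.

Section Defs.
Context {R : realType} {d : measure_display} {T : measurableType d}.

Definition Ex (P : probability T R) (f : T -> R) : R :=
  fine (\int[P]_x (f x)%:E)%E.

Definition rect_event (C : finType) (W : C -> T -> R) (B : C -> set R) : set T :=
  [set x | forall c, B c (W c x)].

(** Mutual independence of a family (indexed by I) of real random vectors
    with coordinates indexed by C: for every finite set J of distinct indices
    and every choice of Borel sets, the probability of the joint rectangle
    event is the product of the probabilities.  (Rectangles generate the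
    product sigma-algebra and form a pi-system.) *)
Definition mutually_independent (P : probability T R) (I : eqType) (C : finType)
    (W : I -> C -> T -> R) : Prop :=
  forall (J : seq I) (B : I -> C -> set R),
    uniq J -> (forall i c, measurable (B i c)) ->
    fine (P [set x | forall i, i \in J -> rect_event (W i) (B i) x]) =
    \prod_(i <- J) fine (P (rect_event (W i) (B i))).

Definition same_law (P : probability T R) (C : finType) (W1 W2 : C -> T -> R) : Prop :=
  forall B : C -> set R, (forall c, measurable (B c)) ->
    P (rect_event W1 B) = P (rect_event W2 B).

Definition cvg_in_prob (P : probability T R) (p : nat)
    (bh : nat -> T -> 'cV[R]_p) (b : 'cV[R]_p) : Prop :=
  forall eps : R, 0 < eps ->
    (fun n => fine (P [set x | eps < `|bh n x - b|])) @ \oo --> (0 : R).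

End Defs.

Definition normal0_law {R : realType} (s2 : R) : set R -> \bar R :=
  fun A => if s2 == 0 then \d_(0 : R) A else normal_prob 0 (Num.sqrt s2) A.

Definition gaussian_vector {R : realType} {d' : measure_display}
    {Om : measurableType d'} (Q : probability Om R) (k : nat)
    (G : Om -> 'cV[R]_k) (V : 'M[R]_k) : Prop :=
  (forall t : 'I_k, measurable_fun setT (fun w => G w t 0)) /\
  forall (u : 'cV[R]_k) (A : set R), measurable A ->
    Q [set w | A ((u^T *m G w) 0 0)] = normal0_law ((u^T *m V *m u) 0 0) A.

Definition cvg_dist_normal {R : realType} {d : measure_display}
    {T : measurableType d} (P : probability T R) (k : nat)
    (W : nat -> T -> 'cV[R]_k) (V : 'M[R]_k) : Prop :=
  exists (d' : measure_display) (Om : measurableType d') (Q : probability Om R)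
         (G : Om -> 'cV[R]_k),
    gaussian_vector Q G V /\
    forall f : 'cV[R]_k -> R, continuous f ->
      (exists M : R, forall v, `|f v| <= M) ->
      (fun n => Ex P (fun x => f (W n x))) @ \oo --> Ex Q (fun w => f (G w)).

Definition psd {R : realType} (k : nat) (M : 'M[R]_k) : Prop :=
  M^T = M /\ forall u : 'cV[R]_k, 0 <= (u^T *m M *m u) 0 0.

Definition pd {R : realType} (k : nat) (M : 'M[R]_k) : Prop :=
  M^T = M /\ forall u : 'cV[R]_k, u != 0 -> 0 < (u^T *m M *m u) 0 0.

Section Trial.
Context {R : realType} {d : measure_display} {T : measurableType d}.
Variables (P : probability T R) (k p : nat) (pi : 'I_k -> R)
  (Y : nat -> 'I_k -> T -> R) (* Y i t = potential response Y_i^(t) *)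
  (X : nat -> 'I_p -> T -> R) (* X i j = j-th baseline covariate of patient i *)
  (A : nat -> T -> 'I_k).     (* A i = arm of patient i (A_i = a_t) *)

Definition Xv (i : nat) (x : T) : 'cV[R]_p := \col_j X i j x.

Definition data_vec (i : nat) : ('I_k + 'I_p)%type -> T -> R :=
  fun c => match c with inl t => Y i t | inr j => X i j end.

(** Family used to state simple randomization: the data vectors (inl i)
    and the treatment indicator vectors (inr i) are mutually independent. *)
Definition trial_family (s : (nat + nat)%type) : ('I_k + 'I_p)%type -> T -> R :=
  match s with
  | inl i => data_vec i
  | inr i => fun c => match c with
                      | inl t => fun x => (A i x == t)%:R
                      | inr _ => fun _ => 0
                      end
  end.

(* population quantities (law of a generic patient, here patient 0) *)
Definition theta : 'cV[R]_k := \col_t Ex P (Y 0 t).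
Definition muX : 'cV[R]_p := \col_j Ex P (X 0 j).
Definition SigmaX : 'M[R]_p :=
  \matrix_(j, l) Ex P (fun x => (X 0 j x - muX j 0) * (X 0 l x - muX l 0)).
Definition covXY (t : 'I_k) : 'cV[R]_p :=
  \col_j Ex P (fun x => (X 0 j x - muX j 0) * (Y 0 t x - theta t 0)).
Definition beta_t (t : 'I_k) : 'cV[R]_p := invmx SigmaX *m covXY t.
Definition beta : 'cV[R]_p := \sum_t pi t *: beta_t t.
Definition Bscr : 'M[R]_(p, k) := \matrix_(j, t) beta_t t j 0.

Definition var_resid (t : 'I_k) (b : 'cV[R]_p) : R :=
  let Z := fun x => Y 0 t x - (b^T *m Xv 0 x) 0 0 in
  Ex P (fun x => (Z x - Ex P Z) ^+ 2).

Definition V_SR (B : 'M[R]_(p, k)) : 'M[R]_k :=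
  diag_mx (\row_t ((pi t)^-1 * var_resid t (col t B)))
  + Bscr^T *m SigmaX *m B + B^T *m SigmaX *m Bscr - B^T *m SigmaX *m B.

Definition ind (i : nat) (t : 'I_k) (x : T) : R := (A i x == t)%:R.
Definition Yobs (i : nat) (x : T) : R := Y i (A i x) x.
Definition n_t (n : nat) (t : 'I_k) (x : T) : R := \sum_(i < n) ind i t x.
Definition Ybar (n : nat) (t : 'I_k) (x : T) : R :=
  (n_t n t x)^-1 * \sum_(i < n) ind i t x * Yobs i x.
Definition Xbar_t (n : nat) (t : 'I_k) (x : T) : 'cV[R]_p :=
  (n_t n t x)^-1 *: \sum_(i < n) ind i t x *: Xv i x.
Definition Xbar (n : nat) (x : T) : 'cV[R]_p :=
  (n%:R)^-1 *: \sum_(i < n) Xv i x.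

Definition theta_hat (b : 'I_k -> 'cV[R]_p) (n : nat) (x : T) : 'cV[R]_k :=
  \col_t (Ybar n t x - ((b t)^T *m (Xbar_t n t x - Xbar n x)) 0 0).

Definition root_n_err (bh : nat -> T -> 'I_k -> 'cV[R]_p) (n : nat) (x : T)
  : 'cV[R]_k := Num.sqrt (n%:R) *: (theta_hat (bh n x) n x - theta).

Definition Sxx_t (n : nat) (t : 'I_k) (x : T) : 'M[R]_p :=
  \sum_(i < n) ind i t x *: ((Xv i x - Xbar_t n t x) *m (Xv i x - Xbar_t n t x)^T).
Definition Sxy_t (n : nat) (t : 'I_k) (x : T) : 'cV[R]_p :=
  \sum_(i < n) ind i t x *: ((Yobs i x) *: (Xv i x - Xbar_t n t x)).
Definition beta_hat (n : nat) (x : T) : 'cV[R]_p :=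
  invmx (\sum_t Sxx_t n t x) *m (\sum_t Sxy_t n t x).
Definition beta_hat_t (n : nat) (t : 'I_k) (x : T) : 'cV[R]_p :=
  invmx (Sxx_t n t x) *m Sxy_t n t x.
Definition beta_hat_t_alt (n : nat) (t : 'I_k) (x : T) : 'cV[R]_p :=
  (n%:R / n_t n t x) *:
  (invmx (\sum_(i < n) (Xv i x - Xbar n x) *m (Xv i x - Xbar n x)^T) *m Sxy_t n t x).

Definition mx_of_cols (b : 'I_k -> 'cV[R]_p) : 'M[R]_(p, k) := \matrix_(j, t) b t j 0.

End Trial.

(* Main.v *)
Require Import Defs.
From HB Require Import structures.
From mathcomp Require Import all_boot all_order all_algebra.
From mathcomp Require Import all_classical all_reals all_analysis.
From mathcomp Require Import measurable_realfun ring lra.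

Set Implicit Arguments.
Unset Strict Implicit.
Unset Printing Implicit Defensive.

Import Order.TTheory GRing.Theory Num.Theory.
Import numFieldNormedType.Exports.
Local Open Scope classical_set_scope.
Local Open Scope ring_scope.

(** Around their means, the estimators are asymptotically linear: with the centred variables
    [Yc], [Xc] and [r = Yc - b^T Xc], coordinate [t] of [sqrt n (theta_hat - theta)] equals
    [n^(-1/2) sum_i (pi_t^-1 1(A_i = a_t) r_i + b_t^T Xc_i)] up to [o_P(1)]; replacing [b_t] by a
    consistent estimate or [n_t / n] by [pi_t] costs only a product of [O_P(1)] and [o_P(1)].
    The summands are i.i.d. with covariance [V_SR].

    For the central limit theorem, characteristic functions are replaced by the real numbers
    [E cos (u^T W + y)].  Expanding [cos] and [sin] to second order gives a linear recursion for
    the pair [E cos], [E sin] of partial sums of i.i.d. variables, with limit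
    [exp (- sigma^2 / 2) cos y].  The Gaussian limit vector is built from independent normals by a
    Gram decomposition of the positive semidefinite covariance matrix.  Convergence of all the
    [E cos (u^T W_n + y)] and tightness yield convergence in distribution: on a cube, a continuous
    function is a continuous function of sines of the coordinates, and its Bernstein
    polynomials in them are trigonometric polynomials.

    The regression coefficients are consistent by a truncation proof of the weak law of large
    numbers and continuity of matrix inversion.  For optimality, the quadratic form of
    [V_SR B - V_SR Bscr] at [u] is a [pi]-weighted variance. *)

Notation Int P f := (P.-integrable setT (EFin \o f)).

Section ExpectationBasics.
Context {R : realType} {d : measure_display} {T : measurableType d}.
Variable P : probability T R.
Implicit Types f g : T -> R.

Lemma Int_measurable f : Int P f -> measurable_fun setT f.
Proof. by move=> /measurable_int /measurable_EFinP. Qed.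

Lemma Int_le f g : measurable_fun setT f -> Int P g ->
  (forall x, `|f x| <= g x) -> Int P f.
Proof.
move=> mf ig fg; apply: (le_integrable measurableT _ _ ig).
  exact/measurable_EFinP.
by move=> x _ /=; rewrite lee_fin (le_trans (fg x))// ler_norm.
Qed.

Lemma Int_cst c : Int P (fun=> c).
Proof. exact: finite_measure_integrable_cst. Qed.

Lemma Int_bounded f M : measurable_fun setT f ->
  (forall x, `|f x| <= M) -> Int P f.
Proof. by move=> mf; apply: Int_le => //; exact: Int_cst. Qed.

Lemma IntD f g : Int P f -> Int P g -> Int P (fun x => f x + g x).
Proof. by move=> fi gi; have := integrableD measurableT fi gi. Qed.

Lemma IntB f g : Int P f -> Int P g -> Int P (fun x => f x - g x).
Proof. by move=> fi gi; have := integrableB measurableT fi gi. Qed.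

Lemma IntZ c f : Int P f -> Int P (fun x => c * f x).
Proof. by move=> fi; have := integrableZl measurableT c fi. Qed.

Lemma Int_norm f : Int P f -> Int P (fun x => `|f x|).
Proof. by move=> fi; have := integrable_abse fi. Qed.

Lemma Int_sum (I : Type) (s : seq I) (Q : pred I) (h : I -> T -> R) :
  (forall i, Q i -> Int P (h i)) -> Int P (fun x => \sum_(i <- s | Q i) h i x).
Proof.
move=> hi; have := integrable_sum measurableT s hi.
by apply: eq_integrable => // x _ /=; rewrite sumEFin.
Qed.

Lemma ExD f g : Int P f -> Int P g -> Ex P (fun x => f x + g x) = Ex P f + Ex P g.
Proof. exact: RintegralD. Qed.

Lemma ExB f g : Int P f -> Int P g -> Ex P (fun x => f x - g x) = Ex P f - Ex P g.
Proof. exact: RintegralB. Qed.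

Lemma ExZ c f : Int P f -> Ex P (fun x => c * f x) = c * Ex P f.
Proof. exact: RintegralZl. Qed.

Lemma Ex_cst c : Ex P (fun=> c) = c.
Proof.
have := @Rintegral_cst _ T R P setT measurableT c; rewrite /Ex /Rintegral => ->.
by rewrite [X in fine X](@probability_setT _ _ _ P) mulr1.
Qed.

Lemma eq_Ex f g : f =1 g -> Ex P f = Ex P g.
Proof. by move=> fg; congr (Ex P); exact/funext. Qed.

Lemma Ex_sum (I : Type) (s : seq I) (Q : pred I) (h : I -> T -> R) :
  (forall i, Q i -> Int P (h i)) ->
  Ex P (fun x => \sum_(i <- s | Q i) h i x) = \sum_(i <- s | Q i) Ex P (h i).
Proof.
move=> hi; elim: s => [|i s ih].
  by rewrite big_nil -[RHS](Ex_cst 0); apply: eq_Ex => x; rewrite big_nil.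
rewrite big_cons -ih; case: ifPn => Qi; last first.
  by apply: eq_Ex => x; rewrite big_cons (negbTE Qi).
rewrite -ExD//; [|exact: hi|exact: Int_sum].
by apply: eq_Ex => x; rewrite big_cons Qi.
Qed.

Lemma le_Ex f g : Int P f -> Int P g -> (forall x, f x <= g x) -> Ex P f <= Ex P g.
Proof. by move=> fi gi fg; apply: le_Rintegral. Qed.

Lemma Ex_ge0 f : (forall x, 0 <= f x) -> 0 <= Ex P f.
Proof. by move=> f0; apply: Rintegral_ge0. Qed.

Lemma norm_Ex f : Int P f -> `|Ex P f| <= Ex P (fun x => `|f x|).
Proof. by move=> fi; apply: le_normr_Rintegral. Qed.

Lemma norm_Ex_le f g : measurable_fun setT f -> Int P g ->
  (forall x, `|f x| <= g x) -> `|Ex P f| <= Ex P g.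
Proof.
move=> mf gi fg; have fi := Int_le mf gi fg.
by apply: (le_trans (norm_Ex fi)); apply: le_Ex => //; exact: Int_norm.
Qed.

Lemma Int_indic (A : set T) : measurable A -> Int P (\1_A : T -> R).
Proof. by move=> mA; apply: integrable_indic => //; rewrite ?setIT. Qed.

Lemma Ex_indic (A : set T) : measurable A -> Ex P (\1_A : T -> R) = fine (P A).
Proof. by move=> mA; rewrite /Ex integral_indic// setIT. Qed.

Lemma fineP_le (A B : set T) : measurable A -> measurable B -> A `<=` B ->
  fine (P A) <= fine (P B).
Proof.
move=> mA mB AB; rewrite fine_le ?fin_num_measure//.
by apply: le_measure; rewrite ?inE.
Qed.

Lemma fineP_setU (A B : set T) : measurable A -> measurable B ->
  fine (P (A `|` B)) <= fine (P A) + fine (P B).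
Proof.
move=> mA mB; rewrite -fineD ?fin_num_measure// fine_le//.
- by rewrite fin_num_measure//; exact: measurableU.
- by rewrite fin_numD !fin_num_measure.
- exact: measureU2.
Qed.

Lemma norm_superlevel_measurable f c : measurable_fun setT f ->
  measurable [set x | c < `|f x|].
Proof.
move=> mf; have m1 : measurable_fun setT (fun x => `|f x|).
  exact: measurableT_comp.
by have := m1 measurableT _ (measurable_itv `]c, +oo[);
  rewrite setTI; congr measurable; apply/seteqP; split => x /=;
  rewrite in_itv/= andbT.
Qed.

Lemma markov_Ex f c : 0 < c -> Int P f ->
  fine (P [set x | c < `|f x|]) <= Ex P (fun x => `|f x|) / c.
Proof.
move=> c0 fi; have mf := Int_measurable fi.
have mA := norm_superlevel_measurable c mf.
rewrite -Ex_indic// ler_pdivlMr// mulrC -ExZ ?(Int_indic mA)//.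
apply: le_Ex => //; [exact/IntZ/Int_indic|exact: Int_norm|move=> x].
rewrite indicE; case: (boolP (x \in _)) => [|_]; last by rewrite mulr0.
by rewrite inE mulr1 => /ltW.
Qed.

Lemma IntM_sq f g : measurable_fun setT f -> measurable_fun setT g ->
  Int P (fun x => f x ^+ 2) -> Int P (fun x => g x ^+ 2) ->
  Int P (fun x => f x * g x).
Proof.
move=> mf mg f2 g2; apply: (Int_le _ (IntD f2 g2)); first exact: measurable_funM.
move=> x; rewrite normrM -[f x ^+ 2]real_normK ?num_real// -[g x ^+ 2]real_normK ?num_real//.
have := sqr_ge0 (`|f x| - `|g x|); have := sqr_ge0 (`|f x| + `|g x|); nra.
Qed.

Lemma Int_of_sq f : measurable_fun setT f -> Int P (fun x => f x ^+ 2) -> Int P f.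
Proof.
move=> mf f2; have := IntM_sq mf (@measurable_cst _ _ T R setT 1) f2 (Int_cst (1 ^+ 2)).
by apply: eq_integrable => // x _ /=; rewrite mulr1.
Qed.

Lemma chebyshev_Ex f c : 0 < c -> measurable_fun setT f ->
  Int P (fun x => f x ^+ 2) ->
  fine (P [set x | c < `|f x|]) <= Ex P (fun x => f x ^+ 2) / c ^+ 2.
Proof.
move=> c0 mf f2; have c20 : 0 < c ^+ 2 by rewrite exprn_gt0.
have := markov_Ex c20 f2.
rewrite (_ : [set x | _] = [set x | c < `|f x|]); last first.
  apply/seteqP; split => x /=;
  by rewrite normrX ltr_pXn2r// ?nnegrE ?normr_ge0 ?ltW.
by rewrite (@eq_Ex (fun x => `|_|) (fun x => f x ^+ 2)) => [//|x]; rewrite ger0_norm ?sqr_ge0.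
Qed.

End ExpectationBasics.

Section Laws.
Context {R : realType}.

Definition same_dist {d1 d2 d3 : measure_display} {T1 : measurableType d1}
    {T2 : measurableType d2} {E : measurableType d3}
    (P : probability T1 R) (U : T1 -> E) (Q : probability T2 R) (V : T2 -> E) :=
  forall A, measurable A -> P (U @^-1` A) = Q (V @^-1` A).

Context {d1 d2 d3 : measure_display} {T1 : measurableType d1}
    {T2 : measurableType d2} {E : measurableType d3}.
Variables (P : probability T1 R) (Q : probability T2 R).

Lemma same_dist_comp {d4 : measure_display} {F : measurableType d4} (g : E -> F) U V :
  measurable_fun setT g -> same_dist P U Q V -> same_dist P (g \o U) Q (g \o V).
Proof.
move=> mg UV A mA; apply: (UV (g @^-1` A)).
by rewrite -[X in measurable X]setTI; exact: mg.
Qed.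

Lemma Int_same_dist (U : T1 -> E) (V : T2 -> E) (f : E -> R) :
  measurable_fun setT U -> measurable_fun setT V -> measurable_fun setT f ->
  same_dist P U Q V -> Int Q (f \o V) -> Int P (f \o U).
Proof.
move=> mU mV mf UV /integrableP[_ fin]; apply/integrableP; split.
  by apply/measurable_EFinP; exact: measurableT_comp.
pose U' : {mfun T1 >-> E} := mfun_Sub (mem_set mU).
pose V' : {mfun T2 >-> E} := mfun_Sub (mem_set mV).
have mf' : measurable_fun setT (abse \o (EFin \o f)).
  by apply: measurableT_comp => //; exact/measurable_EFinP.
have h1 := @ge0_integral_distribution _ _ T1 E R P U' (abse \o (EFin \o f)) mf' (fun=> abse_ge0 _).
have h2 := @ge0_integral_distribution _ _ T2 E R Q V' (abse \o (EFin \o f)) mf' (fun=> abse_ge0 _).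
move: fin; rewrite [X in (X < _)%E -> _](_ : _ = \int[distribution Q V']_y (abse \o (EFin \o f)) y)%E.
  rewrite [X in _ -> (X < _)%E](_ : _ = \int[distribution P U']_y (abse \o (EFin \o f)) y)%E.
    rewrite (eq_measure_integral (distribution P U')) => [//|A mA _].
    exact/esym/UV.
  by rewrite h1.
by rewrite h2.
Qed.

Lemma Ex_same_dist (U : T1 -> E) (V : T2 -> E) (f : E -> R) :
  measurable_fun setT U -> measurable_fun setT V -> measurable_fun setT f ->
  same_dist P U Q V -> Int Q (f \o V) -> Ex P (f \o U) = Ex Q (f \o V).
Proof.
move=> mU mV mf UV fV; have fU := Int_same_dist mU mV mf UV fV.
pose U' : {mfun T1 >-> E} := mfun_Sub (mem_set mU).
pose V' : {mfun T2 >-> E} := mfun_Sub (mem_set mV).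
have mf' : measurable_fun setT (EFin \o f) by exact/measurable_EFinP.
have h1 := @integral_distribution _ _ T1 E R P U' (EFin \o f) mf' fU.
have h2 := @integral_distribution _ _ T2 E R Q V' (EFin \o f) mf' fV.
rewrite /Ex; congr fine; rewrite -[LHS]h1 -[RHS]h2.
apply: eq_measure_integral => A mA _.
exact: UV.
Qed.

End Laws.

Section Independence.
Context {R : realType} {d : measure_display} {T : measurableType d}.
Variable P : probability T R.

Definition indep2 (U V : T -> R) := forall A B, measurable A -> measurable B ->
  P ((U @^-1` A) `&` (V @^-1` B)) = (P (U @^-1` A) * P (V @^-1` B))%E.

Lemma indep2_comp (f g : R -> R) U V :
  measurable_fun setT f -> measurable_fun setT g ->
  indep2 U V -> indep2 (f \o U) (g \o V).
Proof.
move=> mf mg UV A B mA mB; apply: (UV (f @^-1` A) (g @^-1` B)).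
  by rewrite -[X in measurable X]setTI; exact: mf.
by rewrite -[X in measurable X]setTI; exact: mg.
Qed.

Lemma Ex_indepM (U V : T -> R) : Int P U -> Int P V -> indep2 U V ->
  Int P (fun x => U x * V x) /\ Ex P (fun x => U x * V x) = Ex P U * Ex P V.
Proof.
move=> iU iV UV; have mU := Int_measurable iU; have mV := Int_measurable iV.
pose U' : {mfun T >-> R} := mfun_Sub (mem_set mU).
pose V' : {mfun T >-> R} := mfun_Sub (mem_set mV).
have mUV : measurable_fun setT (fun x => (U x, V x)) by exact: measurable_fun_pair.
pose W' : {mfun T >-> (R * R)%type} := mfun_Sub (mem_set mUV).
pose m1 := distribution P U'; pose m2 := distribution P V'.
have joint : forall A, measurable A -> (m1 \x m2)%E A = distribution P W' A.
  by move=> A mA; apply: product_measure_unique => // B C mB mC; exact: UV.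
pose f (z : R * R) : \bar R := (z.1 * z.2)%:E.
have mf : measurable_fun setT f.
  by apply/measurable_EFinP; apply: measurable_funM;
    [exact: measurable_fst|exact: measurable_snd].
have i1 : m1.-integrable setT (EFin : R -> \bar R).
  by have := @integrable_pushforward _ _ T R R U' mU P setT EFin; apply => //;
    exact/measurable_EFinP.
have i2 : m2.-integrable setT (EFin : R -> \bar R).
  by have := @integrable_pushforward _ _ T R R V' mV P setT EFin; apply => //;
    exact/measurable_EFinP.
have e1 : (\int[m1]_y y%:E = (Ex P U)%:E)%E.
  rewrite [LHS](@integral_distribution _ _ T R R P U' EFin)//.
  by rewrite /Ex fineK//; apply: integrable_fin_num.
have e2 : (\int[m2]_y y%:E = (Ex P V)%:E)%E.
  rewrite [LHS](@integral_distribution _ _ T R R P V' EFin)//.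
  by rewrite /Ex fineK//; apply: integrable_fin_num.
have intf : (m1 \x m2)%E.-integrable setT f.
  apply/integrable12ltyP => //.
  have E2 : (\int[m2]_y `|y%:E| < +oo)%E by case/integrableP: i2.
  have E1 : (\int[m1]_y `|y%:E| < +oo)%E by case/integrableP: i1.
  rewrite (_ : (\int[m1]_x _)%E = (\int[m1]_x (`|x%:E| * \int[m2]_y `|y%:E|))%E); last first.
    apply: eq_integral => x _; rewrite -ge0_integralZl//; last first.
      by apply: measurableT_comp => //; exact/measurable_EFinP.
    by apply: eq_integral => y _; rewrite /f/= normrM.
  have finE2 : (\int[m2]_y `|y%:E|)%E \is a fin_num.
    by rewrite ge0_fin_numE// integral_ge0.
  rewrite ge0_integralZr//; last first.
  - exact: integral_ge0.
  - by apply: measurableT_comp => //; exact/measurable_EFinP.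
  rewrite lte_mul_pinfty//; first exact: integral_ge0.
  by rewrite ge0_fin_numE// integral_ge0.
have intW : (distribution P W').-integrable setT f.
  case/integrableP : intf => _ fin; apply/integrableP; split => //.
  by rewrite (eq_measure_integral (m1 \x m2)%E) => [//|A mA _]; exact/esym/joint.
have intUV : Int P (fun x => U x * V x).
  case/integrableP : intW => _ fin; apply/integrableP; split.
    by apply/measurable_EFinP; exact: measurable_funM.
  move: fin; rewrite (@ge0_integral_distribution _ _ T _ R P W' (abse \o f))//.
    exact: measurableT_comp.
  by move=> z; exact: abse_ge0.
split=> //; apply/eqP; rewrite -eqe; apply/eqP.
rewrite {1}/Ex fineK; last exact: integrable_fin_num.
rewrite -[LHS](@integral_distribution _ _ T _ R P W' f)//.
rewrite (eq_measure_integral (m1 \x m2)%E); last by move=> A mA _; exact/esym/joint.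
rewrite -integral12_prod_meas1// /fubini_F.
transitivity (\int[m1]_x (x%:E * (Ex P V)%:E))%E.
  by apply: eq_integral => x _; rewrite -e2 -integralZl//; exact: i2.
by rewrite integralZr// e1.
Qed.

(* Uniqueness of measures is applied twice: first with the event of the second
   pi-system fixed, then with the event of the first sigma-algebra fixed. *)
Lemma indep_sigma (G H : set (set T)) :
  G `<=` measurable -> H `<=` measurable -> setI_closed G -> setI_closed H ->
  G setT -> H setT ->
  (forall A B, G A -> H B -> P (A `&` B) = (P A * P B)%E) ->
  forall A B, <<s G >> A -> <<s H >> B -> P (A `&` B) = (P A * P B)%E.
Proof.
move=> mG mH IG IH GT HT GH.
have half (K : set (set T)) (B : set T) : K `<=` measurable -> setI_closed K -> K setT ->
    measurable B -> (forall A, K A -> P (A `&` B) = (P A * P B)%E) ->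
    forall A, <<s K >> A -> P (A `&` B) = (P A * P B)%E.
  move=> mK IK KT mB KB A sA.
  have PB0 : 0 <= fine (P B) by rewrite fine_ge0.
  have mA : measurable A.
    by apply: (@smallest_sub _ _ _ _ _ _ A sA) => //; exact: sigma_algebra_measurable.
  have sE C : mscale (NngNum PB0) P C = (P C * P B)%E.
    by rewrite /mscale/= fineK ?fin_num_measure// muleC.
  rewrite -sE; apply: (@g_sigma_algebra_measure_unique _ R T K mK (fun=> setT) (fun=> KT) _
    (mrestr P mB) (mscale (NngNum PB0) P) IK) => //.
  - by rewrite bigcup_const.
  - by move=> C KC; rewrite [RHS]sE -KB.
  - move=> _; apply: (@le_lt_trans _ _ 1%E); last exact: ltry.
    by apply: probability_le1; exact: measurableI.
have sm (K : set (set T)) A : K `<=` measurable -> <<s K >> A -> measurable A.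
  move=> mK sA.
  by apply: (@smallest_sub _ _ _ _ _ _ A sA) => //; exact: sigma_algebra_measurable.
move=> A B sA sB; have mA := sm _ _ mG sA.
rewrite setIC muleC; apply: (half H) => // C HC.
rewrite setIC muleC; apply: (half G) => //; first exact: mH.
by move=> D GD; exact: GH.
Qed.

End Independence.

Section TrigBounds.
Context {R : realType}.
Implicit Types t : R.

Lemma mvt0 (f df : R -> R) : f 0 = 0 -> (forall x : R, is_derive x 1 f (df x)) ->
  forall t, exists2 c, `|c| <= `|t| & f t = df c * t.
Proof.
move=> f0 dfE t.
have cf : continuous f.
  by move=> x; apply: differentiable_continuous; apply/derivable1_diffP; case: (dfE x).
have [t0|/ltW t0] := leP 0 t.
  have [c] := MVT_segment t0 (fun x _ => dfE x) (continuous_subspaceT cf).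
  rewrite in_itv/= => /andP[c0 ct]; rewrite f0 !subr0 => ->.
  by exists c => //; rewrite !ger0_norm// (le_trans c0).
have [c] := MVT_segment t0 (fun x _ => dfE x) (continuous_subspaceT cf).
rewrite in_itv/= => /andP[ct c0]; rewrite f0 !sub0r mulrN => /oppr_inj ->.
by exists c => //; rewrite !ler0_norm// lerN2.
Qed.

Lemma norm_sin_le t : `|sin t| <= `|t|.
Proof.
have [c _ ->] := mvt0 (@sin0 R) (@is_derive_sin R) t.
by rewrite normrM ler_piMl// ler_norml cos_le1 cos_geN1.
Qed.

Lemma norm_cosB1_le t : `|cos t - 1| <= `|t| ^+ 2 /\ `|cos t - 1| <= `|t|.
Proof.
have [||c ct ->] := @mvt0 (fun x => cos x - 1) (fun x => - sin x) _ _ t.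
- by rewrite cos0 subrr.
- by move=> x; apply: is_derive_eq; rewrite subr0.
rewrite normrM normrN; split.
  by rewrite expr2 ler_wpM2r// (le_trans (norm_sin_le c)).
by rewrite ler_piMl// ler_norml sin_le1 sin_geN1.
Qed.

Lemma norm_sinB_le t : `|sin t - t| <= `|t| ^+ 3 /\ `|sin t - t| <= `|t| ^+ 2.
Proof.
have [|c ct ->] := @mvt0 (fun x => sin x - x) (fun x => cos x - 1) _ _ t.
  by rewrite sin0 subrr.
have [h1 h2] := norm_cosB1_le c; rewrite normrM; split.
  rewrite exprSr ler_wpM2r// (le_trans h1)// lerXn2r// nnegrE//.
by rewrite expr2 ler_wpM2r// (le_trans h2).
Qed.

Lemma norm_cos_taylor_le t :
  `|cos t - 1 + t ^+ 2 / 2| <= t ^+ 4 /\ `|cos t - 1 + t ^+ 2 / 2| <= 2 * t ^+ 2.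
Proof.
have [||c ct ->] := @mvt0 (fun x => cos x - 1 + x ^+ 2 / 2) (fun x => - (sin x - x)) _ _ t.
- by rewrite cos0 subrr expr0n/= mul0r addr0.
- move=> x; apply: is_derive_eq.
  by rewrite /GRing.scale/=; field.
have [h1 h2] := norm_sinB_le c; rewrite normrM normrN; split.
  rewrite -[t ^+ 4]ger0_norm ?exprn_even_ge0// normrX [leRHS]exprSr ler_wpM2r//.
  by rewrite (le_trans h1)// lerXn2r// nnegrE.
rewrite -[t ^+ 2]ger0_norm ?sqr_ge0// normrX expr2 mulrA ler_wpM2r//.
by rewrite (le_trans (ler_normB _ _))// mulr_natl mulr2n lerD// (le_trans (norm_sin_le c)).
Qed.

Lemma norm_expRN_le (s : R) : 0 <= s -> `|expR (- s) - 1 + s| <= s ^+ 2.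
Proof.
move=> s0; have h1 := expR_ge1Dx (- s); have h2 := expR_ge1Dx s.
rewrite ger0_norm; last lra.
have e0 := expR_gt0 (- s).
have : expR (- s) * (1 + s) <= 1.
  by rewrite -[leRHS](mulVf (lt0r_neq0 (expR_gt0 s))) -expRN ler_wpM2l// ltW.
nra.
Qed.

Lemma measurable_cos : measurable_fun setT (@cos R).
Proof. by apply: continuous_measurable_fun; exact: continuous_cos. Qed.

Lemma measurable_sin : measurable_fun setT (@sin R).
Proof. by apply: continuous_measurable_fun; exact: continuous_sin. Qed.

Lemma norm_cos_le1 (x : R) : `|cos x| <= 1.
Proof. by rewrite ler_norml cos_le1 cos_geN1. Qed.

Lemma norm_sin_le1 (x : R) : `|sin x| <= 1.
Proof. by rewrite ler_norml sin_le1 sin_geN1. Qed.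

Lemma cos_lip (x y : R) : `|cos x - cos y| <= `|x - y|.
Proof.
have [||c _ e] := @mvt0 (fun h => cos (y + h) - cos y) (fun h => - sin (y + h)) _ _ (x - y).
- by rewrite addr0 subrr.
- move=> h.
  have h1 : is_derive h 1 (fun h => y + h) 1.
    by have := is_deriveD (is_derive_cst y h 1) (is_derive_id h 1); rewrite add0r.
  have := is_derive1_comp (is_derive_cos (y + h)) h1.
  rewrite mulr1 => h2; have := is_deriveB h2 (is_derive_cst (cos y) h 1).
  by rewrite subr0.
move: e; rewrite (_ : y + (x - y) = x) => [->|]; last by ring.
by rewrite normrM normrN ler_piMl// norm_sin_le1.
Qed.

End TrigBounds.

Section CosCLT.
Context {R : realType}.

Lemma cos_rec_bound (Phi : nat -> R -> R) (a b r : R) : 0 <= r <= 1 ->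
  (forall y, Phi 0%N y = cos y) ->
  (forall m y, Phi m.+1 y = a * Phi m y + b * Phi m (y + pi / 2)) ->
  (forall m y, `|Phi m y| <= 1) ->
  forall n y, `|Phi n y - r ^+ n * cos y| <= n%:R * (`|a - r| + `|b|).
Proof.
move=> /andP[r0 r1] P0 PS P1; elim=> [|n ih] y.
  by rewrite P0 expr0 !mul1r subrr normr0 mul0r.
rewrite PS exprS.
rewrite (_ : _ - _ = (a - r) * Phi n y + b * Phi n (y + pi / 2)
   + r * (Phi n y - r ^+ n * cos y)); last by ring.
have -> : n.+1%:R * (`|a - r| + `|b|) = (`|a - r| + `|b|) + n%:R * (`|a - r| + `|b|).
  by rewrite -[n.+1]add1n natrD mulrDl mul1r.
rewrite (le_trans (ler_normD _ _))// lerD//; last first.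
  by rewrite normrM ger0_norm// (le_trans _ (ih y))// ler_piMl.
by rewrite (le_trans (ler_normD _ _))// !normrM lerD// ler_piMr.
Qed.

Lemma Ex_dominated_cvg {d : measure_display} {T : measurableType d} (P : probability T R)
    (f_ : nat -> T -> R) (f g : T -> R) :
  (forall n, measurable_fun setT (f_ n)) -> Int P g ->
  (forall n x, `|f_ n x| <= g x) -> (forall x, f_ ^~ x @ \oo --> f x) ->
  Ex P (f_ n) @[n --> \oo] --> Ex P f.
Proof.
move=> mf gi fg cf.
have h := @dominated_cvg _ T R P setT measurableT (fun n => EFin \o f_ n) (EFin \o f)
  (EFin \o g) _ _ _ gi _.
apply: fine_cvg; rewrite fineK.
  apply: h => //.
  - by move=> n; exact/measurable_EFinP.
  - by move=> x _ /=; apply: cvg_EFin; [exact: nearW|exact: cf].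
  - by move=> n x _; rewrite /= lee_fin.
apply: integrable_fin_num => //; apply: (Int_le _ gi).
  apply: (measurable_fun_cvg mf) => // x _; exact: cf.
move=> x; have c1 : `|f_ n x| @[n --> \oo] --> `|f x| by apply: cvg_norm; exact: cf.
by apply: (ler_cvg_to c1 (cvg_cst (g x))); apply: nearW => n; exact: fg.
Qed.

Lemma cvg_norm_harmonic (u : nat -> R) (c : R) :
  (forall n, (0 < n)%N -> `|u n| <= c / n%:R) -> u @ \oo --> (0 : R).
Proof.
move=> h; apply/cvgrPdist_le => e e0; near=> n.
have n0 : (0 < n)%N by near: n; exact: nbhs_infty_gt.
rewrite sub0r normrN (le_trans (h n n0))// ler_pdivrMr ?ltr0n//.
rewrite -ler_pdivrMl// (le_trans (ler_norm _))//.
near: n; exact: nbhs_infty_ger.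
Unshelve. all: end_near. Qed.

Lemma cvg_norm_sqrt (c : R) (u : nat -> R) :
  (forall n, (0 < n)%N -> `|u n| <= c / Num.sqrt n%:R) -> u @ \oo --> (0 : R).
Proof.
move=> h; apply/cvgrPdist_le => e e0; near=> n.
have n0 : (0 < n)%N by near: n; exact: nbhs_infty_gt.
have sn0 : 0 < Num.sqrt (n%:R : R) by rewrite sqrtr_gt0 ltr0n.
rewrite sub0r normrN (le_trans (h n n0))// ler_pdivrMr// -ler_pdivrMl//.
rewrite (le_trans (ler_norm _))// -sqrtr_sqr ler_sqrt ?ler0n//.
near: n; exact: nbhs_infty_ger.
Unshelve. all: end_near. Qed.

Context {d : measure_display} {T : measurableType d} (P : probability T R).
Variable eta : T -> R.
Hypothesis meta : measurable_fun setT eta.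
Hypothesis eta2 : Int P (fun x => eta x ^+ 2).
Hypothesis eta0 : Ex P eta = 0.

Let s2 := Ex P (fun x => eta x ^+ 2).
Let a n := Ex P (fun x => cos (eta x / Num.sqrt n%:R)).
Let b n := Ex P (fun x => sin (eta x / Num.sqrt n%:R)).

Let msc n : measurable_fun setT (fun x => eta x / Num.sqrt n%:R).
Proof. exact: measurable_funM. Qed.

Let sq_sqrtn n : (Num.sqrt (n%:R : R)) ^+ 2 = n%:R.
Proof. by rewrite sqr_sqrtr. Qed.

Let cos_term : n%:R * (a n - 1 + s2 / n%:R / 2) @[n --> \oo] --> (0 : R).
Proof.
have h : Ex P (fun x => n%:R * (cos (eta x / Num.sqrt n%:R) - 1 +
     (eta x / Num.sqrt n%:R) ^+ 2 / 2)) @[n --> \oo] --> Ex P (fun=> 0).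
  apply: (Ex_dominated_cvg (g := fun x => 2 * eta x ^+ 2)).
  - move=> n; apply: measurable_funM => //; apply: measurable_funD.
      by apply: measurable_funB => //; apply: measurableT_comp => //; exact: measurable_cos.
    by apply: measurable_funM => //; exact: measurable_funX.
  - exact: IntZ.
  - move=> [|n] x; first by rewrite mul0r normr0 mulr_ge0// sqr_ge0.
    have [_ h] := norm_cos_taylor_le (eta x / Num.sqrt n.+1%:R).
    rewrite normrM ger0_norm// -ler_pdivlMl// (le_trans h)//.
    by rewrite expr_div_n sq_sqrtn le_eqVlt; apply/orP; left; apply/eqP; field.
  - move=> x; apply: (@cvg_norm_harmonic _ (eta x ^+ 4)) => n n0.
    have [h _] := norm_cos_taylor_le (eta x / Num.sqrt n%:R).
    rewrite normrM ger0_norm// -ler_pdivlMl ?ltr0n// (le_trans h)//.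
    rewrite expr_div_n (_ : Num.sqrt n%:R ^+ 4 = (n%:R : R) ^+ 2); last by rewrite -[in RHS](sq_sqrtn n) -exprM.
    rewrite le_eqVlt; apply/orP; left; apply/eqP; field.
    by rewrite pnatr_eq0 -lt0n.
rewrite Ex_cst in h; apply: cvg_trans h; apply: near_eq_cvg; near=> n.
have n0 : (0 < n)%N by near: n; exact: nbhs_infty_gt.
have ic : Int P (fun x => cos (eta x / Num.sqrt n%:R)).
  by apply: (@Int_bounded _ _ _ _ _ 1) => [|x]; [apply: measurableT_comp => //; exact: measurable_cos|exact: norm_cos_le1].
rewrite (@eq_Ex _ _ _ _ _ (fun x => n%:R * (cos (eta x / Num.sqrt n%:R) - 1) + 2^-1 * eta x ^+ 2)).
  rewrite ExD; [|exact/IntZ/IntB/Int_cst|exact: IntZ].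
  rewrite ExZ; last exact/IntB/Int_cst.
  rewrite ExB ?Ex_cst//; last exact: Int_cst.
  rewrite ExZ// -/s2 /a; field.
  by rewrite pnatr_eq0 -lt0n.
move=> x; rewrite expr_div_n sq_sqrtn; field.
by rewrite pnatr_eq0 -lt0n.
Unshelve. all: end_near. Qed.

Let sin_term : n%:R * b n @[n --> \oo] --> (0 : R).
Proof.
have h : Ex P (fun x => n%:R * (sin (eta x / Num.sqrt n%:R) - eta x / Num.sqrt n%:R))
   @[n --> \oo] --> Ex P (fun=> 0).
  apply: (Ex_dominated_cvg (g := fun x => eta x ^+ 2)) => //.
  - move=> n; apply: measurable_funM => //; apply: measurable_funB => //.
    by apply: measurableT_comp => //; exact: measurable_sin.
  - move=> [|n] x; first by rewrite mul0r normr0 sqr_ge0.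
    have [_ h] := norm_sinB_le (eta x / Num.sqrt n.+1%:R).
    rewrite normrM ger0_norm// -ler_pdivlMl// (le_trans h)//.
    rewrite -normrX ger0_norm ?sqr_ge0// expr_div_n sq_sqrtn.
    by rewrite le_eqVlt; apply/orP; left; apply/eqP; field.
  - move=> x; apply: (@cvg_norm_sqrt (`|eta x| ^+ 3)) => n n0.
    have sn0 : 0 < Num.sqrt (n%:R : R) by rewrite sqrtr_gt0 ltr0n.
    have [h _] := norm_sinB_le (eta x / Num.sqrt n%:R).
    rewrite normrM ger0_norm// -ler_pdivlMl ?ltr0n// (le_trans h)//.
    rewrite normrM exprMn normfV (ger0_norm (ltW sn0)) exprVn.
    have -> : (Num.sqrt (n%:R : R)) ^- 3 = n%:R^-1 * (Num.sqrt (n%:R : R))^-1.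
      by rewrite exprSr sq_sqrtn invfM.
    by rewrite mulrCA.
rewrite Ex_cst in h; apply: cvg_trans h; apply: near_eq_cvg; near=> n.
have ic : Int P (fun x => sin (eta x / Num.sqrt n%:R)).
  by apply: (@Int_bounded _ _ _ _ _ 1) => [|x]; [apply: measurableT_comp => //; exact: measurable_sin|exact: norm_sin_le1].
have ie := Int_of_sq meta eta2.
have ie' : Int P (fun x => eta x / Num.sqrt n%:R).
  by have := IntZ (Num.sqrt n%:R)^-1 ie; apply: eq_integrable => // x _ /=; rewrite mulrC.
rewrite ExZ; last exact: IntB.
rewrite ExB// (@eq_Ex _ _ _ _ (fun x => eta x / _) (fun x => (Num.sqrt n%:R)^-1 * eta x)).
  by rewrite ExZ// eta0 mulr0 subr0.
by move=> x; rewrite mulrC.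
Unshelve. all: end_near. Qed.

Lemma clt_cos_rec (Phi : nat -> nat -> R -> R) :
  (forall n y, Phi n 0%N y = cos y) ->
  (forall n m y, Phi n m.+1 y = Ex P (fun x => cos (eta x / Num.sqrt n%:R)) * Phi n m y
     + Ex P (fun x => sin (eta x / Num.sqrt n%:R)) * Phi n m (y + pi / 2)) ->
  (forall n m y, `|Phi n m y| <= 1) ->
  forall y, Phi n n y @[n --> \oo] -->
    expR (- (Ex P (fun x => eta x ^+ 2) / 2)) * cos y.
Proof.
move=> Phi0 PhiS Phi1 y; rewrite -/s2.
have s20 : 0 <= s2 by apply: Ex_ge0 => x; exact: sqr_ge0.
pose r n := expR (- (s2 / 2 / n%:R)).
have r01 n : 0 <= r n <= 1.
  by rewrite expR_ge0/= -expR0 ler_expR oppr_le0 !divr_ge0.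
have rterm : n%:R * (r n - 1 + s2 / 2 / n%:R) @[n --> \oo] --> (0 : R).
  apply: (@cvg_norm_harmonic _ ((s2 / 2) ^+ 2)) => n n0.
  rewrite normrM ger0_norm// -ler_pdivlMl ?ltr0n//.
  rewrite (le_trans (norm_expRN_le _)) ?divr_ge0//.
  rewrite expr_div_n le_eqVlt; apply/orP; left; apply/eqP; field.
  by rewrite pnatr_eq0 -lt0n.
have bound : `|n%:R * (a n - 1 + s2 / n%:R / 2) - n%:R * (r n - 1 + s2 / 2 / n%:R)|
     + `|n%:R * b n| @[n --> \oo] --> (0 : R).
  have e0 : (0 : R) = `|(0 - 0 : R)| + `|(0 : R)| by rewrite subrr !normr0 addr0.
  rewrite [X in _ --> X]e0; apply: cvgD; last exact: cvg_norm.
  by apply: cvg_norm; exact: cvgB.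
apply/cvgrPdist_le => e e0; near=> n.
have n0 : (0 < n)%N by near: n; exact: nbhs_infty_gt.
have nn : (n%:R : R) != 0 by rewrite pnatr_eq0 -lt0n.
have rn : r n ^+ n = expR (- (s2 / 2)).
  by rewrite -expRM_natl; congr expR; field.
rewrite -rn distrC.
have := @cos_rec_bound (Phi n) (a n) (b n) (r n) (r01 n) (Phi0 n) (PhiS n) (Phi1 n) n y.
move=> /le_trans -> //.
have : `|n%:R * (a n - 1 + s2 / n%:R / 2) - n%:R * (r n - 1 + s2 / 2 / n%:R)|
     + `|n%:R * b n| <= e.
  rewrite (le_trans (ler_norm _))// -[X in `|X|]subr0 distrC.
  by near: n; move/cvgrPdist_le : bound; exact.
rewrite -mulrBr !normrM -mulrDr ger0_norm//.
by rewrite (_ : _ - (r n - 1 + _) = a n - r n); last by field.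
Unshelve. all: end_near. Qed.

End CosCLT.

Section CosCLTSequence.
Context {R : realType} {d : measure_display} {T : measurableType d}.
Variable P : probability T R.

Lemma Ex_cosD_indep (U V : T -> R) : measurable_fun setT U -> measurable_fun setT V ->
  indep2 P U V ->
  Ex P (fun x => cos (U x + V x)) = Ex P (fun x => cos (V x)) * Ex P (fun x => cos (U x))
    + Ex P (fun x => sin (V x)) * Ex P (fun x => cos (U x + pi / 2)).
Proof.
move=> mU mV UV.
have ic W : measurable_fun setT W -> Int P (fun x => cos (W x)).
  move=> mW; apply: (@Int_bounded _ _ _ _ _ 1) => [|x]; last exact: norm_cos_le1.
  by apply: measurableT_comp => //; exact: measurable_cos.
have isn W : measurable_fun setT W -> Int P (fun x => sin (W x)).
  move=> mW; apply: (@Int_bounded _ _ _ _ _ 1) => [|x]; last exact: norm_sin_le1.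
  by apply: measurableT_comp => //; exact: measurable_sin.
have [i1 e1] := Ex_indepM (ic _ mU) (ic _ mV) (indep2_comp measurable_cos measurable_cos UV).
have [i2 e2] := Ex_indepM (isn _ mU) (isn _ mV) (indep2_comp measurable_sin measurable_sin UV).
rewrite (@eq_Ex _ _ _ _ _ (fun x => cos (U x) * cos (V x) - sin (U x) * sin (V x))); last first.
  by move=> x; rewrite cosD.
rewrite ExB// e1 e2 (@eq_Ex _ _ _ _ (fun x => cos (U x + pi / 2)) (fun x => (-1) * sin (U x))).
  rewrite ExZ; [by ring|exact: isn].
by move=> x; rewrite cosDpihalf mulN1r.
Qed.

Lemma clt_cos (eta : nat -> T -> R) :
  (forall i, measurable_fun setT (eta i)) ->
  (forall i, same_dist P (eta i) P (eta 0%N)) ->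
  (forall m, indep2 P (fun x => \sum_(i < m) eta i x) (eta m)) ->
  Int P (fun x => eta 0%N x ^+ 2) -> Ex P (eta 0%N) = 0 ->
  forall y, Ex P (fun x => cos ((\sum_(i < n) eta i x) / Num.sqrt n%:R + y)) @[n --> \oo] -->
    expR (- (Ex P (fun x => eta 0%N x ^+ 2) / 2)) * cos y.
Proof.
move=> meta seta ind eta2 eta0 y.
have mS m : measurable_fun setT (fun x => \sum_(i < m) eta i x).
  by apply: measurable_sum => i.
pose Phi n m y := Ex P (fun x => cos ((\sum_(i < m) eta i x) / Num.sqrt n%:R + y)).
apply: (@clt_cos_rec _ _ _ _ _ (meta 0%N) eta2 eta0 Phi).
- move=> n z; rewrite /Phi -[RHS](Ex_cst P); apply: eq_Ex => x.
  by rewrite big_ord0 mul0r add0r.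
- move=> n m z; rewrite /Phi.
  have sc (f : R -> R) : measurable_fun setT f -> (forall x, `|f x| <= 1) ->
      Ex P (fun x => f (eta m x / Num.sqrt n%:R)) = Ex P (fun x => f (eta 0%N x / Num.sqrt n%:R)).
    move=> mf f1.
    have mf' : measurable_fun setT (fun u : R => f (u / Num.sqrt n%:R)).
      by apply: measurableT_comp => //; exact: mulrr_measurable.
    apply: (Ex_same_dist (meta m) (meta 0%N) mf' (seta m)).
    apply: (@Int_bounded _ _ _ _ _ 1) => [|x]; last exact: f1.
    exact: (measurableT_comp mf' (meta 0%N)).
  rewrite -(sc cos measurable_cos norm_cos_le1) -(sc sin measurable_sin norm_sin_le1).
  pose U x := (\sum_(i < m) eta i x) / Num.sqrt n%:R + z.
  pose V x := eta m x / Num.sqrt n%:R.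
  rewrite (@eq_Ex _ _ _ _ _ (fun x => cos (U x + V x))); last first.
    by move=> x; rewrite big_ord_recr /= /U /V mulrDl addrAC.
  rewrite (@Ex_cosD_indep U V).
  - by congr (_ + _ * _); apply: eq_Ex => x; rewrite /U addrA.
  - by apply: measurable_funD => //; exact: measurable_funM.
  - exact: measurable_funM.
  - apply: (@indep2_comp _ _ _ P (fun u => u / Num.sqrt n%:R + z) (fun u => u / Num.sqrt n%:R)) => //.
      by apply: measurable_funD => //; exact: mulrr_measurable.
    exact: mulrr_measurable.
- move=> n m z; rewrite -[leRHS](Ex_cst P 1).
  apply: norm_Ex_le; [|exact: Int_cst|by move=> x; exact: norm_cos_le1].
  apply: measurableT_comp; first exact: measurable_cos.
  by apply: measurable_funD => //; exact: measurable_funM.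
Qed.

End CosCLTSequence.

Section NormalLaws.
Context {R : realType}.
Local Notation mu := (@lebesgue_measure R).
Local Notation N01 := (@normal_prob R 0 1).

Lemma lebesgue_measure_affine (x c : R) (A : set (measurableTypeR R)) : c != 0 ->
  measurable A -> mu A = (`|c|%:E * mu ((fun z : R => (x + c * z)%R) @^-1` A))%E.
Proof.
move=> c0 mA.
have mphi : measurable_fun setT ((fun z => x + c * z) : measurableTypeR R -> measurableTypeR R).
  by apply: measurable_funD => //; exact: measurable_funM.
pose nu := @measure_function_pushforward__canonical__measure_function_Measure _ _ _ _ _ mu _ mphi.
rewrite (@lebesgue_measure_unique R (mscale (NngNum (normr_ge0 c)) nu))//.
move=> _ [[a b] _ <-].
change (mu `]a, b] = (`|c|%:E * mu ((fun z : R => (x + c * z)%R) @^-1` `]a, b]))%E).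
have [cp|cn] := ltP 0 c.
  rewrite (_ : _ @^-1` _ = `](a - x) / c, (b - x) / c]%classic); last first.
    apply/seteqP; split => z /=; rewrite !in_itv/= ltr_pdivrMr// ler_pdivlMr//;
      by rewrite ltrBlDl lerBrDl [z * c]mulrC.
  rewrite !lebesgue_measure_itv/= !lte_fin ltr_pM2r ?invr_gt0// ltrD2r.
  case: ifPn => // _; last by rewrite mule0.
  rewrite gtr0_norm// -!EFinB -EFinM; congr EFin; field.
  by rewrite gt_eqF.
have {}cn : c < 0 by rewrite lt_neqAle c0.
rewrite (_ : _ @^-1` _ = `[(b - x) / c, (a - x) / c[%classic); last first.
  apply/seteqP; split => z /=; rewrite !in_itv/= ltr_ndivlMr// ler_ndivrMr//;
    by rewrite ltrBlDl lerBrDl [z * c]mulrC andbC.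
rewrite !lebesgue_measure_itv/= !lte_fin ltr_nM2r ?invr_lt0// ltrD2r.
case: ifPn => // _; last by rewrite mule0.
rewrite ltr0_norm// -!EFinB -EFinM; congr EFin; field.
by rewrite lt_eqF.
Qed.

Lemma ge0_integral_affine (x c : R) (f : R -> R) : c != 0 ->
  measurable_fun setT f -> (forall y, 0 <= f y) ->
  (\int[mu]_z (`|c| * f (x + c * z))%:E = \int[mu]_y (f y)%:E)%E.
Proof.
move=> c0 mf f0.
have mphi : measurable_fun setT ((fun z => x + c * z) : measurableTypeR R -> measurableTypeR R).
  by apply: measurable_funD => //; exact: measurable_funM.
pose nu := @measure_function_pushforward__canonical__measure_function_Measure _ _ _ _ _ mu _ mphi.
rewrite [RHS](eq_measure_integral (mscale (NngNum (normr_ge0 c)) nu)); last first.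
  by move=> A mA _; exact: (lebesgue_measure_affine x c0 mA).
rewrite ge0_integral_mscale//; last 2 first.
- exact/measurable_EFinP.
- by move=> y _; rewrite lee_fin.
rewrite [X in (_ = _ * X)%E](ge0_integral_pushforward mphi)//; last 2 first.
- exact/measurable_EFinP.
- by move=> y _; rewrite lee_fin.
rewrite preimage_setT -ge0_integralZl//.
- apply/measurable_EFinP; exact: (measurableT_comp mf mphi).
- by move=> z _ /=; rewrite lee_fin.
Qed.

Lemma normal_pdfE (m s x : R) : s != 0 ->
  normal_pdf m s x = normal_peak s * expR (- (x - m) ^+ 2 / (s ^+ 2 *+ 2)).
Proof. by move=> s0; rewrite normal_pdfE. Qed.

Lemma normal_peakM (s c : R) : normal_peak (s * c) = `|s|^-1 * normal_peak c.
Proof.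
rewrite /normal_peak.
have -> : (s * c) ^+ 2 * pi *+ 2 = s ^+ 2 * (c ^+ 2 * pi *+ 2).
  by rewrite exprMn -mulrA mulrnAr.
by rewrite sqrtrM ?sqr_ge0// sqrtr_sqr invfM.
Qed.

Lemma normal_prob_indic (m s : R) A : measurable A ->
  normal_prob m s A = (\int[mu]_y (normal_pdf m s y * \1_A y)%:E)%E.
Proof.
move=> mA; rewrite /normal_prob integral_mkcond; apply: eq_integral => y _.
by rewrite patchE indicE; case: ifPn => yA; rewrite ?mulr1 ?mulr0.
Qed.

Lemma normal_prob_sqr (s c : R) : s ^+ 2 = c ^+ 2 -> normal_prob 0 s = normal_prob 0 c.
Proof.
move=> sc; rewrite /normal_prob; apply/funext => A; apply: eq_integral => y _.
have e : (s == 0) = (c == 0) by rewrite -[s == 0]sqrf_eq0 sc sqrf_eq0.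
by rewrite /normal_pdf e /normal_peak /normal_fun sc.
Qed.

Lemma normal_prob_affine (x c : R) A : c != 0 -> measurable A ->
  N01 ((fun z => x + c * z) @^-1` A) = normal_prob x c A.
Proof.
move=> c0 mA.
have mphi : measurable_fun setT (fun z : R => x + c * z).
  apply: measurable_funD => //; exact: measurable_funM.
have mpre : measurable ((fun z => x + c * z) @^-1` A).
  by rewrite -[X in measurable X]setTI; exact: mphi.
rewrite !normal_prob_indic// -(@ge0_integral_affine x c (fun y => normal_pdf x c y * \1_A y))//.
- apply: eq_integral => z _; congr EFin; rewrite mulrA; congr (_ * _).
  rewrite !normal_pdfE// ?oner_eq0// -{2}[c]mulr1 normal_peakM !mulrA.
  rewrite mulfV ?normr_eq0// mul1r; congr (_ * expR _); field.
  by rewrite c0.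
- apply: measurable_funM; first exact: measurable_normal_pdf.
  exact: measurable_indic.
- by move=> y; rewrite mulr_ge0 ?normal_pdf_ge0// indicE.
Qed.

Lemma normal_pdf_conv (s c z : R) : s != 0 -> c != 0 ->
  (\int[mu]_y (normal_pdf 0 s y * normal_pdf y c z)%:E =
   (normal_pdf 0 (Num.sqrt (s ^+ 2 + c ^+ 2)) z)%:E)%E.
Proof.
move=> s0 c0; set r := Num.sqrt _.
have sp : 0 < s ^+ 2 by rewrite lt_neqAle sqr_ge0 eq_sym sqrf_eq0 s0.
have cp : 0 < c ^+ 2 by rewrite lt_neqAle sqr_ge0 eq_sym sqrf_eq0 c0.
have r2 : r ^+ 2 = s ^+ 2 + c ^+ 2 by rewrite sqr_sqrtr// addr_ge0 ?ltW.
have rp : 0 < r by rewrite sqrtr_gt0 addr_gt0.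
have r0 : r != 0 by rewrite gt_eqF.
have sc0 : s ^+ 2 + c ^+ 2 != 0 by rewrite -r2 sqrf_eq0.
pose t := s * c / r; pose m := z * s ^+ 2 / r ^+ 2.
have t0 : t != 0 by rewrite !mulf_neq0// invr_eq0.
rewrite (eq_integral (fun y : measurableTypeR R => (normal_pdf 0 r z)%:E * (normal_pdf m t y)%:E)%E); last first.
  move=> y _; rewrite -EFinM; congr EFin; rewrite !normal_pdfE//.
  rewrite [LHS]mulrACA [RHS]mulrACA -!expRD; congr (_ * expR _); last first.
    by rewrite /t /m !expr_div_n !exprMn r2; field; rewrite s0 c0 sc0.
  rewrite -[X in normal_peak X * normal_peak c](mulr1 s) -[X in _ * normal_peak X = _](mulr1 c).
  rewrite -[X in _ = normal_peak X * _](mulr1 r) -[X in _ = _ * normal_peak X](mulr1 t).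
  rewrite !normal_peakM /t !normrM normfV (gtr0_norm rp); field.
  by rewrite r0 !normr_eq0 s0 c0.
rewrite ge0_integralZl//; last 3 first.
- by apply/measurable_EFinP; exact: measurable_normal_pdf.
- by move=> y _; rewrite lee_fin normal_pdf_ge0.
- by rewrite lee_fin normal_pdf_ge0.
by rewrite integral_normal_pdf mule1.
Qed.

Lemma integral_normal_prob (m s : R) (f : R -> \bar R) (U : set R) :
  measurable U -> measurable_fun U f ->
  (\int[normal_prob m s]_(x in U) `|f x| < +oo)%E ->
  (\int[normal_prob m s]_(x in U) f x =
   \int[mu]_(x in U) (f x * (normal_pdf m s x)%:E))%E.
Proof.
move=> mU mf finf.
rewrite -(Radon_Nikodym_change_of_variables (normal_prob_dominates m s))//=; last first.
  by apply/integrableP; split.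
apply: ae_eq_integral => //.
- apply: emeasurable_funM => //; apply: (measurable_int mu).
  apply: (integrableS _ _ (@subsetT _ _)) => //=.
  by apply: Radon_Nikodym_integrable; exact: normal_prob_dominates.
- apply: emeasurable_funM => //=; apply/measurableT_comp => //=.
  by apply/measurable_funTS; exact: measurable_normal_pdf.
- apply: ae_eqe_mul2l => /=.
  rewrite Radon_NikodymE//=; first exact: normal_prob_dominates.
  move=> abmu.
  case: cid => /= h [h1 h2 h3].
  apply: integral_ae_eq => //=.
  + exact: integrableS h2.
  + by apply/measurable_funTS/measurableT_comp =>//; exact: measurable_normal_pdf.
  + by move=> E E01 mE; rewrite -h3.
Qed.

End NormalLaws.

Section NormalMoments.
Context {R : realType}.
Local Notation mu := (@lebesgue_measure R).
Local Notation N01 := (@normal_prob R 0 1).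
Let phi : R -> R := normal_pdf 0 1.

Let phiE : phi = fun x => normal_peak 1 * expR (- (x ^+ 2) / 2).
Proof.
apply/funext => x; rewrite /phi normal_pdfE ?oner_eq0//.
by rewrite subr0 expr1n.
Qed.

Let dphi (x : R) : is_derive x 1 phi (- x * phi x).
Proof.
rewrite phiE.
have h1 : is_derive x 1 (fun x : R => - (x ^+ 2) / 2) (- x).
  by apply: is_derive_eq; rewrite /GRing.scale/=; field.
have h2 : is_derive x 1 (fun x : R => expR (- (x ^+ 2) / 2)) (expR (- x ^+ 2 / 2) * - x).
  exact: (@is_derive1_comp _ expR (fun x => - (x ^+ 2) / 2)).
by apply: is_derive_eq; rewrite /GRing.scale/=; ring.
Qed.

Let F (x : R) := x * phi x.
Let J (n : nat) : set R := `[- n.+1%:R, n.+1%:R]%classic.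

Let mJ n : measurable (J n : set (measurableTypeR R)).
Proof. exact: measurable_itv. Qed.

Let dF (x : R) : is_derive x 1 F (phi x - x ^+ 2 * phi x).
Proof. by have h := dphi x; apply: is_derive_eq; rewrite /GRing.scale/=; ring. Qed.

Let cphi : continuous phi.
Proof. by apply: continuous_normal_pdf; rewrite oner_eq0. Qed.

Let cF : continuous F.
Proof. by move=> x; apply: cvgM; [exact: cvg_id|exact: cphi]. Qed.

Let cg : continuous (fun x : R => x ^+ 2 * phi x).
Proof. by move=> x; apply: cvgM; [exact: exprn_continuous|exact: cphi]. Qed.

Let ftc n : (\int[mu]_(x in J n) (x ^+ 2 * phi x)%:E =
  \int[mu]_(x in J n) (phi x)%:E - (2 * n.+1%:R * phi n.+1%:R)%:E)%E.
Proof.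
have ab : - n.+1%:R < n.+1%:R :> R by rewrite -subr_gt0 opprK addr_gt0 ?ltr0n.
have := @continuous_FTC2 R (fun x => phi x - x ^+ 2 * phi x) F _ _ ab.
have ci (h : R -> R) : continuous h -> mu.-integrable (J n) (EFin \o h).
  by move=> ch; apply: continuous_compact_integrable; [exact: segment_compact|exact: continuous_subspaceT].
have i1 := ci _ cphi; have i2 := ci _ cg.
move=> H.
have {H} : (\int[mu]_(x in J n) (phi x - x ^+ 2 * phi x)%:E =
   (2 * n.+1%:R * phi n.+1%:R)%:E)%E.
  rewrite H.
  - rewrite /F -EFinB; congr EFin.
    have -> : phi (- n.+1%:R) = phi n.+1%:R by rewrite phiE sqrrN.
    ring.
  - apply: continuous_subspaceT => x; apply: cvgB; [exact: cphi|exact: cg].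
  - split; [by move=> x _; case: (dF x)| |]; apply: cvg_at_right_filter || apply: cvg_at_left_filter; exact: cF.
  - by move=> x _; rewrite derive1E; case: (dF x).
under eq_integral do rewrite EFinB.
rewrite (integralB (mJ n) i1 i2) => <-.
have f1 := integrable_fin_num (mJ n) i1.
have f2 := integrable_fin_num (mJ n) i2.
rewrite -(fineK f1) -(fineK f2) -!EFinB; congr EFin.
by rewrite opprB addrC subrK.
Qed.

Let bigcup_itv : \bigcup_n (J n) = [set: R].
Proof.
apply/seteqP; split => // x _.
have /andP[h1 h2] : - (Num.trunc `|x|).+1%:R <= x <= (Num.trunc `|x|).+1%:R.
  by rewrite -ler_norml ltW// truncnS_gt.
by exists (Num.trunc `|x|) => //; rewrite /J/= in_itv/= h1 h2.
Qed.

Let nd_itv : nondecreasing_seq (fun n => J n : set R).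
Proof.
move=> m n mn; apply/subsetPset => x; rewrite /J/= !in_itv/= => /andP[h1 h2].
have le : m.+1%:R <= n.+1%:R :> R by rewrite ler_nat.
by rewrite (le_trans _ h1) ?lerN2// (le_trans h2).
Qed.

Lemma normal_second_moment : (\int[N01]_x (x ^+ 2)%:E = 1)%E.
Proof.
have m2 : measurable_fun setT (fun x : R => (x ^+ 2)%:E).
  by apply/measurable_EFinP; exact: exprn_measurable.
have h1 : (\int[N01]_(x in J n) (x ^+ 2)%:E)%E @[n --> \oo]
    --> (\int[N01]_x (x ^+ 2)%:E)%E.
  rewrite -bigcup_itv.
  apply: (@ge0_nondecreasing_set_cvg_integral _ (measurableTypeR R) R J (fun x => (x ^+ 2)%:E) N01) => //.
  - by move=> n; exact: measurable_funTS.
  - by move=> n x _; rewrite lee_fin sqr_ge0.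
apply: (cvg_unique _ h1) => //.
have h2 : (\int[mu]_(x in J n) (phi x)%:E)%E @[n --> \oo] --> (1 : \bar R)%E.
  rewrite -(integral_normal_pdf 0 1) -bigcup_itv.
  apply: (@ge0_nondecreasing_set_cvg_integral _ (measurableTypeR R) R J (fun x => (phi x)%:E) mu) => //.
  - by move=> n; apply: measurable_funTS; apply/measurable_EFinP; exact: measurable_normal_pdf.
  - by move=> n x _; rewrite lee_fin normal_pdf_ge0.
have h3 : (2 * n.+1%:R * phi n.+1%:R)%:E @[n --> \oo] --> (0 : \bar R)%E.
  apply: cvg_EFin; first exact: nearW.
  change ((fun n => 2 * n.+1%:R * phi n.+1%:R) @ \oo --> (0 : R)).
  rewrite (cvg_shiftS (fun n => 2 * n%:R * phi n%:R)).
  apply: (@cvg_norm_harmonic _ _ (4 * normal_peak 1)) => n n0.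
  have np : 0 < n%:R :> R by rewrite ltr0n.
  rewrite ger0_norm; last by rewrite !mulr_ge0 ?normal_pdf_ge0.
  have e1 : n%:R ^+ 2 / 2 <= expR (n%:R ^+ 2 / 2) :> R.
    by rewrite (le_trans _ (expR_ge1Dx _))// lerDr.
  have e2 := normal_peak_ge0 (1 : R).
  rewrite phiE mulNr expRN ler_pdivlMr//.
  have ep := expR_gt0 (n%:R ^+ 2 / 2 : R).
  rewrite (_ : _ * n%:R = 4 * normal_peak 1 * ((n%:R ^+ 2 / 2) / expR (n%:R ^+ 2 / 2))); last first.
    by field; rewrite gt_eqF.
  by rewrite ler_piMr ?mulr_ge0// ler_pdivrMr// mul1r.
rewrite (_ : (fun n => _) = (fun n => (\int[mu]_(x in J n) (phi x)%:E - (2 * n.+1%:R * phi n.+1%:R)%:E)%E)).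
  by rewrite /= -[X in _ --> X]sube0; apply: (cvgeB _ h2 h3).
apply/funext => n; rewrite -ftc integral_normal_prob//.
- exact: mJ.
- exact: measurable_funTS.
- have : N01.-integrable (J n) (EFin \o (fun x : measurableTypeR R => x ^+ 2)).
    apply: (@le_integrable _ _ _ N01 (J n) _ _ (EFin \o cst (n.+1%:R ^+ 2))) => //.
    + exact: measurable_funTS.
    + move=> x; rewrite /J/= in_itv/= => xn; rewrite lee_fin.
      by rewrite !normrX lerXn2r ?nnegrE// [leRHS]ger0_norm// ler_norml.
    + exact: finite_measure_integrable_cst.
  by case/integrableP.
Qed.

End NormalMoments.

Section NormalSums.
Context {R : realType}.
Local Notation mu := (@lebesgue_measure R).
Local Notation N01 := (normal_prob 0 1 : probability (measurableTypeR R) R).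

Definition has_normal0_law {d : measure_display} {Om : measurableType d}
    (Q : probability Om R) (U : Om -> R) (s2 : R) :=
  forall A : set R, measurable A -> Q (U @^-1` A) = normal0_law s2 A.

Lemma normal_scale_law (c : R) :
  has_normal0_law N01 (fun z : measurableTypeR R => c * z) (c ^+ 2).
Proof.
move=> A mA; rewrite /normal0_law sqrf_eq0; case: ifPn => [/eqP ->|c0].
  rewrite diracE; case: (boolP (0 \in A)) => A0.
    rewrite (_ : _ @^-1` _ = setT) ?probability_setT//.
    by apply/seteqP; split => // z _ /=; rewrite mul0r; rewrite inE in A0.
  rewrite (_ : _ @^-1` _ = set0) ?measure0//.
  apply/seteqP; split => // z /=; rewrite mul0r => /mem_set; exact/negP.
rewrite sqrtr_sqr -(normal_prob_sqr (s := c) (c := `|c|)); last by rewrite real_normK ?num_real.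
rewrite -(normal_prob_affine 0 c0 mA); congr (normal_prob 0 1 _).
by apply/funext => z /=; rewrite add0r.
Qed.

Lemma measurable_normal_pdf2 (c : R) (A : set (measurableTypeR R)) :
  c != 0 -> measurable A ->
  measurable_fun setT (fun w : measurableTypeR R * measurableTypeR R => normal_pdf w.1 c w.2) /\
  measurable_fun setT (fun w : measurableTypeR R * measurableTypeR R => \1_A w.2 : R).
Proof.
move=> c0 mA; split.
  have m1 : measurable_fun setT (fst : measurableTypeR R * measurableTypeR R -> R).
    exact: measurable_fst.
  have m2 : measurable_fun setT (snd : measurableTypeR R * measurableTypeR R -> R).
    exact: measurable_snd.
  rewrite (_ : (fun w => _) = (fun w => normal_peak c * expR (- (w.2 - w.1) ^+ 2 / (c ^+ 2 *+ 2)))); last first.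
    by apply/funext => w; rewrite normal_pdfE.
  apply: measurable_funM => //; apply: measurableT_comp => //.
  apply: measurable_funM => //; apply: measurable_funN; apply: measurable_funX.
  exact: measurable_funB.
by apply: (@measurableT_comp _ _ _ _ _ _ (\1_A : measurableTypeR R -> R) _ snd).
Qed.

Lemma measurable_normal_prob (c : R) (A : set (measurableTypeR R)) : c != 0 -> measurable A ->
  measurable_fun setT (fun y : measurableTypeR R => normal_prob y c A).
Proof.
move=> c0 mA; have [m3 mi] := measurable_normal_pdf2 c0 mA.
pose h (w : measurableTypeR R * measurableTypeR R) : \bar R :=
  (normal_pdf w.1 c w.2 * \1_A w.2)%:E.
have mh : measurable_fun setT h by apply/measurable_EFinP; exact: measurable_funM.
have h0 w : (0 <= h w)%E by rewrite lee_fin mulr_ge0 ?normal_pdf_ge0// indicE.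
rewrite (_ : (fun y => _) = fubini_F mu h).
  by apply: measurable_fun_fubini_tonelli_F.
by apply/funext => y; rewrite normal_prob_indic.
Qed.

Lemma normal_prob_mix (s c : R) (A : set (measurableTypeR R)) : s != 0 -> c != 0 -> measurable A ->
  (\int[normal_prob 0 s]_y normal_prob y c A =
   normal_prob 0 (Num.sqrt (s ^+ 2 + c ^+ 2)) A)%E.
Proof.
move=> s0 c0 mA; have [m3 mi] := measurable_normal_pdf2 c0 mA.
have mnp := measurable_normal_prob c0 mA.
rewrite integral_normal_prob//; last first.
- apply: (@le_lt_trans _ _ (\int[normal_prob 0 s]_x (cst 1%E) x)%E); last first.
    rewrite integral_cst// mul1e; apply: (@le_lt_trans _ _ 1%E); last exact: ltry.
    exact: (@probability_le1 _ _ _ (normal_prob 0 s)).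
  apply: ge0_le_integral => //.
  + exact: measurableT_comp.
  + by move=> y _; rewrite gee0_abs//; exact: probability_le1.
pose g (w : measurableTypeR R * measurableTypeR R) : \bar R :=
  (normal_pdf 0 s w.1 * (normal_pdf w.1 c w.2 * \1_A w.2))%:E.
have mg : measurable_fun setT g.
  apply/measurable_EFinP; apply: measurable_funM; last exact: measurable_funM.
  by apply: measurableT_comp => //; exact: measurable_normal_pdf.
have g0 w : (0 <= g w)%E by rewrite lee_fin !mulr_ge0 ?normal_pdf_ge0// indicE.
transitivity (\int[mu]_y \int[mu]_z g (y, z))%E.
  apply: eq_integral => y _; rewrite normal_prob_indic// muleC -ge0_integralZl//.
  - by apply/measurable_EFinP; apply: measurable_funM;
      [exact: measurable_normal_pdf|exact: measurable_indic].
  - by move=> z _; rewrite lee_fin mulr_ge0 ?normal_pdf_ge0// indicE.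
  - by rewrite lee_fin normal_pdf_ge0.
transitivity (\int[mu]_z \int[mu]_y g (y, z))%E; first exact: fubini_tonelli.
rewrite normal_prob_indic//; apply: eq_integral => z _.
rewrite EFinM -normal_pdf_conv// -ge0_integralZr//.
- by apply: eq_integral => y _; rewrite /g/= mulrA.
- apply/measurable_EFinP; apply: measurable_funM; first exact: measurable_normal_pdf.
  by apply: (measurable_comp measurableT _ m3 (pair2_measurable z)).
- by move=> y _; rewrite lee_fin mulr_ge0 ?normal_pdf_ge0.
Qed.

Lemma normal_sum_law {d : measure_display} {Om : measurableType d}
    (Q : probability Om R) (U : Om -> R) (s2 c : R) : 0 <= s2 ->
  measurable_fun setT U -> has_normal0_law Q U s2 ->
  has_normal0_law (Q \x N01)%E
    (fun w : Om * measurableTypeR R => U w.1 + c * w.2) (s2 + c ^+ 2).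
Proof.
move=> s20 mU lU A mA.
rewrite /= /product_measure1/=.
transitivity (\int[Q]_w (N01 ((fun z : R => (U w + c * z)%R) @^-1` A)))%E.
  apply: eq_integral => w _; congr (normal_prob 0 1 _).
  by apply/seteqP; split => z /=; rewrite /xsection/= ?inE.
have [c0|c0] := eqVneq c 0.
  have mUA : measurable (U @^-1` A) by rewrite -[X in measurable X]setTI; exact: mU.
  rewrite c0 expr0n/= addr0 -lU//.
  have := @integral_indic _ _ _ Q setT measurableT (U @^-1` A) mUA; rewrite setIT => <-.
  apply: eq_integral => w _; rewrite indicE.
  case: (boolP (w \in _)) => wA.
    rewrite (_ : _ @^-1` _ = setT) ?probability_setT//.
    by apply/seteqP; split => // z _ /=; rewrite mul0r addr0; rewrite inE in wA.
  rewrite (_ : _ @^-1` _ = set0) ?measure0//.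
  apply/seteqP; split => // z /=; rewrite mul0r addr0 => wA'.
  by move/negP : wA; apply; rewrite inE.
transitivity (\int[Q]_w normal_prob (U w) c A)%E.
  by apply: eq_integral => w _; exact: normal_prob_affine.
have sc0 : s2 + c ^+ 2 != 0.
  by rewrite gt_eqF// ltr_wpDl// lt_neqAle sqr_ge0 eq_sym sqrf_eq0 c0.
rewrite /normal0_law (negbTE sc0).
have mnp : measurable_fun setT (fun y : measurableTypeR R => normal_prob y c A).
  exact: measurable_normal_prob.
have mU' : @measurable_fun _ _ Om (measurableTypeR R) setT U := mU.
pose nu := measure_function_pushforward__canonical__measure_function_Measure Q mU'.
transitivity (\int[nu]_y normal_prob y c A)%E.
  by rewrite [RHS](ge0_integral_pushforward mU' Q).
have [s0|s0] := eqVneq s2 0.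
  rewrite (eq_measure_integral (\d_(0 : measurableTypeR R))); last first.
    by move=> B mB _; have := lU B mB; rewrite /normal0_law s0 eqxx.
  rewrite integral_dirac//= diracT mul1e s0 add0r sqrtr_sqr.
  by rewrite (normal_prob_sqr (s := c) (c := `|c|))// real_normK// num_real.
rewrite (eq_measure_integral (normal_prob 0 (Num.sqrt s2))); last first.
  by move=> B mB _; have := lU B mB; rewrite /normal0_law (negbTE s0).
have sq0 : Num.sqrt s2 != 0 by rewrite sqrtr_eq0 -ltNge lt_neqAle eq_sym s0.
rewrite -[in RHS](sqr_sqrtr s20); exact: normal_prob_mix.
Qed.

Lemma prod_same_dist {d1 d2 : measure_display} {O1 : measurableType d1}
    {O2 : measurableType d2} (Q1 : probability O1 R) (Q2 : probability O2 R) :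
  same_dist (Q1 \x Q2)%E fst Q1 id /\ same_dist (Q1 \x Q2)%E snd Q2 id.
Proof.
split=> A mA.
  rewrite (_ : _ @^-1` _ = A `*` setT); last by apply/seteqP; split => [[a b]//|[a b] []].
  by rewrite [LHS]product_measure1E// [X in (_ * X)%E](@probability_setT _ _ _ Q2) mule1.
rewrite (_ : _ @^-1` _ = setT `*` A); last by apply/seteqP; split => [[a b]//|[a b] []].
by rewrite [LHS]product_measure1E// [X in (X * _)%E](@probability_setT _ _ _ Q1) mul1e.
Qed.

Lemma prod_indep2 {d1 d2 : measure_display} {O1 : measurableType d1}
    {O2 : measurableType d2} (Q1 : probability O1 R) (Q2 : probability O2 R)
    (f : O1 -> R) (g : O2 -> R) : measurable_fun setT f -> measurable_fun setT g ->
  indep2 (Q1 \x Q2)%E (f \o fst) (g \o snd).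
Proof.
move=> mf mg A B mA mB.
have mfA : measurable (f @^-1` A) by rewrite -[X in measurable X]setTI; exact: mf.
have mgB : measurable (g @^-1` B) by rewrite -[X in measurable X]setTI; exact: mg.
have [h1 h2] := prod_same_dist Q1 Q2.
have e1 : (Q1 \x Q2)%E ((f \o fst) @^-1` A) = Q1 (f @^-1` A) := h1 _ mfA.
have e2 : (Q1 \x Q2)%E ((g \o snd) @^-1` B) = Q2 (g @^-1` B) := h2 _ mgB.
transitivity (Q1 (f @^-1` A) * Q2 (g @^-1` B))%E.
  exact: (@product_measure1E _ _ _ _ _ Q1 Q2).
by congr (_ * _)%E; exact/esym.
Qed.

Lemma normal_mean_sq : Int N01 (fun z : measurableTypeR R => z ^+ 2) /\
  Ex N01 (fun z : measurableTypeR R => z ^+ 2) = 1.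
Proof.
split; last by rewrite /Ex normal_second_moment.
apply/integrableP; split.
  by apply/measurable_EFinP; exact: exprn_measurable.
under eq_integral do rewrite gee0_abs ?lee_fin ?sqr_ge0//.
by rewrite normal_second_moment ltry.
Qed.

Lemma normal_mean0 : Ex N01 (fun z : measurableTypeR R => z) = 0.
Proof.
have mid : measurable_fun setT (fun z : measurableTypeR R => z : R) by [].
have iz : Int N01 (fun z : measurableTypeR R => z).
  by apply: Int_of_sq => //; case: normal_mean_sq.
have mN : measurable_fun setT (fun z : measurableTypeR R => - z : R) by exact: oppr_measurable.
have e : Ex N01 (fun z : measurableTypeR R => - z) = Ex N01 (fun z : measurableTypeR R => z).
  apply: (@Ex_same_dist _ _ _ _ _ _ _ N01 N01 (fun z : measurableTypeR R => - z : R) (fun z => z : R) (fun z : R => z)) => // A mA.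
  have := normal_scale_law (-1) mA; have := normal_scale_law 1 mA.
  rewrite expr1n sqrrN expr1n => <- .
  rewrite (_ : (fun z => 1 * z) = (fun z => z)); last by apply/funext => z; rewrite mul1r.
  by rewrite (_ : (fun z => -1 * z) = (fun z => - z))//; apply/funext => z; rewrite mulN1r.
have : Ex N01 (fun z : measurableTypeR R => - z) = - Ex N01 (fun z : measurableTypeR R => z).
  by rewrite -mulN1r -ExZ//; apply: eq_Ex => z; rewrite mulN1r.
by rewrite e; lra.
Qed.

Lemma normal_cos {d : measure_display} {Om : measurableType d}
    (Q : probability Om R) (U : Om -> R) (s2 y : R) : 0 <= s2 ->
  measurable_fun setT U -> has_normal0_law Q U s2 ->
  Ex Q (fun w => cos (U w + y)) = expR (- (s2 / 2)) * cos y.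
Proof.
move=> s20 mU lU.
pose s := Num.sqrt s2.
pose Phi n m y := Ex N01 (fun z : measurableTypeR R => cos (Num.sqrt (m%:R / n%:R) * s * z + y)).
have s2E : s ^+ 2 = s2 by rewrite sqr_sqrtr.
have msc (c : R) : measurable_fun setT (fun z : measurableTypeR R => c * z : R).
  exact: mulrl_measurable.
have [i2 e2] := normal_mean_sq.
have eta2 : Int N01 (fun z : measurableTypeR R => (s * z) ^+ 2).
  by have := IntZ (s ^+ 2) i2; apply: eq_integrable => // z _ /=; rewrite exprMn.
have eta2E : Ex N01 (fun z : measurableTypeR R => (s * z) ^+ 2) = s2.
  by rewrite (@eq_Ex _ _ _ _ _ (fun z : measurableTypeR R => s ^+ 2 * z ^+ 2)) ?ExZ// ?e2 ?mulr1// => z; rewrite exprMn.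
have eta0 : Ex N01 (fun z : measurableTypeR R => s * z) = 0.
  rewrite ExZ ?normal_mean0 ?mulr0//.
  by apply: Int_of_sq.
have law_eq (d' : measure_display) (Om' : measurableType d') (Q' : probability Om' R) (V : Om' -> R) (v z : R) :
    measurable_fun setT V -> has_normal0_law Q' V (v ^+ 2) ->
    Ex Q' (fun w => cos (V w + z)) = Ex N01 (fun x : measurableTypeR R => cos (v * x + z)).
  move=> mV lV.
  have mc : measurable_fun setT (fun u : R => cos (u + z)).
    by apply: measurableT_comp; [exact: measurable_cos|exact: measurable_funD].
  apply: (@Ex_same_dist _ _ _ _ _ _ _ Q' N01 V (fun x : measurableTypeR R => v * x) (fun u : R => cos (u + z))) => //.
    by move=> A mA; rewrite lV// normal_scale_law.
  apply: (@Int_bounded _ _ _ _ _ 1) => [|x]; last exact: norm_cos_le1.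
  exact: (measurableT_comp mc (msc v)).
have lim := @clt_cos_rec R _ _ N01 _ (msc s) eta2 eta0 Phi _ _ _ y.
have {lim} : Phi n n y @[n --> \oo] --> expR (- (s2 / 2)) * cos y.
  rewrite -eta2E; apply: lim.
  - move=> n z; rewrite /Phi -[RHS](Ex_cst N01); apply: eq_Ex => x.
    by rewrite mul0r sqrtr0 !mul0r add0r.
  - move=> n m z; rewrite /Phi.
    pose V (w : measurableTypeR R * measurableTypeR R) : R :=
      Num.sqrt (m%:R / n%:R) * s * w.1 + (s / Num.sqrt n%:R) * w.2.
    have mf1 : measurable_fun setT (fst : measurableTypeR R * measurableTypeR R -> R).
      exact: measurable_fst.
    have mf2 : measurable_fun setT (snd : measurableTypeR R * measurableTypeR R -> R).
      exact: measurable_snd.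
    have mV : measurable_fun setT V.
      by apply: measurable_funD; exact: measurable_funM.
    have lV : has_normal0_law (N01 \x N01)%E V ((Num.sqrt (m.+1%:R / n%:R) * s) ^+ 2).
      rewrite (_ : _ ^+ 2 = (Num.sqrt (m%:R / n%:R) * s) ^+ 2 + (s / Num.sqrt n%:R) ^+ 2).
        apply: normal_sum_law; [exact: sqr_ge0|exact: msc|exact: normal_scale_law].
      rewrite !exprMn exprVn !sqr_sqrtr ?divr_ge0// -natr1; ring.
    rewrite -(law_eq _ _ _ _ _ _ mV lV).
    rewrite (@eq_Ex _ _ _ _ _ (fun w : measurableTypeR R * measurableTypeR R => cos ((Num.sqrt (m%:R / n%:R) * s * w.1 + z) + (s * w.2) / Num.sqrt n%:R))); last first.
      by move=> w; congr cos; rewrite /V; ring.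
    rewrite Ex_cosD_indep.
    + have [h1 h2] := prod_same_dist N01 N01.
      have mc (f : R -> R) (c e : R) : measurable_fun setT f -> measurable_fun setT (fun u : measurableTypeR R => f (c * u + e)).
        move=> mf; apply: (measurableT_comp mf); apply: measurable_funD => //; exact: msc.
      have E1 e : Ex (N01 \x N01)%E (fun w => cos (Num.sqrt (m%:R / n%:R) * s * w.1 + e)) = Ex N01 (fun u : measurableTypeR R => cos (Num.sqrt (m%:R / n%:R) * s * u + e)).
        apply: (Ex_same_dist measurable_fst _ (mc cos _ e measurable_cos) h1) => //.
        apply: (@Int_bounded _ _ _ _ _ 1) => [|x]; last exact: norm_cos_le1.
        exact: (mc cos _ e measurable_cos).
      have E2 (f : R -> R) : measurable_fun setT f -> (forall u, `|f u| <= 1) -> Ex (N01 \x N01)%E (fun w => f (s * w.2 / Num.sqrt n%:R)) = Ex N01 (fun u : measurableTypeR R => f (s * u / Num.sqrt n%:R)).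
        move=> mf f1.
        have mf' : measurable_fun setT (fun u : measurableTypeR R => f (s * u / Num.sqrt n%:R)).
          by apply: (measurableT_comp mf); apply: measurable_funM => //; exact: msc.
        apply: (Ex_same_dist measurable_snd _ mf' h2) => //.
        by apply: (@Int_bounded _ _ _ _ _ 1) => [|x]; [exact: mf'|exact: f1].
      rewrite E1 (E2 cos measurable_cos norm_cos_le1) (E2 sin measurable_sin norm_sin_le1).
      congr (_ + _ * _); rewrite -E1; apply: eq_Ex => w; congr cos; ring.
    + by apply: measurable_funD => //; exact: measurable_funM.
    + by apply: measurable_funM => //; exact: measurable_funM.
    + apply: (@prod_indep2 _ _ _ _ N01 N01 (fun u : measurableTypeR R => Num.sqrt (m%:R / n%:R) * s * u + z) (fun u : measurableTypeR R => s * u / Num.sqrt n%:R)).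
        by apply: measurable_funD => //; exact: msc.
      by apply: measurable_funM => //; exact: msc.
  - move=> n m z; rewrite -[leRHS](Ex_cst N01 1).
    apply: norm_Ex_le; [|exact: Int_cst|by move=> x; exact: norm_cos_le1].
    apply: measurableT_comp; first exact: measurable_cos.
    by apply: measurable_funD => //; exact: msc.
have -> : Ex Q (fun w => cos (U w + y)) = Phi 1%N 1%N y.
  have lU' : has_normal0_law Q U (s ^+ 2) by rewrite s2E.
  rewrite (law_eq _ _ Q U s y mU lU') /Phi; apply: eq_Ex => z.
  by rewrite divr1 sqrtr1 mul1r.
move=> h; apply: (cvg_unique _ _ h) => //.
apply: cvg_near_cst; near=> n.
rewrite /Phi; apply: eq_Ex => z; rewrite !divff ?oner_eq0//.
by rewrite pnatr_eq0 -lt0n; near: n; exact: nbhs_infty_gt.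
Unshelve. all: end_near. Qed.

End NormalSums.

Section PsdDecomposition.
Context {R : realType} {k : nat}.
Implicit Types (V : 'M[R]_k) (u w : 'cV[R]_k).
Local Notation e_ i := (@delta_mx R k 1 i 0).

Lemma quad_formE V u w : (u^T *m V *m w) 0 0 = \sum_i \sum_j u i 0 * V i j * w j 0.
Proof.
rewrite mxE exchange_big; apply: eq_bigr => j _; rewrite mxE big_distrl/=.
by apply: eq_bigr => i _; rewrite mxE.
Qed.

Lemma quad_formD V u w c : V^T = V ->
  ((u + c *: w)^T *m V *m (u + c *: w)) 0 0 =
  (u^T *m V *m u) 0 0 + 2 * c * (u^T *m V *m w) 0 0 + c ^+ 2 * (w^T *m V *m w) 0 0.
Proof.
move=> Vs.
have sym : (w^T *m V *m u) 0 0 = (u^T *m V *m w) 0 0.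
  have -> : w^T *m V *m u = (u^T *m V *m w)^T.
    by rewrite !trmx_mul trmxK Vs mulmxA.
  by rewrite mxE.
have mx1D (M N : 'M[R]_1) : (M + N) 0 0 = M 0 0 + N 0 0 by rewrite mxE.
have mx1Z e (M : 'M[R]_1) : (e *: M) 0 0 = e * M 0 0 by rewrite mxE.
rewrite [(u + c *: w)^T]linearD/= linearZ/= !mulmxDl !mulmxDr -!scalemxAl -!scalemxAr.
rewrite !mx1D !mx1Z sym.
ring.
Qed.

Lemma quad_form_delta V u i : (u^T *m V *m e_ i) 0 0 = (u^T *m V) 0 i.
Proof.
rewrite mxE (bigD1 i)//= big1 ?addr0 => [|j ji]; rewrite !mxE ?eqxx ?mulr1//.
by rewrite (negbTE ji) mulr0.
Qed.

Lemma psd_diag0 V i j : psd V -> V i i = 0 -> V i j = 0.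
Proof.
move=> [Vs Vp] Vi0; apply/eqP; apply: contraT => Vij.
pose u : 'cV[R]_k := e_ j; pose e : 'cV[R]_k := e_ i.
have de a b : ((e_ a)^T *m V *m e_ b) 0 0 = V a b.
  by rewrite quad_form_delta trmx_delta -rowE mxE.
have Vji : V j i = V i j by rewrite -[in LHS]Vs mxE.
have := Vp (u + (- (V j j + 1) / (2 * V i j)) *: e).
rewrite quad_formD// /u /e !de Vi0 Vji mulr0 addr0.
rewrite (_ : _ + _ = - 1); last by field.
by rewrite oppr_ge0 ler10.
Qed.

Lemma psd_decomp V : psd V -> exists ls : seq 'cV[R]_k, V = \sum_(l <- ls) l *m l^T.
Proof.
suff H n : forall (S : {set 'I_k}) V, #|S| = n -> psd V ->
    (forall i j, i \notin S -> V i j = 0) ->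
    exists ls : seq 'cV[R]_k, V = \sum_(l <- ls) l *m l^T.
  by move=> pV; apply: (H _ [set: 'I_k]%SET V erefl pV) => i j; rewrite inE.
elim: n => [|n IH] S {}V cS pV VS.
  exists [::]; rewrite big_nil; apply/matrixP => i j; rewrite VS ?mxE//.
  by move/eqP : cS; rewrite cards_eq0 => /eqP ->; rewrite inE.
have [i iS] : exists i, i \in S by apply/set0Pn; rewrite -cards_eq0 cS.
have cS' : #|S :\ i| = n by have := cardsD1 i S; rewrite iS cS => -[].
have [Vs Vp] := pV.
have Vsym a b : V a b = V b a by rewrite -[in LHS]Vs mxE.
have de u : (u^T *m V *m e_ i) 0 0 = \sum_a u a 0 * V a i.
  by rewrite quad_form_delta mxE; apply: eq_bigr => a _; rewrite mxE.
have dei : ((e_ i)^T *m V *m e_ i) 0 0 = V i i.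
  by rewrite quad_form_delta trmx_delta -rowE mxE.
have [Vi0|Vi0] := eqVneq (V i i) 0.
  apply: (IH (S :\ i)) => // a b; rewrite !inE negb_and negbK.
  by case/orP => [/eqP ->|aS]; [exact: psd_diag0|exact: VS].
have Vip : 0 < V i i.
  by rewrite lt_neqAle eq_sym Vi0/= -dei; exact: Vp.
pose l : 'cV[R]_k := (Num.sqrt (V i i))^-1 *: col i V.
have ll a b : (l *m l^T) a b = V a i * V b i / V i i.
  rewrite mxE big_ord1 !mxE.
  have -> : (V i i)^-1 = (Num.sqrt (V i i))^-1 * (Num.sqrt (V i i))^-1.
    by rewrite -invfM -expr2 sqr_sqrtr ?ltW.
  by ring.
have [] := IH (S :\ i) (V - l *m l^T) cS'.
- split.
    by apply/matrixP => a b; rewrite mxE [LHS]mxE [in RHS]mxE [in X in _ + X]mxE [in X in _ = _ + X]mxE !ll [V b a]Vsym; ring.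
  move=> u.
  have := Vp (u + (- (\sum_a u a 0 * V a i) / V i i) *: e_ i).
  rewrite quad_formD// dei de.
  have -> : (u^T *m (V - l *m l^T) *m u) 0 0 =
      (u^T *m V *m u) 0 0 - (\sum_a u a 0 * V a i) ^+ 2 / V i i.
    rewrite mulmxBr mulmxBl mxE [in X in _ + X]mxE; congr (_ - _).
    rewrite quad_formE expr2 big_distrl big_distrl/=; apply: eq_bigr => a _.
    rewrite -mulrA big_distrl big_distrr/=; apply: eq_bigr => b _.
    by rewrite ll; ring.
  rewrite (_ : _ + _ + _ = (u^T *m V *m u) 0 0 - (\sum_a u a 0 * V a i) ^+ 2 / V i i)//.
  by field.
- move=> a b; rewrite !inE negb_and negbK mxE [in X in _ + X]mxE ll.
  case/orP => [/eqP ->|aS]; last by rewrite !(VS a)// mul0r mul0r subrr.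
  by rewrite [V b i]Vsym; field.
move=> ls e; exists (l :: ls); rewrite big_cons -e.
by rewrite addrC subrK.
Qed.

End PsdDecomposition.

Section GaussianVectors.
Context {R : realType} {k : nat}.

Lemma measurable_lincomb {d : measure_display} {Om : measurableType d}
    (G : Om -> 'cV[R]_k) (u : 'cV[R]_k) :
  (forall t, measurable_fun setT (fun w => G w t 0)) ->
  measurable_fun setT (fun w => (u^T *m G w) 0 0).
Proof.
move=> mG; under eq_fun do rewrite mxE.
by apply: measurable_sum => t; apply: measurable_funM.
Qed.

Lemma gaussian_vector_exists (ls : seq 'cV[R]_k) :
  exists (d' : measure_display) (Om : measurableType d') (Q : probability Om R)
    (G : Om -> 'cV[R]_k), gaussian_vector Q G (\sum_(l <- ls) l *m l^T).
Proof.
elim: ls => [|l ls [d' [Om [Q [G [mG lG]]]]]].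
  exists _, (measurableTypeR R), (normal_prob 0 1 : probability (measurableTypeR R) R), (fun=> 0).
  split=> [t|u A mA]; first by under eq_fun do rewrite mxE; exact: measurable_cst.
  rewrite big_nil !mulmx0 mul0mx !mxE.
  have := @normal_scale_law R 0 _ mA; rewrite expr0n/= => <-; congr (normal_prob 0 1 _).
  by apply/funext => z /=; rewrite mul0r.
pose N01 := normal_prob 0 1 : probability (measurableTypeR R) R.
exists _, (Om * measurableTypeR R)%type, (Q \x N01)%E, (fun w => G w.1 + w.2 *: l).
split=> [t|u A mA].
  rewrite (_ : (fun w => _) = (fun w : Om * measurableTypeR R => G w.1 t 0 + w.2 * l t 0)); last first.
    by apply/funext => w; rewrite !mxE.
  apply: measurable_funD; first exact: (measurableT_comp (mG t) measurable_fst).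
  by apply: measurable_funM => //; exact: measurable_snd.
have s20 : 0 <= (u^T *m (\sum_(l <- ls) l *m l^T) *m u) 0 0.
  rewrite mulmx_sumr mulmx_suml summxE; apply: sumr_ge0 => j _.
  rewrite mulmxA -mulmxA mxE big_ord1.
  have -> : (j^T *m u) = (u^T *m j)^T by rewrite trmx_mul trmxK.
  by rewrite [_^T 0 0]mxE -expr2 sqr_ge0.
have law := @normal_sum_law R _ _ Q _ _ ((u^T *m l) 0 0) s20 (measurable_lincomb u mG) (lG u) A mA.
rewrite big_cons mulmxDr mulmxDl [in RHS]mxE addrC.
have -> : (u^T *m (l *m l^T) *m u) 0 0 = ((u^T *m l) 0 0) ^+ 2.
  rewrite mulmxA -mulmxA mxE big_ord1.
  have -> : (l^T *m u) = (u^T *m l)^T by rewrite trmx_mul trmxK.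
  by rewrite [_^T 0 0]mxE expr2.
rewrite -law; congr (product_measure1 _ _ _); apply/funext => w /=.
by rewrite mulmxDr -scalemxAr mxE [in X in _ + X]mxE [w.2 * _]mulrC.
Qed.

Lemma gaussian_cos {d' : measure_display} {Om : measurableType d'} (Q : probability Om R)
    (G : Om -> 'cV[R]_k) (V : 'M[R]_k) (u : 'cV[R]_k) (y : R) :
  psd V -> gaussian_vector Q G V ->
  Ex Q (fun w => cos ((u^T *m G w) 0 0 + y)) = expR (- ((u^T *m V *m u) 0 0 / 2)) * cos y.
Proof.
move=> [_ pV] [mG lG]; apply: normal_cos; first exact: pV.
  exact: measurable_lincomb.
exact: lG.
Qed.

End GaussianVectors.

Section BernsteinWeights.
Context {R : realType}.

Fixpoint bern (m j : nat) (y : R) : R :=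
  if m is m'.+1 then
    y * (if j is j'.+1 then bern m' j' y else 0) + (1 - y) * bern m' j y
  else (j == 0%N)%:R.

Lemma bern_ge0 m j y : 0 <= y <= 1 -> 0 <= bern m j y.
Proof.
move=> /andP[y0 y1]; elim: m j => [|m ih] j /=; first by rewrite ler0n.
rewrite addr_ge0// mulr_ge0 ?subr_ge0//.
by case: j.
Qed.

Lemma bern_gt m j y : (m < j)%N -> bern m j y = 0.
Proof.
elim: m j => [|m ih] [|j] //= mj.
by rewrite !ih ?mulr0 ?addr0// (ltn_trans (ltnSn m)).
Qed.

Lemma bern_sum_rec m y (h : nat -> R) :
  \sum_(j < m.+2) bern m.+1 j y * h j =
  y * (\sum_(j < m.+1) bern m j y * h j.+1) + (1 - y) * (\sum_(j < m.+1) bern m j y * h j).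
Proof.
rewrite (eq_bigr (fun j : 'I_m.+2 => y * ((if nat_of_ord j is j'.+1 then bern m j' y else 0) * h j)
   + (1 - y) * (bern m j y * h j))); last by move=> j _ /=; ring.
rewrite big_split/= -!mulr_sumr; congr (_ * _ + _ * _).
  by rewrite big_ord_recl/= mul0r add0r.
by rewrite big_ord_recr/= bern_gt// mul0r addr0.
Qed.

Lemma bern_sum1 m y : \sum_(j < m.+1) bern m j y = 1.
Proof.
have -> : \sum_(j < m.+1) bern m j y = \sum_(j < m.+1) bern m j y * (fun=> 1) (nat_of_ord j).
  by apply: eq_bigr => j _; rewrite mulr1.
elim: m => [|m ih]; first by rewrite big_ord1 /= mulr1.
by rewrite (bern_sum_rec m y (fun=> 1)) ih; ring.
Qed.

Lemma bern_sum_sq m y a :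
  \sum_(j < m.+1) bern m j y * (j%:R - m%:R * y + a) ^+ 2 = m%:R * (y * (1 - y)) + a ^+ 2.
Proof.
elim: m a => [|m ih] a; first by rewrite big_ord1/= !mul0r mul1r subrr !add0r.
rewrite (bern_sum_rec m y (fun j => (j%:R - m.+1%:R * y + a) ^+ 2)).
rewrite (eq_bigr (fun j : 'I_m.+1 => bern m j y * (j%:R - m%:R * y + (a + 1 - y)) ^+ 2)); last first.
  by move=> j _; rewrite -!natr1; congr (_ * _ ^+ 2); ring.
rewrite [X in _ + _ * X](eq_bigr (fun j : 'I_m.+1 => bern m j y * (j%:R - m%:R * y + (a - y)) ^+ 2)); last first.
  by move=> j _; rewrite -!natr1; congr (_ * _ ^+ 2); ring.
by rewrite !ih -natr1; ring.
Qed.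

Lemma bern_variance m y : 0 <= y <= 1 ->
  \sum_(j < m.+2) bern m.+1 j y * (j%:R / m.+1%:R - y) ^+ 2 <= m.+1%:R^-1.
Proof.
move=> /andP[y0 y1].
rewrite (eq_bigr (fun j : 'I_m.+2 => m.+1%:R ^- 2 * (bern m.+1 j y * (j%:R - m.+1%:R * y + 0) ^+ 2))); last first.
  move=> j _; rewrite addr0 -[X in (_ - X) ^+ 2](mulKf (lt0r_neq0 (ltr0Sn R m))) [X in (X - _) ^+ 2]mulrC -mulrBr.
  by rewrite exprMn exprVn mulrCA.
rewrite -mulr_sumr bern_sum_sq expr0n/= addr0 expr2 invfM -mulrA mulKf ?pnatr_eq0//.
rewrite ler_piMr ?invr_ge0//; nra.
Qed.

End BernsteinWeights.

Section TrigPolynomials.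
Context {R : realType} {k : nat}.
Implicit Types f g : 'cV[R]_k -> R.

Inductive trig : ('cV[R]_k -> R) -> Prop :=
| trig_cos (u : 'cV[R]_k) (y : R) : trig (fun v => cos ((u^T *m v) 0 0 + y))
| trigD (f g : 'cV[R]_k -> R) : trig f -> trig g -> trig (fun v => f v + g v)
| trigZ (c : R) (f : 'cV[R]_k -> R) : trig f -> trig (fun v => c * f v).

Lemma eq_trig f g : f =1 g -> trig f -> trig g.
Proof. by move=> /funext ->. Qed.

Lemma trig_cst c : trig (fun=> c).
Proof.
apply: (eq_trig _ (trigZ c (trig_cos 0 0))) => v.
by rewrite trmx0 mul0mx mxE addr0 cos0 mulr1.
Qed.

Lemma trigM f g : trig f -> trig g -> trig (fun v => f v * g v).
Proof.
move=> tf; elim: tf g => [u y|f1 f2 _ ih1 _ ih2|c f1 _ ih1] g tg.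
- elim: tg => [w z|g1 g2 _ ih1 _ ih2|c g1 _ ih1].
  + apply: (eq_trig _ (trigZ 2^-1 (trigD (trig_cos (u + w) (y + z)) (trig_cos (u - w) (y - z))))) => v.
    rewrite linearD linearB/= mulmxDl mulmxBl [in LHS]mxE [in X in _ + X]mxE [in X in _ + cos (_ + X + _)]mxE.
    set a := (u^T *m v) 0 0; set b := (w^T *m v) 0 0.
    rewrite (_ : a + b + _ = (a + y) + (b + z)); last by ring.
    rewrite (_ : a - b + _ = (a + y) - (b + z)); last by ring.
    by rewrite cosD cosB; field.
  + by apply: (eq_trig _ (trigD ih1 ih2)) => v; rewrite mulrDr.
  + by apply: (eq_trig _ (trigZ c ih1)) => v; rewrite mulrCA.
- by apply: (eq_trig _ (trigD (ih1 _ tg) (ih2 _ tg))) => v; rewrite mulrDl.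
- by apply: (eq_trig _ (trigZ c (ih1 _ tg))) => v; rewrite mulrA.
Qed.

Lemma trig_sum (I : Type) (s : seq I) (h : I -> 'cV[R]_k -> R) :
  (forall i, trig (h i)) -> trig (fun v => \sum_(i <- s) h i v).
Proof.
move=> th; elim: s => [|i s ih].
  by apply: (eq_trig _ (trig_cst 0)) => v; rewrite big_nil.
by apply: (eq_trig _ (trigD (th i) ih)) => v; rewrite big_cons.
Qed.

Lemma trig_prod (I : Type) (s : seq I) (h : I -> 'cV[R]_k -> R) :
  (forall i, trig (h i)) -> trig (fun v => \prod_(i <- s) h i v).
Proof.
move=> th; elim: s => [|i s ih].
  by apply: (eq_trig _ (trig_cst 1)) => v; rewrite big_nil.
by apply: (eq_trig _ (trigM (th i) ih)) => v; rewrite big_cons.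
Qed.

Lemma trig_bern m j g : trig g -> trig (fun v => bern m j (g v)).
Proof.
move=> tg; elim: m j => [|m ih] j /=; first exact: trig_cst.
apply: trigD; apply: trigM => //.
- by case: j => [|j]; [exact: trig_cst|exact: ih].
- by apply: (eq_trig _ (trigD (trig_cst 1) (trigZ (-1) tg))) => v; rewrite mulN1r.
Qed.

Lemma trig_measurable {d : measure_display} {T : measurableType d} (W : T -> 'cV[R]_k) f :
  (forall t, measurable_fun setT (fun x => W x t 0)) -> trig f ->
  measurable_fun setT (fun x => f (W x)).
Proof.
move=> mW; elim => [u y|f1 f2 _ ih1 _ ih2|c f1 _ ih1].
- apply: measurableT_comp; first exact: measurable_cos.
  by apply: measurable_funD => //; exact: measurable_lincomb.
- exact: measurable_funD.
- exact: measurable_funM.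
Qed.

Lemma trig_bounded f : trig f -> exists M, forall v, `|f v| <= M.
Proof.
elim => [u y|f1 f2 _ [M1 h1] _ [M2 h2]|c f1 _ [M1 h1]].
- by exists 1 => v; exact: norm_cos_le1.
- by exists (M1 + M2) => v; rewrite (le_trans (ler_normD _ _))// lerD.
- by exists (`|c| * M1) => v; rewrite normrM ler_wpM2l.
Qed.

Lemma trig_Int {d : measure_display} {T : measurableType d} (P : probability T R)
    (W : T -> 'cV[R]_k) f :
  (forall t, measurable_fun setT (fun x => W x t 0)) -> trig f -> Int P (fun x => f (W x)).
Proof.
move=> mW tf; have [M hM] := trig_bounded tf.
by apply: (@Int_bounded _ _ _ _ _ M) => //; exact: trig_measurable.
Qed.

Lemma trig_cvg {d d' : measure_display} {T : measurableType d} {Om : measurableType d'}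
    (P : probability T R) (Q : probability Om R) (W : nat -> T -> 'cV[R]_k)
    (G : Om -> 'cV[R]_k) f :
  (forall n t, measurable_fun setT (fun x => W n x t 0)) ->
  (forall t, measurable_fun setT (fun w => G w t 0)) ->
  (forall (u : 'cV[R]_k) (y : R), Ex P (fun x => cos ((u^T *m W n x) 0 0 + y)) @[n --> \oo] -->
     Ex Q (fun w => cos ((u^T *m G w) 0 0 + y))) ->
  trig f -> Ex P (fun x => f (W n x)) @[n --> \oo] --> Ex Q (fun w => f (G w)).
Proof.
move=> mW mG hc; elim => [u y|f1 f2 t1 ih1 t2 ih2|c f1 t1 ih1]; first exact: hc.
- rewrite ExD; [|exact: trig_Int|exact: trig_Int].
  rewrite (_ : (fun n => _) = (fun n => Ex P (fun x => f1 (W n x)) + Ex P (fun x => f2 (W n x)))).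
    exact: cvgD.
  by apply/funext => n; rewrite ExD//; exact: trig_Int.
- rewrite ExZ; last exact: trig_Int.
  rewrite (_ : (fun n => _) = (fun n => c * Ex P (fun x => f1 (W n x)))).
    exact: cvgMr.
  by apply/funext => n; rewrite ExZ//; exact: trig_Int.
Qed.

End TrigPolynomials.

Section UniformContinuity.
Context {R : realType} {k : nat}.

Definition cube (L : R) (v : 'cV[R]_k) := forall t, `|v t 0| <= L.

Lemma continuous_coordP (f : 'cV[R]_k -> R) (v : 'cV[R]_k) (e : R) :
  {for v, continuous f} -> 0 < e ->
  exists2 r, 0 < r & forall w : 'cV[R]_k, (forall t, `|v t 0 - w t 0| < r) -> `|f v - f w| < e.
Proof.
move=> /cvgrPdist_lt cf e0; have /nbhs_ballP[r /= r0 hr] := cf e e0.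
exists r => // w hw; apply: hr; split => // i j; rewrite (ord1 j).
exact: hw.
Qed.

Lemma cube_unif_continuous (f : 'cV[R]_k -> R) (L e : R) : continuous f -> 0 < e ->
  exists2 r, 0 < r & forall v w : 'cV[R]_k, cube L v ->
    (forall t, `|v t 0 - w t 0| < r) -> `|f v - f w| <= e.
Proof.
move=> cf e0.
have cK : compact [set v : 'rV[R]_k | forall i, `[- L, L]%classic (v 0 i)].
  by apply: (@rV_compact R k (fun=> `[- L, L]%classic)) => i; exact: segment_compact.
have e20 : 0 < e / 2 by rewrite divr_gt0.
move/compact_near_coveringP : cK => /(_ R (0^'+) (fun r v => forall w : 'cV[R]_k,
   (forall t, `|v 0 t - w t 0| < r) -> `|f v^T - f w| <= e) _) [].
  move=> v _.
  have [r r0 hr] := continuous_coordP (cf v^T) e20.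
  have r20 : 0 < r / 2 by rewrite divr_gt0.
  exists (ball v (r / 2), [set s | s < r / 2]); first split.
  - exact: nbhsx_ballx.
  - exact: nbhs_right_lt.
  move=> [v' s] [/= vv' sr] w hw.
  have h1 : `|f v^T - f v'^T| < e / 2.
    apply: hr => t; rewrite !mxE; case: vv' => _ /(_ 0 t) /lt_trans; apply.
    by rewrite ltr_pdivrMr// ltr_pMr// ltr1n.
  have h2 : `|f v^T - f w| < e / 2.
    apply: hr => t; rewrite mxE.
    rewrite (_ : _ - _ = (v 0 t - v' 0 t) + (v' 0 t - w t 0)); last by ring.
    rewrite (le_lt_trans (ler_normD _ _))// [ltRHS]splitr ltrD//.
      by case: vv' => _ /(_ 0 t).
    by rewrite (lt_trans (hw t)).
  rewrite (_ : _ - _ = (f v^T - f w) - (f v^T - f v'^T)); last by ring.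
  by rewrite (le_trans (ler_normB _ _))// [leRHS]splitr lerD// ltW.
move=> s /= s0 hs; exists (s / 2); first by rewrite divr_gt0.
move=> v w vL vw.
have := hs (s / 2) _ _ (v^T) _ w; rewrite trmxK; apply.
- by rewrite /= sub0r normrN gtr0_norm ?divr_gt0// ltr_pdivrMr// ltr_pMr// ltr1n.
- by rewrite divr_gt0.
- by move=> i /=; rewrite mxE in_itv/= -ler_norml.
- by move=> t; rewrite mxE.
Qed.

End UniformContinuity.

Section Approximation.
Context {R : realType} {k : nat}.

Lemma cos_nincr (x y : R) : 0 <= x -> x <= y -> y <= pi -> cos y <= cos x.
Proof.
move=> x0; rewrite le_eqVlt => /orP[/eqP ->//|xy] ypi; apply: ltW.
by rewrite ltr_cos// in_itv/= ?x0 ?ypi ?andbT ?(le_trans x0 (ltW xy))// (le_trans (ltW xy)).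
Qed.

Lemma cos_lt1 (x : R) : 0 < x -> x <= pi -> cos x < 1.
Proof.
move=> x0 xpi; rewrite -cos0 ltr_cos// in_itv/= ?lexx ?pi_ge0// xpi andbT ltW//.
Qed.

(* With h = (a - b) / 2 >= 0: sin a - sin b = 2 sin h cos ((a + b) / 2)
   >= 2 (sin h)^2 = 1 - cos (a - b) since |a + b| / 2 <= pi / 2 - h. *)
Lemma sin_inj_quant (eta : R) : 0 < eta ->
  forall a b, `|a| <= pi / 2 -> `|b| <= pi / 2 -> `|sin a - sin b| < 1 - cos eta ->
    `|a - b| < eta.
Proof.
move=> eta0.
have key a b : a <= pi / 2 -> - (pi / 2) <= b -> b <= a -> sin a - sin b < 1 - cos eta -> a - b < eta.
  move=> api bpi ba.
  pose h := (a - b) / 2; pose c := (a + b) / 2.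
  have sE : sin a - sin b = 2 * cos c * sin h.
    have aE : a = c + h by rewrite /c /h; field.
    have bE : b = c - h by rewrite /c /h; field.
    by rewrite [in LHS]aE [in LHS]bE sinD sinB; ring.
  have h0 : 0 <= h by rewrite divr_ge0// subr_ge0.
  have hpi : h <= pi / 2 by rewrite /h; lra.
  have pi0 := pi_ge0 R.
  have sh0 : 0 <= sin h by apply: sin_ge0_pi; rewrite h0/=; lra.
  have cc : sin h <= cos c.
    rewrite -cosBpihalf -cosN opprB.
    have -> : cos c = cos `|c| by case: (ger0P c) => // _; rewrite cosN.
    apply: cos_nincr => //; last lra.
    by rewrite ler_norml /c /h; apply/andP; split; lra.
  have c2 : cos (a - b) = 1 - 2 * sin h ^+ 2.
    rewrite (_ : a - b = h *+ 2); last by rewrite /h mulr2n; field.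
    by rewrite cos_mulr2n cos2sin2 mulr2n; ring.
  have sq : sin h ^+ 2 <= cos c * sin h by rewrite expr2 ler_wpM2r.
  move=> lt1.
  have lt2 : cos eta < cos (a - b) by rewrite c2; lra.
  rewrite ltNge; apply/negP => le; move: lt2; rewrite ltNge => /negP; apply.
  by apply: cos_nincr; [exact: ltW|exact: le|lra].
move=> a b; rewrite !ler_norml => /andP[a1 a2] /andP[b1 b2] hs; have [ab|/ltW ab] := leP b a.
  rewrite ger0_norm ?subr_ge0//; apply: key => //.
  exact: (le_lt_trans (ler_norm _)).
rewrite distrC ger0_norm ?subr_ge0//; apply: key => //.
by rewrite distrC in hs; exact: (le_lt_trans (ler_norm _)).
Qed.

Lemma trig_approx (f : 'cV[R]_k -> R) (M L e : R) : continuous f ->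
  (forall v, `|f v| <= M) -> 0 < e -> 0 < L ->
  exists B, [/\ trig B, forall v, `|B v| <= M & forall v, cube L v -> `|f v - B v| <= e].
Proof.
move=> cf fM e0 L0.
have M0 : 0 <= M by exact: (le_trans (normr_ge0 (f 0))).
have pi0 := pi_gt0 R.
have e20 : 0 < e / 2 by rewrite divr_gt0.
have [r r0 hr] := cube_unif_continuous L cf e20.
pose a := pi / 2 / L.
have a0 : 0 < a by rewrite !divr_gt0.
pose eta := Num.min (a * r) pi.
have eta0 : 0 < eta by rewrite lt_min pi0 mulr_gt0.
have etapi : eta <= pi by rewrite ge_min lexx orbT.
have etar : eta <= a * r by rewrite ge_min lexx.
have ceta : 0 < 1 - cos eta.
  by rewrite subr_gt0; exact: cos_lt1.
pose dl := (1 - cos eta) / 4.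
have dl0 : 0 < dl by rewrite divr_gt0.
pose y (v : 'cV[R]_k) t := (1 + sin (a * v t 0)) / 2.
have y01 v t : 0 <= y v t <= 1.
  by rewrite /y; have := sin_le1 (a * v t 0); have := sin_geN1 (a * v t 0); lra.
have ty t : trig (y ^~ t).
  apply: (eq_trig _ (trigD (trig_cst 2^-1) (trigZ 2^-1 (trig_cos (a *: delta_mx t 0) (- (pi / 2)))))) => v.
  rewrite linearZ/= -scalemxAl mxE trmx_delta -rowE mxE.
  have -> : cos (a * v t 0 - pi / 2) = sin (a * v t 0) by rewrite cosB cos_pihalf sin_pihalf; ring.
  by rewrite /y; field.
have [m hm] : exists m, 2 * M * k%:R / dl ^+ 2 / m.+1%:R <= e / 2.
  exists (Num.trunc (2 * M * k%:R / dl ^+ 2 / (e / 2))).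
  by rewrite ler_pdivrMr// -ler_pdivrMl// mulrC ltW// truncnS_gt.
pose pt (z : {ffun 'I_k -> 'I_m.+2}) : 'cV[R]_k :=
  \col_t (asin (2 * ((z t)%:R / m.+1%:R) - 1) / a).
pose wt (z : {ffun 'I_k -> 'I_m.+2}) v := \prod_t bern m.+1 (z t) (y v t).
have wt0 z v : 0 <= wt z v by apply: prodr_ge0 => t _; exact: bern_ge0.
have wt_marg v t (h : nat -> R) : \sum_z wt z v * h (z t) = \sum_(j < m.+2) bern m.+1 j (y v t) * h j.
  rewrite (eq_bigr (fun z : {ffun 'I_k -> 'I_m.+2} => \prod_s (bern m.+1 (z s) (y v s) * (if s == t then h (z s) else 1)))); last first.
    move=> z _; rewrite big_split/=; congr (_ * _).
    by rewrite -big_mkcond/= big_pred1_eq.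
  rewrite -(bigA_distr_bigA (fun s (j : 'I_m.+2) => bern m.+1 j (y v s) * (if s == t then h j else 1))).
  rewrite (bigD1 t)//= [X in _ * X]big1 ?mulr1.
    by apply: eq_bigr => j _; rewrite eqxx.
  move=> s /negbTE st; rewrite -[RHS](bern_sum1 m.+1 (y v s)).
  by apply: eq_bigr => j _; rewrite st mulr1.
have wt1 v : \sum_z wt z v = 1.
  rewrite /wt -(bigA_distr_bigA (fun s (j : 'I_m.+2) => bern m.+1 j (y v s))).
  by apply: big1 => s _; exact: bern_sum1.
exists (fun v => \sum_z f (pt z) * wt z v); split.
- apply: trig_sum => z; apply: trigZ; apply: trig_prod => t; exact: (trig_bern _ _ (ty t)).
- move=> v; rewrite (le_trans (ler_norm_sum _ _ _))// -[leRHS]mulr1 -(wt1 v) mulr_sumr.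
  by apply: ler_sum => z _; rewrite normrM (ger0_norm (wt0 _ _)) ler_wpM2r.
- move=> v vL.
  have q01 (z : {ffun 'I_k -> 'I_m.+2}) t : 0 <= ((z t)%:R / m.+1%:R : R) <= 1.
    by rewrite divr_ge0//= ler_pdivrMr// mul1r ler_nat -ltnS.
  have qN1 (z : {ffun 'I_k -> 'I_m.+2}) t : -1 <= (2 * ((z t)%:R / m.+1%:R) - 1 : R) <= 1.
    by have := q01 z t; set q := (_ / _ : R); move: q => q /andP[q1 q2]; apply/andP; split; lra.
  have ypt z t : y (pt z) t = (z t)%:R / m.+1%:R.
    rewrite /y /pt mxE mulrCA divff ?gt_eqF// mulr1 asinK; first by field.
    by rewrite in_itv/=.
  have ptL z : cube L (pt z).
    move=> t; rewrite mxE normrM normfV (gtr0_norm a0) ler_pdivrMr//.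
    rewrite (_ : L * a = pi / 2); last by rewrite /a mulrC divfK// gt_eqF.
    by rewrite ler_norml (asin_lepi2 (qN1 z t)) (asin_geNpi2 (qN1 z t)).
  have est z : `|f v - f (pt z)| <= e / 2 + 2 * M / dl ^+ 2 * \sum_t ((z t)%:R / m.+1%:R - y v t) ^+ 2.
    have s0 : 0 <= \sum_t ((z t)%:R / m.+1%:R - y v t) ^+ 2 by apply: sumr_ge0 => t _; exact: sqr_ge0.
    have [/forallP near|] := boolP [forall t, `|(z t)%:R / m.+1%:R - y v t| < dl].
      rewrite (le_trans (hr v (pt z) vL _))//; last by rewrite lerDl mulr_ge0// divr_ge0 ?mulr_ge0 ?sqr_ge0.
      move=> t; have := near t; rewrite -(ypt z t) /y -mulrBl normrM [`|2^-1|]ger0_norm ?invr_ge0//.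
      rewrite (_ : _ - _ = sin (a * pt z t 0) - sin (a * v t 0)); last by ring.
      rewrite /dl => near1.
      have cL w : cube L w -> `|a * w t 0| <= pi / 2.
        move=> wL; rewrite normrM (gtr0_norm a0) (_ : pi / 2 = a * L); last by rewrite /a divfK// gt_eqF.
        by rewrite ler_wpM2l ?(ltW a0)//; exact: wL.
      have := @sin_inj_quant eta eta0 (a * pt z t 0) (a * v t 0) (cL _ (ptL z)) (cL _ vL).
      rewrite -mulrBr normrM (gtr0_norm a0) => near2.
      rewrite distrC -(ltr_pM2l a0); apply: (lt_le_trans _ etar); apply: near2; lra.
    rewrite negb_forall => /existsP[t]; rewrite -leNgt => far.
    rewrite (@le_trans _ _ (2 * M))//.
      by rewrite (le_trans (ler_normB _ _))// mulr_natl mulr2n lerD.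
    rewrite -[leLHS]add0r lerD ?(ltW e20)//.
    rewrite [leRHS]mulrAC ler_pdivlMr ?exprn_gt0// ler_wpM2l ?mulr_ge0//.
    rewrite (bigD1 t)//= -[leLHS]addr0 lerD//.
      by rewrite -[leRHS]real_normK ?num_real// lerXn2r// nnegrE ltW.
    by apply: sumr_ge0 => s _; exact: sqr_ge0.
  have -> : f v - \sum_z f (pt z) * wt z v = \sum_z (f v - f (pt z)) * wt z v.
    under [RHS]eq_bigr do rewrite mulrBl.
    by rewrite sumrB -mulr_sumr wt1 mulr1.
  rewrite (le_trans (ler_norm_sum _ _ _))//.
  have step : \sum_z `|(f v - f (pt z)) * wt z v| <=
      \sum_(z : {ffun 'I_k -> 'I_m.+2}) (e / 2 + 2 * M / dl ^+ 2 * \sum_t ((z t)%:R / m.+1%:R - y v t) ^+ 2) * wt z v.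
    by apply: ler_sum => z _; rewrite normrM (ger0_norm (wt0 _ _)) ler_wpM2r.
  apply: (le_trans step).
  under eq_bigr do rewrite mulrDl.
  rewrite big_split/= -mulr_sumr wt1 mulr1 [leRHS]splitr lerD2l.
  apply: le_trans hm.
  under eq_bigr do rewrite -mulrA mulr_suml.
  rewrite -mulr_sumr exchange_big/=.
  rewrite (_ : 2 * M * k%:R / dl ^+ 2 / m.+1%:R = 2 * M / dl ^+ 2 * (k%:R / m.+1%:R)); last by ring.
  rewrite ler_wpM2l//; first by rewrite divr_ge0 ?mulr_ge0 ?sqr_ge0.
  rewrite (@le_trans _ _ (\sum_(t < k) m.+1%:R^-1))//; last first.
    by rewrite sumr_const card_ord -[leLHS]mulr_natl.
  apply: ler_sum => t _.
  under eq_bigr do rewrite mulrC.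
  rewrite (wt_marg v t (fun j => (j%:R / m.+1%:R - y v t) ^+ 2)).
  exact: bern_variance.
Qed.

End Approximation.

Section ConvergenceInDistribution.
Context {R : realType} {k : nat}.

Lemma fineP_bigsetU {d : measure_display} {T : measurableType d} (P : probability T R)
    (I : finType) (F : I -> set T) : (forall i, measurable (F i)) ->
  fine (P (\big[setU/set0]_i F i)) <= \sum_i fine (P (F i)).
Proof.
move=> mF; elim: (index_enum I) => [|i s ih]; first by rewrite !big_nil measure0.
rewrite !big_cons (le_trans (fineP_setU _ _ _))//; last by rewrite lerD2l.
by apply: bigsetU_measurable => j _.
Qed.

Lemma continuous_comp_measurable {d : measure_display} {T : measurableType d}
    (W : T -> 'cV[R]_k) (f : 'cV[R]_k -> R) (M : R) :
  (forall t, measurable_fun setT (fun x => W x t 0)) -> continuous f ->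
  (forall v, `|f v| <= M) -> measurable_fun setT (fun x => f (W x)).
Proof.
move=> mW cf fM.
have /choice[B hB] : forall n : nat, exists B, [/\ trig B, forall v, `|B v| <= M
    & forall v, cube n.+1%:R v -> `|f v - B v| <= n.+1%:R^-1].
  by move=> n; apply: trig_approx => //; rewrite invr_gt0.
apply: (@measurable_fun_cvg _ _ _ setT (fun n x => B n (W x))) => //.
  by move=> n; apply: trig_measurable => //; case: (hB n).
move=> x _; apply/cvgrPdist_le => e e0; near=> n.
have [_ _ h] := hB n; rewrite (le_trans (h (W x) _))//.
  move=> t; apply: (@le_trans _ _ (\sum_t `|W x t 0|)).
    by rewrite (bigD1 t)//= lerDl sumr_ge0.
  by rewrite (@le_trans _ _ n%:R) ?ler_nat//; near: n; exact: nbhs_infty_ger.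
rewrite -[leRHS]invrK lef_pV2 ?posrE ?invr_gt0//.
by rewrite (@le_trans _ _ n%:R) ?ler_nat//; near: n; exact: nbhs_infty_ger.
Unshelve. all: end_near. Qed.

Lemma Ex_diff_cube {d : measure_display} {T : measurableType d} (P : probability T R)
    (W : T -> 'cV[R]_k) (f g : 'cV[R]_k -> R) (M L e : R) (E : set T) :
  measurable_fun setT (fun x => f (W x)) -> measurable_fun setT (fun x => g (W x)) ->
  (forall v, `|f v| <= M) -> (forall v, `|g v| <= M) ->
  (forall v, cube L v -> `|f v - g v| <= e) -> 0 <= e ->
  measurable E -> (forall x, ~ E x -> cube L (W x)) ->
  `|Ex P (fun x => f (W x)) - Ex P (fun x => g (W x))| <= e + 2 * M * fine (P E).
Proof.
move=> mf mg fM gM fg e0 mE EL.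
have fi := @Int_bounded _ _ _ P _ M mf (fun x => fM (W x)).
have gi := @Int_bounded _ _ _ P _ M mg (fun x => gM (W x)).
have M0 : 0 <= M by exact: (le_trans (normr_ge0 (f 0))).
rewrite -ExB// -Ex_indic// -ExZ; last exact: Int_indic.
rewrite -[X in X + _](Ex_cst P) -ExD; [|exact: Int_cst|exact/IntZ/Int_indic].
apply: norm_Ex_le.
- exact: measurable_funB.
- by apply: IntD; [exact: Int_cst|exact/IntZ/Int_indic].
move=> x; rewrite indicE; have [xE|xE] := boolP (x \in E); last first.
  by rewrite mulr0 addr0; apply: fg; apply: EL => /mem_set; exact/negP.
rewrite mulr1 (le_trans (ler_normB _ _))// (le_trans (lerD (fM _) (gM _)))//.
by rewrite mulr_natl mulr2n lerDr.
Qed.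

Lemma gaussian_tight {d : measure_display} {Om : measurableType d} (Q : probability Om R)
    (G : Om -> 'cV[R]_k) (V : 'M[R]_k) (e : R) : psd V -> gaussian_vector Q G V -> 0 < e ->
  exists L, exists E, [/\ measurable E, fine (Q E) <= e & forall w, ~ E w -> cube L (G w)].
Proof.
move=> [_ pV] [mG lG] e0.
pose N01 := normal_prob 0 1 : probability (measurableTypeR R) R.
have sq t : Int Q (fun w => G w t 0 ^+ 2) /\ 0 <= Ex Q (fun w => G w t 0 ^+ 2).
  split; last by apply: Ex_ge0 => w; exact: sqr_ge0.
  pose u : 'cV[R]_k := delta_mx t 0.
  have uG w : (u^T *m G w) 0 0 = G w t 0 by rewrite /u trmx_delta -rowE mxE.
  have s20 := pV u.
  pose s := Num.sqrt ((u^T *m V *m u) 0 0).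
  have [i2 _] := @normal_mean_sq R.
  apply: (@Int_same_dist _ _ _ _ _ _ _ Q N01 (fun w => G w t 0) (fun z : measurableTypeR R => s * z) (fun z : R => z ^+ 2)) => //.
  - exact: mulrl_measurable.
  - move=> A mA; have := lG u A mA; rewrite -[(u^T *m V *m u) 0 0](sqr_sqrtr s20).
    rewrite -(normal_scale_law s mA) => <-; congr (Q _).
    by apply/seteqP; split => w /=; rewrite uG.
  - by have := IntZ (s ^+ 2) i2; apply: eq_integrable => // z _ /=; rewrite exprMn.
pose C := \sum_t Ex Q (fun w => G w t 0 ^+ 2).
pose L := Num.sqrt (C / e) + 1.
have C0 : 0 <= C by apply: sumr_ge0 => t _; case: (sq t).
have L0 : 0 < L by rewrite ltr_wpDl// sqrtr_ge0.
exists L, (\big[setU/set0]_t [set w | L < `|G w t 0|]).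
have mE t : measurable [set w | L < `|G w t 0|] by exact: norm_superlevel_measurable.
split.
- by apply: bigsetU_measurable => t _.
- apply: (@le_trans _ _ (\sum_t fine (Q [set w | L < `|G w t 0|]))).
    exact: fineP_bigsetU.
  apply: (@le_trans _ _ (C / L ^+ 2)).
    rewrite mulr_suml; apply: ler_sum => t _; apply: chebyshev_Ex => //.
    by case: (sq t).
  rewrite ler_pdivrMr ?exprn_gt0// mulrC -ler_pdivrMr//.
  rewrite -[leLHS]sqr_sqrtr ?divr_ge0// ?(ltW e0)//.
  by rewrite lerXn2r ?nnegrE ?sqrtr_ge0// ?(ltW L0)// lerDl.
- move=> w wE t; rewrite leNgt; apply/negP => h; apply: wE.
  by rewrite -bigcup_seq; exists t => //=; rewrite mem_index_enum.
Qed.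

Definition tight {d : measure_display} {T : measurableType d} (P : probability T R)
    (W : nat -> T -> 'cV[R]_k) :=
  forall e, 0 < e -> exists L N, forall n, (N <= n)%N ->
    exists E, [/\ measurable E, fine (P E) <= e & forall x, ~ E x -> cube L (W n x)].

Theorem cvg_dist_of_cos {d : measure_display} {T : measurableType d} (P : probability T R)
    (W : nat -> T -> 'cV[R]_k) (V : 'M[R]_k) : psd V ->
  (forall n t, measurable_fun setT (fun x => W n x t 0)) ->
  (forall (u : 'cV[R]_k) (y : R), Ex P (fun x => cos ((u^T *m W n x) 0 0 + y)) @[n --> \oo] -->
     expR (- ((u^T *m V *m u) 0 0 / 2)) * cos y) ->
  tight P W -> cvg_dist_normal P W V.
Proof.
move=> pV mW hc tW.
have [ls Vls] := psd_decomp pV.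
have [d' [Om [Q [G gG]]]] := gaussian_vector_exists ls.
rewrite -Vls in gG; exists d', Om, Q, G; split=> // f cf [M fM].
have mG := gG.1.
have M0 : 0 <= M by exact: (le_trans (normr_ge0 (f 0))).
apply/cvgrPdist_le => e e0.
have c4 : 0 < 4 * M + 4 by lra.
pose e1 := e / (4 * M + 4).
have e10 : 0 < e1 by rewrite divr_gt0.
have [LG [EG [mEG PEG hEG]]] := gaussian_tight pV gG e10.
have [LW [N hN]] := tW _ e10.
pose L := Num.max LG LW + `|LG| + 1.
have L0 : 0 < L.
  rewrite /L; have h : LG <= Num.max LG LW by rewrite le_max lexx.
  have := ler_norm (- LG); rewrite normrN; lra.
have [B [tB BM hB]] := trig_approx cf fM e10 L0.
have cubeL l v : l <= Num.max LG LW -> @cube R k l v -> cube L v.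
  by move=> lm h t; rewrite (le_trans (h t))// (le_trans lm)// /L -addrA lerDl addr_ge0.
have mfG := continuous_comp_measurable mG cf fM.
have mBG := trig_measurable mG tB.
have dG : `|Ex Q (fun w => f (G w)) - Ex Q (fun w => B (G w))| <= e1 + 2 * M * e1.
  apply: (@le_trans _ _ (e1 + 2 * M * fine (Q EG))).
    apply: (@Ex_diff_cube _ _ _ _ _ _ _ L) => //; first exact: ltW.
    by move=> w /hEG; apply: cubeL; rewrite le_max lexx.
  by rewrite lerD2l ler_wpM2l// mulr_ge0.
have hcG (u : 'cV[R]_k) (y : R) : Ex P (fun x => cos ((u^T *m W n x) 0 0 + y)) @[n --> \oo] -->
     Ex Q (fun w => cos ((u^T *m G w) 0 0 + y)).
  by rewrite (gaussian_cos u y pV gG).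
have /cvgrPdist_le /(_ _ e10) cB := trig_cvg mW mG hcG tB.
near=> n.
have dB : `|Ex Q (fun w => B (G w)) - Ex P (fun x => B (W n x))| <= e1.
  by near: n.
have [EW [mEW PEW hEW]] : exists E, [/\ measurable E, fine (P E) <= e1 & forall x, ~ E x -> cube LW (W n x)].
  by apply: hN; near: n; exact: nbhs_infty_ge.
have mfW := continuous_comp_measurable (mW n) cf fM.
have mBW := trig_measurable (mW n) tB.
have dW : `|Ex P (fun x => f (W n x)) - Ex P (fun x => B (W n x))| <= e1 + 2 * M * e1.
  apply: (@le_trans _ _ (e1 + 2 * M * fine (P EW))).
    apply: (@Ex_diff_cube _ _ _ _ _ _ _ L) => //; first exact: ltW.
    by move=> w /hEW; apply: cubeL; rewrite le_max lexx orbT.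
  by rewrite lerD2l ler_wpM2l// mulr_ge0.
set a := Ex Q _ in dG *; set b := Ex Q _ in dG dB; set c := Ex P _ in dB dW; set a' := Ex P _ in dW *.
rewrite (_ : a - a' = (a - b) + (b - c) - (a' - c)); last by ring.
have eE : e = 4 * M * e1 + 4 * e1 by rewrite /e1; field; rewrite gt_eqF.
rewrite (le_trans (ler_normB _ _))// (le_trans (lerD (ler_normD _ _) (lexx _)))//.
rewrite eE; lra.
Unshelve. all: end_near. Qed.

End ConvergenceInDistribution.

Section StochasticOrder.
Context {R : realType} {d : measure_display} {T : measurableType d}.
Variable P : probability T R.
Implicit Types (U V : nat -> T -> R) (c e : R).

(* Stated with measurable exceptional sets, so that the calculus below needs no
   measurability of the sequences themselves. *)
Definition whp (S : nat -> T -> Prop) := forall e, 0 < e -> exists N, forall n, (N <= n)%N ->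
  exists E, [/\ measurable E, fine (P E) <= e & forall x, ~ E x -> S n x].

Definition bddP U := forall e, 0 < e -> exists L N, forall n, (N <= n)%N ->
  exists E, [/\ measurable E, fine (P E) <= e & forall x, ~ E x -> `|U n x| <= L].

Definition litoP U := forall e, 0 < e -> whp (fun n x => `|U n x| <= e).

Definition cvP U c := litoP (fun n x => U n x - c).

Lemma whp_and S1 S2 : whp S1 -> whp S2 -> whp (fun n x => S1 n x /\ S2 n x).
Proof.
move=> h1 h2 e e0; have e20 : 0 < e / 2 by rewrite divr_gt0.
have [N1 {}h1] := h1 _ e20; have [N2 {}h2] := h2 _ e20.
exists (maxn N1 N2) => n; rewrite geq_max => /andP[/h1[E1 [m1 p1 s1]] /h2[E2 [m2 p2 s2]]].
exists (E1 `|` E2); split; first exact: measurableU.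
  by rewrite (le_trans (fineP_setU _ m1 m2))// [leRHS]splitr lerD.
by move=> x /not_orP[/s1 ? /s2 ?].
Qed.

Lemma whp_mono (S1 S2 : nat -> T -> Prop) : whp S1 ->
  (exists N, forall n, (N <= n)%N -> forall x, S1 n x -> S2 n x) -> whp S2.
Proof.
move=> h1 [N1 h2] e e0; have [N2 {}h1] := h1 _ e0.
exists (maxn N1 N2) => n; rewrite geq_max => /andP[/h2 s2 /h1[E [mE pE sE]]].
by exists E; split => // x /sE /s2.
Qed.

Lemma whp_imply (S1 S2 : nat -> T -> Prop) : whp S1 ->
  (forall n x, S1 n x -> S2 n x) -> whp S2.
Proof. by move=> h1 h2; apply: (whp_mono h1); exists 0%N => n _; exact: h2. Qed.

Lemma whp_all S : (forall n x, S n x) -> whp S.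
Proof. by move=> h e e0; exists 0%N => n _; exists set0; rewrite measure0; split => //; exact: ltW. Qed.

Lemma litoP_whp_eq U V : litoP U -> whp (fun n x => U n x = V n x) -> litoP V.
Proof.
move=> hU hE e e0; apply: (whp_imply (whp_and (hU e e0) hE)) => n x [].
by move=> h <-.
Qed.

Lemma eq_litoP U V : (forall n x, U n x = V n x) -> litoP U -> litoP V.
Proof. by move=> h hU; apply: (litoP_whp_eq hU); apply: whp_all. Qed.

Lemma eq_bddP U V : (forall n x, U n x = V n x) -> bddP U -> bddP V.
Proof.
move=> h hU e /hU[L [N {}hU]]; exists L, N => n /hU[E [mE pE hE]].
by exists E; split => // x /hE; rewrite h.
Qed.

Lemma litoPD U V : litoP U -> litoP V -> litoP (fun n x => U n x + V n x).
Proof.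
move=> hU hV e e0; have e20 : 0 < e / 2 by rewrite divr_gt0.
apply: (whp_imply (whp_and (hU _ e20) (hV _ e20))) => n x [u v].
by rewrite (le_trans (ler_normD _ _))// [leRHS]splitr lerD.
Qed.

Lemma bddPD U V : bddP U -> bddP V -> bddP (fun n x => U n x + V n x).
Proof.
move=> hU hV e e0; have e20 : 0 < e / 2 by rewrite divr_gt0.
have [L1 [N1 {}hU]] := hU _ e20; have [L2 [N2 {}hV]] := hV _ e20.
exists (L1 + L2), (maxn N1 N2) => n; rewrite geq_max => /andP[/hU[E1 [m1 p1 s1]] /hV[E2 [m2 p2 s2]]].
exists (E1 `|` E2); split; first exact: measurableU.
  by rewrite (le_trans (fineP_setU _ m1 m2))// [leRHS]splitr lerD.
by move=> x /not_orP[/s1 ? /s2 ?]; rewrite (le_trans (ler_normD _ _))// lerD.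
Qed.

Lemma bddP_litoPM U V : bddP U -> litoP V -> litoP (fun n x => U n x * V n x).
Proof.
move=> hU hV e e0 e' e'0; have e20 : 0 < e' / 2 by rewrite divr_gt0.
have [L [N1 {}hU]] := hU _ e20.
have L0 : 0 < `|L| + 1 by rewrite ltr_wpDl.
have eL : 0 < e / (`|L| + 1) by rewrite divr_gt0.
have [N2 {}hV] := hV _ eL _ e20.
exists (maxn N1 N2) => n; rewrite geq_max => /andP[/hU[E1 [m1 p1 s1]] /hV[E2 [m2 p2 s2]]].
exists (E1 `|` E2); split; first exact: measurableU.
  by rewrite (le_trans (fineP_setU _ m1 m2))// [leRHS]splitr lerD.
move=> x /not_orP[/s1 u /s2 v]; rewrite normrM.
rewrite (@le_trans _ _ ((`|L| + 1) * (e / (`|L| + 1))))//; last by rewrite mulrC divfK// gt_eqF.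
by rewrite ler_pM// (le_trans u)// (le_trans (ler_norm _))// lerDl.
Qed.

Lemma bddP_cst c : bddP (fun _ _ => c).
Proof.
move=> e e0; exists `|c|, 0%N => n _; exists set0; rewrite measure0.
by split => //; exact: ltW.
Qed.

Lemma litoP_bddP U : litoP U -> bddP U.
Proof. by move=> hU e e0; have [N h] := hU 1 ltr01 e e0; exists 1, N. Qed.

Lemma litoP0 : litoP (fun _ _ => 0).
Proof. by move=> e e0; apply: whp_all => n x; rewrite normr0 ltW. Qed.

Lemma litoPZ c U : litoP U -> litoP (fun n x => c * U n x).
Proof. exact/bddP_litoPM/bddP_cst. Qed.

Lemma cvP_cst c : cvP (fun _ _ => c) c.
Proof. by apply: (eq_litoP _ litoP0) => n x; rewrite subrr. Qed.

Lemma cvP_bddP U c : cvP U c -> bddP U.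
Proof.
move=> h; apply: (eq_bddP _ (bddPD (litoP_bddP h) (bddP_cst c))) => n x.
by rewrite subrK.
Qed.

Lemma eq_cvP U V c : (forall n x, U n x = V n x) -> cvP U c -> cvP V c.
Proof. by move=> h; apply: eq_litoP => n x; rewrite h. Qed.

Lemma cvP_whp_eq U V c : cvP U c -> whp (fun n x => U n x = V n x) -> cvP V c.
Proof.
by move=> h e; apply: (litoP_whp_eq h); apply: (whp_imply e) => n x ->.
Qed.

Lemma cvPD U V a b : cvP U a -> cvP V b -> cvP (fun n x => U n x + V n x) (a + b).
Proof.
by move=> hU hV; apply: (eq_litoP _ (litoPD hU hV)) => n x; ring.
Qed.

Lemma cvPM U V a b : cvP U a -> cvP V b -> cvP (fun n x => U n x * V n x) (a * b).
Proof.
move=> hU hV.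
apply: (eq_litoP _ (litoPD (bddP_litoPM (cvP_bddP hU) hV) (litoPZ b hU))) => n x; ring.
Qed.

Lemma cvPZ c U a : cvP U a -> cvP (fun n x => c * U n x) (c * a).
Proof. exact/cvPM/cvP_cst. Qed.

Lemma cvPB U V a b : cvP U a -> cvP V b -> cvP (fun n x => U n x - V n x) (a - b).
Proof.
move=> hU hV; rewrite -[- b]mulN1r.
by apply: (eq_cvP _ (cvPD hU (cvPZ (-1) hV))) => n x; rewrite mulN1r.
Qed.

Lemma cvP_sum (I : Type) (s : seq I) (U : I -> nat -> T -> R) (c : I -> R) :
  (forall i, cvP (U i) (c i)) -> cvP (fun n x => \sum_(i <- s) U i n x) (\sum_(i <- s) c i).
Proof.
move=> h; elim: s => [|i s ih].
  by rewrite big_nil; apply: (eq_cvP _ (cvP_cst 0)) => n x; rewrite big_nil.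
by rewrite big_cons; apply: (eq_cvP _ (cvPD (h i) ih)) => n x; rewrite big_cons.
Qed.

Lemma cvP_prod (I : Type) (s : seq I) (U : I -> nat -> T -> R) (c : I -> R) :
  (forall i, cvP (U i) (c i)) -> cvP (fun n x => \prod_(i <- s) U i n x) (\prod_(i <- s) c i).
Proof.
move=> h; elim: s => [|i s ih].
  by rewrite big_nil; apply: (eq_cvP _ (cvP_cst 1)) => n x; rewrite big_nil.
by rewrite big_cons; apply: (eq_cvP _ (cvPM (h i) ih)) => n x; rewrite big_cons.
Qed.

Lemma cvP_neq0 U c : cvP U c -> c != 0 -> whp (fun n x => U n x != 0).
Proof.
move=> h c0; have c20 : 0 < `|c| / 2 by rewrite divr_gt0 ?normr_gt0.
apply: (whp_imply (h _ c20)) => n x; apply: contraTneq => ->.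
by rewrite sub0r normrN -ltNge ltr_pdivrMr ?normr_gt0// ltr_pMr ?normr_gt0// ltr1n.
Qed.

Lemma cvP_inv U c : cvP U c -> c != 0 -> cvP (fun n x => (U n x)^-1) c^-1.
Proof.
move=> h c0; have c20 : 0 < `|c| / 2 by rewrite divr_gt0 ?normr_gt0.
have cp : 0 < `|c| by rewrite normr_gt0.
have bI : bddP (fun n x => - (U n x)^-1 * c^-1).
  move=> e e0; have [N hN] := h _ c20 _ e0.
  exists (2 / `|c| * `|c|^-1), N => n /hN[E [mE pE sE]]; exists E; split => // x /sE hx.
  have Ux : `|c| / 2 <= `|U n x|.
    have := ler_normB (U n x) (U n x - c); rewrite opprB addrC subrK; lra.
  rewrite normrM normrN !normfV ler_wpM2r ?invr_ge0//.
  by rewrite -[leRHS]invrK invf_div lef_pV2 ?posrE// (lt_le_trans c20).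
apply: (litoP_whp_eq (bddP_litoPM bI h)).
apply: (whp_imply (cvP_neq0 h c0)) => n x U0.
by field; rewrite U0 c0.
Qed.

Lemma bddP_L2 U C : (forall n, measurable_fun setT (U n)) ->
  (forall n, Int P (fun x => U n x ^+ 2)) ->
  (forall n, Ex P (fun x => U n x ^+ 2) <= C) -> bddP U.
Proof.
move=> mU iU hC e e0.
have C0 : 0 <= C by apply: (le_trans _ (hC 0%N)); apply: Ex_ge0 => x; exact: sqr_ge0.
pose L := Num.sqrt (C / e) + 1.
have L0 : 0 < L by rewrite ltr_wpDl// sqrtr_ge0.
exists L, 0%N => n _; exists [set x | L < `|U n x|]; split.
- exact: norm_superlevel_measurable.
- rewrite (le_trans (chebyshev_Ex L0 (mU n) (iU n)))//.
  rewrite ler_pdivrMr ?exprn_gt0// (le_trans (hC n))// mulrC -ler_pdivrMr//.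
  rewrite -[leLHS]sqr_sqrtr ?divr_ge0// ?(ltW e0)//.
  by rewrite lerXn2r ?nnegrE ?sqrtr_ge0// ?(ltW L0)// lerDl.
- by move=> x /=; rewrite leNgt => h; apply/negP.
Qed.

Lemma Ex_cos_slutsky U V (l y : R) : (forall n, measurable_fun setT (U n)) ->
  (forall n, measurable_fun setT (V n)) -> litoP (fun n x => U n x - V n x) ->
  Ex P (fun x => cos (V n x + y)) @[n --> \oo] --> l ->
  Ex P (fun x => cos (U n x + y)) @[n --> \oo] --> l.
Proof.
move=> mU mV UV hV.
have mc (W : T -> R) : measurable_fun setT W -> measurable_fun setT (fun x : T => cos (W x + y)).
  move=> mW; apply: measurableT_comp; first exact: measurable_cos.
  exact: measurable_funD.
have ic (W : T -> R) : measurable_fun setT W -> Int P (fun x : T => cos (W x + y)).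
  move=> mW; apply: (@Int_bounded _ _ _ _ _ 1); first exact: mc.
  by move=> x; exact: norm_cos_le1.
apply/cvgrPdist_le => e e0; have e40 : 0 < e / 4 by rewrite divr_gt0.
have [N hN] := UV _ e40 _ e40.
near=> n.
have [E [mE pE sE]] : exists E, [/\ measurable E, fine (P E) <= e / 4
    & forall x, ~ E x -> `|U n x - V n x| <= e / 4].
  by apply: hN; near: n; exact: nbhs_infty_ge.
have d1 : `|l - Ex P (fun x => cos (V n x + y))| <= e / 4.
  by near: n; move/cvgrPdist_le : hV; exact.
have d2 : `|Ex P (fun x => cos (V n x + y)) - Ex P (fun x => cos (U n x + y))| <= e / 4 + 2 * fine (P E).
  rewrite -ExB; [|exact: ic|exact: ic].
  rewrite -Ex_indic// -ExZ; last exact: Int_indic.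
  rewrite -[X in X + _](Ex_cst P) -ExD; [|exact: Int_cst|exact/IntZ/Int_indic].
  apply: norm_Ex_le.
  - by apply: measurable_funB; exact: mc.
  - by apply: IntD; [exact: Int_cst|exact/IntZ/Int_indic].
  move=> x; rewrite indicE; have [xE|xE] := boolP (x \in E); last first.
    rewrite mulr0 addr0 (le_trans (cos_lip _ _))// opprD addrACA subrr addr0 distrC.
    by apply: sE => /mem_set; exact/negP.
  rewrite mulr1 (le_trans (ler_normB _ _))// (le_trans (lerD (norm_cos_le1 _) (norm_cos_le1 _)))//.
  by lra.
rewrite -(subrKA (Ex P (fun x => cos (V n x + y)))) (le_trans (ler_normD _ _))//; lra.
Unshelve. all: end_near. Qed.

End StochasticOrder.

Section LawOfLargeNumbers.
Context {R : realType} {d : measure_display} {T : measurableType d}.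
Variable P : probability T R.

Lemma Ex_sum_sq (Z : nat -> T -> R) :
  (forall i, measurable_fun setT (Z i)) ->
  (forall i, same_dist P (Z i) P (Z 0%N)) ->
  (forall i j, i != j -> indep2 P (Z i) (Z j)) ->
  Int P (fun x => Z 0%N x ^+ 2) -> Ex P (Z 0%N) = 0 ->
  forall n, Int P (fun x => (\sum_(i < n) Z i x) ^+ 2) /\
    Ex P (fun x => (\sum_(i < n) Z i x) ^+ 2) = n%:R * Ex P (fun x => Z 0%N x ^+ 2).
Proof.
move=> mZ sZ iZ Z2 Z0 n.
have msq : measurable_fun setT (fun u : R => u ^+ 2) by exact: exprn_measurable.
have Zi2 i : Int P (fun x => Z i x ^+ 2) := Int_same_dist (mZ i) (mZ 0%N) msq (sZ i) Z2.
have EZi2 i : Ex P (fun x => Z i x ^+ 2) = Ex P (fun x => Z 0%N x ^+ 2) :=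
  Ex_same_dist (mZ i) (mZ 0%N) msq (sZ i) Z2.
have Zi i : Int P (Z i) by apply: Int_of_sq.
have EZi i : Ex P (Z i) = 0.
  by rewrite -Z0; apply: (@Ex_same_dist _ _ _ _ _ _ _ P P (Z i) (Z 0%N) (fun u => u)) => //; exact: Zi.
have iij i j : Int P (fun x => Z i x * Z j x) by apply: IntM_sq.
have Eij i j : i != j -> Ex P (fun x => Z i x * Z j x) = 0.
  by move=> ij; have [_ ->] := Ex_indepM (Zi i) (Zi j) (iZ i j ij); rewrite EZi mul0r.
have sqE x : (\sum_(i < n) Z i x) ^+ 2 = \sum_(i < n) \sum_(j < n) Z i x * Z j x.
  by rewrite expr2 mulr_suml; apply: eq_bigr => i _; rewrite mulr_sumr.
split.
  have : Int P (fun x => \sum_(i < n) \sum_(j < n) Z i x * Z j x).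
    by apply: Int_sum => i _; apply: Int_sum => j _.
  by apply: eq_integrable => // x _ /=; rewrite sqE.
rewrite (eq_Ex P sqE) Ex_sum; last by move=> i _; apply: Int_sum => j _.
rewrite (eq_bigr (fun=> Ex P (fun x => Z 0%N x ^+ 2))); last first.
  move=> i _; rewrite Ex_sum; last by move=> j _.
  rewrite (bigD1 i)//= [X in _ + X]big1 ?addr0.
    by rewrite -(EZi2 i); apply: eq_Ex => x; rewrite expr2.
  by move=> j ji; apply: Eij; rewrite eq_sym.
by rewrite sumr_const card_ord mulr_natl.
Qed.

Lemma bddP_normalized_sum (Z : nat -> T -> R) :
  (forall i, measurable_fun setT (Z i)) ->
  (forall i, same_dist P (Z i) P (Z 0%N)) ->
  (forall i j, i != j -> indep2 P (Z i) (Z j)) ->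
  Int P (fun x => Z 0%N x ^+ 2) -> Ex P (Z 0%N) = 0 ->
  bddP P (fun n x => (\sum_(i < n) Z i x) / Num.sqrt n%:R).
Proof.
move=> mZ sZ iZ Z2 Z0.
have h := Ex_sum_sq mZ sZ iZ Z2 Z0.
have s0 : 0 <= Ex P (fun x => Z 0%N x ^+ 2) by apply: Ex_ge0 => x; exact: sqr_ge0.
have e n x : ((\sum_(i < n) Z i x) / Num.sqrt n%:R) ^+ 2 = n%:R^-1 * (\sum_(i < n) Z i x) ^+ 2.
  by rewrite expr_div_n sqr_sqrtr// mulrC.
apply: (@bddP_L2 _ _ _ _ _ (Ex P (fun x => Z 0%N x ^+ 2))).
- by move=> n; apply: measurable_funM => //; exact: measurable_sum.
- move=> n; have := IntZ n%:R^-1 (h n).1.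
  by apply: eq_integrable => // x _ /=; rewrite e.
- move=> n; rewrite (eq_Ex P (e n)) ExZ; last by case: (h n).
  rewrite (h n).2; case: n => [|n]; first by rewrite !mul0r mulr0.
  by rewrite mulKf ?pnatr_eq0.
Qed.

Lemma trunc_L1 (Z : T -> R) (e : R) : Int P Z -> 0 < e ->
  exists2 M : R, 0 <= M & Ex P (fun x => `|Z x - (if `|Z x| <= M then Z x else 0)|) <= e.
Proof.
move=> iZ e0; have mZ := Int_measurable iZ.
pose f n x := `|Z x - (if `|Z x| <= n%:R then Z x else 0)|.
have c0 : Ex P (f n) @[n --> \oo] --> Ex P (fun=> 0).
  apply: (Ex_dominated_cvg (g := fun x => `|Z x|)).
  - move=> n; apply: measurableT_comp => //; apply: measurable_funB => //.
    apply: measurable_fun_ifT => //.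
    by apply: measurable_fun_ler => //; exact: measurableT_comp.
  - exact: Int_norm.
  - move=> n x; rewrite /f normr_id; case: ifP => _; last by rewrite subr0.
    by rewrite subrr normr0.
  - move=> x; apply: cvg_near_cst; near=> n; rewrite /f.
    suff -> : `|Z x| <= n%:R by rewrite subrr normr0.
    by near: n; exact: nbhs_infty_ger.
rewrite Ex_cst in c0; move/cvgrPdist_le : c0 => /(_ e e0) [N _ hN].
exists N%:R => //; have := hN N (leqnn N); rewrite sub0r normrN.
exact: (le_trans (ler_norm _)).
Unshelve. all: end_near. Qed.

Lemma wlln (Z : nat -> T -> R) :
  (forall i, measurable_fun setT (Z i)) ->
  (forall i, same_dist P (Z i) P (Z 0%N)) ->
  (forall i j, i != j -> indep2 P (Z i) (Z j)) -> Int P (Z 0%N) ->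
  cvP P (fun n x => n%:R^-1 * \sum_(i < n) Z i x) (Ex P (Z 0%N)).
Proof.
move=> mZ sZ iZ iZ0 e e0 e' e'0.
pose r := Num.min (e / 3) (e / 3 * (e' / 2)).
have r0 : 0 < r by rewrite lt_min !mulr_gt0 ?invr_gt0.
have re : r <= e / 3 by rewrite ge_min lexx.
have re' : r <= e / 3 * (e' / 2) by rewrite ge_min lexx orbT.
have [M M0 hM] := trunc_L1 iZ0 r0.
pose h (u : R) := if `|u| <= M then u else 0.
have mh : measurable_fun setT h.
  apply: measurable_fun_ifT => //.
  by apply: measurable_fun_ler => //; exact: normr_measurable.
have hb u : `|h u| <= M by rewrite /h; case: ifP => //; rewrite normr0.
pose mu := Ex P (fun x => h (Z 0%N x)).
pose g u := h u - mu.
have mg : measurable_fun setT g by exact: measurable_funB.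
have ih i : Int P (fun x => h (Z i x)).
  by apply: (@Int_bounded _ _ _ _ _ M) => //; exact: measurableT_comp.
have ig2 : Int P (fun x => g (Z 0%N x) ^+ 2).
  apply: (@Int_bounded _ _ _ _ _ ((M + `|mu|) ^+ 2)).
    by apply: measurable_funX; exact: measurableT_comp.
  move=> x; rewrite normrX lerXn2r ?nnegrE ?addr_ge0//.
  by rewrite (le_trans (ler_normB _ _))// lerD2r.
have g0 : Ex P (fun x => g (Z 0%N x)) = 0.
  by rewrite ExB// ?Ex_cst ?subrr//; exact: Int_cst.
have bO := @bddP_normalized_sum (fun i x => g (Z i x)) (fun i => measurableT_comp mg (mZ i))
  (fun i => same_dist_comp mg (sZ i)) (fun i j ij => indep2_comp mg mg (iZ i j ij)) ig2 g0.
have [L [N1 {}bO]] := bO (e' / 2) (divr_gt0 e'0 (ltr0Sn _ 1)).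
pose N2 := (Num.trunc ((`|L| / (e / 3)) ^+ 2)).+1.
exists (maxn N1 N2) => n; rewrite geq_max => /andP[/bO[E1 [m1 p1 s1]] nN2].
have n0 : (0 < n)%N by exact: leq_trans nN2.
have np : 0 < n%:R :> R by rewrite ltr0n.
have sn0 : 0 < Num.sqrt (n%:R : R) by rewrite sqrtr_gt0.
pose rest x := n%:R^-1 * \sum_(i < n) (Z i x - h (Z i x)).
have mid : measurable_fun setT (fun u : R => u - h u) by exact: measurable_funB.
have ir i : Int P (fun x => Z i x - h (Z i x)).
  apply: (Int_same_dist (mZ i) (mZ 0%N) mid (sZ i)); exact: IntB.
have irest : Int P rest by apply: IntZ; apply: Int_sum => i _.
have Er : Ex P (fun x => `|rest x|) <= r.
  apply: (@le_trans _ _ (Ex P (fun x => n%:R^-1 * \sum_(i < n) `|Z i x - h (Z i x)|))).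
    apply: le_Ex; [exact: Int_norm|by apply: IntZ; apply: Int_sum => i _; exact: Int_norm|].
    move=> x; rewrite /rest normrM ger0_norm ?invr_ge0// ler_wpM2l ?invr_ge0//.
    exact: ler_norm_sum.
  rewrite ExZ; last by apply: Int_sum => i _; exact: Int_norm.
  rewrite Ex_sum; last by move=> i _; exact: Int_norm.
  rewrite ler_pdivrMl//.
  apply: (@le_trans _ _ (\sum_(i < n) r)); last by rewrite sumr_const card_ord mulr_natl.
  apply: ler_sum => i _; apply: le_trans hM.
  have mid' : measurable_fun setT (fun u : R => `|u - h u|) by exact: measurableT_comp.
  rewrite (Ex_same_dist (mZ i) (mZ 0%N) mid' (sZ i))//.
  exact: (Int_norm (ir 0%N)).
have e30 : 0 < e / 3 by rewrite divr_gt0.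
exists (E1 `|` [set x | e / 3 < `|rest x|]).
have m2 : measurable [set x | e / 3 < `|rest x|].
  exact: (norm_superlevel_measurable _ (Int_measurable irest)).
split; first exact: measurableU.
  rewrite (le_trans (fineP_setU _ m1 m2))// [leRHS]splitr lerD//.
  rewrite (le_trans (markov_Ex e30 irest))// ler_pdivrMr// (le_trans Er)//.
  by rewrite mulrC.
move=> x /not_orP[/s1 h1 /negP]; rewrite -leNgt => h2.
have h3 : `|mu - Ex P (Z 0%N)| <= e / 3.
  rewrite distrC -ExB// (le_trans (norm_Ex (ir 0%N)))// (le_trans _ re)//.
have h4 : `|n%:R^-1 * \sum_(i < n) g (Z i x)| <= e / 3.
  have -> : n%:R^-1 * \sum_(i < n) g (Z i x) = (\sum_(i < n) g (Z i x)) / Num.sqrt n%:R / Num.sqrt n%:R.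
    by rewrite -mulrA -invfM -expr2 sqr_sqrtr// mulrC.
  rewrite normrM normfV (gtr0_norm sn0) ler_pdivrMr// (le_trans h1)//.
  rewrite (le_trans (ler_norm _))// mulrC -ler_pdivrMr//.
  have q0 : 0 <= `|L| / (e / 3) by rewrite divr_ge0// ltW.
  rewrite -(ger0_norm q0) -sqrtr_sqr ler_sqrt ?(ltW np)//; apply: ltW.
  by rewrite (lt_le_trans (truncnS_gt _))// ler_nat.
have -> : n%:R^-1 * (\sum_(i < n) Z i x) - Ex P (Z 0%N) =
   n%:R^-1 * \sum_(i < n) g (Z i x) + rest x + (mu - Ex P (Z 0%N)).
  rewrite /rest -mulrDr -big_split/=.
  rewrite [in RHS](eq_bigr (fun i : 'I_n => Z i x - mu)); last by move=> i _; rewrite /g; ring.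
  rewrite sumrB sumr_const card_ord -[mu *+ n]mulr_natl mulrBr mulKf ?gt_eqF//.
  by ring.
rewrite (le_trans (ler_normD _ _))// (le_trans (lerD (ler_normD _ _) (lexx _)))//; lra.
Qed.

End LawOfLargeNumbers.

Section RectangleSpace.
Context {R : realType} {C : finType}.

Definition rects : set (set (C -> R)) :=
  [set E | exists2 B : C -> set R, (forall c, measurable (B c))
     & E = [set f | forall c, B c (f c)]].

Definition fspace := g_sigma_algebraType rects.

Lemma measurable_fspace_coord (c : C) : measurable_fun setT (fun f : fspace => f c).
Proof.
move=> _ B mB; rewrite setTI; apply: sub_sigma_algebra.
exists (fun c' => if c' == c then B else setT) => [c'|]; first by case: ifP.
apply/seteqP; split => f /= h; last by have := h c; rewrite eqxx.
by move=> c'; case: eqP => // ->.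
Qed.

Lemma measurable_to_fspace {d' : measure_display} {T' : measurableType d'}
    (F : T' -> C -> R) :
  (forall c, measurable_fun setT (fun x => F x c)) ->
  measurable_fun setT (F : T' -> fspace).
Proof.
move=> mF; apply: (@measurability _ _ T' fspace setT F rects) => // _ [_ [B mB ->] <-].
rewrite setTI (_ : _ @^-1` _ = \bigcap_(c in setT) ((fun x => F x c) @^-1` (B c))); last first.
  by apply/seteqP; split => x h c; [move=> _; exact: h|exact: (h c Logic.I)].
apply: fin_bigcap_measurable; first exact: finite_finset.
by move=> c _; rewrite -[X in measurable X]setTI; exact: mF.
Qed.

Lemma setI_closed_rects : setI_closed rects.
Proof.
move=> _ _ [B1 m1 ->] [B2 m2 ->]; exists (fun c => B1 c `&` B2 c) => [c|].
  exact: measurableI.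
by apply/seteqP; split => f /=; [move=> [h1 h2] c|move=> h; split => c; case: (h c)].
Qed.

Lemma same_dist_rects {d1 d2 : measure_display} {T1 : measurableType d1}
    {T2 : measurableType d2} (P : probability T1 R) (Q : probability T2 R)
    (F : T1 -> C -> R) (G : T2 -> C -> R) :
  (forall c, measurable_fun setT (fun x => F x c)) ->
  (forall c, measurable_fun setT (fun x => G x c)) ->
  (forall B : C -> set R, (forall c, measurable (B c)) ->
    P [set x | forall c, B c (F x c)] = Q [set x | forall c, B c (G x c)]) ->
  same_dist P (F : T1 -> fspace) Q (G : T2 -> fspace).
Proof.
move=> mF mG FG A mA.
have mF' := measurable_to_fspace mF; have mG' := measurable_to_fspace mG.
pose nF := measure_function_pushforward__canonical__measure_function_Measure P mF'.
pose nG := measure_function_pushforward__canonical__measure_function_Measure Q mG'.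
apply: (@measure_unique _ R fspace rects (fun=> setT) _ _ _ _ nF nG) => //.
- exact: setI_closed_rects.
- by move=> _; exists (fun=> setT) => //; apply/seteqP; split.
- by rewrite bigcup_const.
- by move=> _ [B mB ->]; exact: FG.
- move=> _; apply: (@le_lt_trans _ _ 1%E); last exact: ltry.
  by apply: probability_le1; rewrite preimage_setT.
Qed.

End RectangleSpace.
Arguments fspace R C : clear implicits.

Section MutualIndependence.
Context {R : realType} {d : measure_display} {T : measurableType d}.
Variables (P : probability T R) (I : eqType) (C : finType) (W : I -> C -> T -> R).
Hypothesis mW : forall i c, measurable_fun setT (W i c).
Hypothesis indW : mutually_independent P W.

Let ev (J : seq I) (B : I -> C -> set R) : set T :=
  [set x | forall i, i \in J -> rect_event (W i) (B i) x].

Definition rect_system (J : seq I) : set (set T) :=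
  [set E | exists2 B : I -> C -> set R, (forall i c, measurable (B i c)) & E = ev J B].

Let measurable_rect B i : (forall i c, measurable (B i c)) ->
  measurable (rect_event (W i) (B i)).
Proof.
move=> mB; rewrite (_ : rect_event _ _ = \bigcap_(c in setT) ((W i c) @^-1` (B i c))); last first.
  by apply/seteqP; split => x h c; [move=> _; exact: h|exact: (h c Logic.I)].
apply: fin_bigcap_measurable; first exact: finite_finset.
by move=> c _; rewrite -[X in measurable X]setTI; exact: mW.
Qed.

Let measurable_ev J B : (forall i c, measurable (B i c)) -> measurable (ev J B).
Proof.
move=> mB; elim: J => [|i J ih].
  by rewrite (_ : ev [::] B = setT)//; apply/seteqP; split.
rewrite (_ : ev (i :: J) B = rect_event (W i) (B i) `&` ev J B).
  by apply: measurableI => //; exact: measurable_rect.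
apply/seteqP; split => x /= h.
  by split=> [|j jJ]; apply: h; rewrite inE ?eqxx ?jJ ?orbT.
by case: h => h1 h2 j; rewrite inE => /orP[/eqP ->|/h2].
Qed.

Lemma indep2_rect_system (J1 J2 : seq I) (U V : T -> R) : uniq (J1 ++ J2) ->
  measurable_fun setT (U : g_sigma_algebraType (rect_system J1) -> R) ->
  measurable_fun setT (V : g_sigma_algebraType (rect_system J2) -> R) ->
  indep2 P U V.
Proof.
move=> uJ mU mV A B mA mB.
have msys J : rect_system J `<=` measurable by move=> _ [D mD ->]; exact: measurable_ev.
have Isys J : setI_closed (rect_system J).
  move=> _ _ [B1 m1 ->] [B2 m2 ->]; exists (fun i c => B1 i c `&` B2 i c) => [i c|].
    exact: measurableI.
  apply/seteqP; split => x /=; first by move=> [h1 h2] i iJ c; split; [exact: h1|exact: h2].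
  by move=> h; split => i iJ c; case: (h i iJ c).
have Tsys J : rect_system J setT.
  by exists (fun _ _ => setT) => //; apply/seteqP; split.
have sU : <<s rect_system J1 >> (U @^-1` A) by have := mU measurableT A mA; rewrite setTI.
have sV : <<s rect_system J2 >> (V @^-1` B) by have := mV measurableT B mB; rewrite setTI.
apply: (indep_sigma (@msys J1) (@msys J2) (@Isys J1) (@Isys J2) (Tsys J1) (Tsys J2) _ sU sV).
move=> _ _ [B1 m1 ->] [B2 m2 ->].
pose B3 i := if i \in J1 then B1 i else B2 i.
have m3 i c : measurable (B3 i c) by rewrite /B3; case: ifP.
move: (uJ); rewrite cat_uniq => /and3P[u1 dJ u2].
have nJ1 i : i \in J2 -> i \notin J1.
  by move=> iJ2; apply: contra dJ => iJ1; apply/hasP; exists i.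
have -> : ev J1 B1 `&` ev J2 B2 = ev (J1 ++ J2) B3.
  apply/seteqP; split => x /=.
    move=> [h1 h2] i; rewrite mem_cat /B3 => /orP[iJ|iJ]; first by rewrite iJ; exact: h1.
    by rewrite (negbTE (nJ1 i iJ)); exact: h2.
  move=> h; split => i iJ.
    by have := h i; rewrite mem_cat iJ /B3 iJ; exact.
  by have := h i; rewrite mem_cat iJ orbT /B3 (negbTE (nJ1 i iJ)); exact.
have key J D : uniq J -> (forall i c, measurable (D i c)) ->
    P (ev J D) = (\prod_(i <- J) fine (P (rect_event (W i) (D i))))%:E.
  by move=> uJ' mD; rewrite -indW// fineK// fin_num_measure//; exact: measurable_ev.
rewrite !key// -EFinM; congr EFin; rewrite big_cat/=; congr (_ * _);
  rewrite big_seq [RHS]big_seq; apply: eq_bigr => i iJ; rewrite /B3.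
  by rewrite iJ.
by rewrite (negbTE (nJ1 i iJ)).
Qed.

Lemma measurable_rect_system (J : seq I) i c : i \in J ->
  measurable_fun setT (W i c : g_sigma_algebraType (rect_system J) -> R).
Proof.
move=> iJ _ B mB; rewrite setTI; apply: sub_sigma_algebra.
exists (fun i' c' => if (i' == i) && (c' == c) then B else setT).
  by move=> i' c'; case: ifP.
apply/seteqP; split => x /= h.
  by move=> i' _ c'; case: andP => // -[/eqP -> /eqP ->].
by have := h i iJ c; rewrite !eqxx.
Qed.

End MutualIndependence.

Section MeasurableMatrices.
Context {R : realType} {d : measure_display} {T : measurableType d}.

Lemma measurable_invr : measurable_fun setT (fun x : R => x^-1).
Proof.
apply: (@measurable_fun_cvg _ _ _ setT (fun n (x : R) => x / (x ^+ 2 + n.+1%:R^-1))) => //.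
  move=> n; apply: continuous_measurable_fun => x.
  have pos : 0 < x ^+ 2 + n.+1%:R^-1 by rewrite ltr_wpDl ?sqr_ge0.
  apply: cvgM; first exact: cvg_id.
  apply: cvgV; first by rewrite gt_eqF.
  by apply: cvgD; [exact: exprn_continuous|exact: cvg_cst].
move=> x _; have [->|x0] := eqVneq x 0.
  by rewrite invr0; under eq_fun do rewrite mul0r; exact: cvg_cst.
have -> : x^-1 = x / (x ^+ 2 + 0) by rewrite addr0 expr2 invfM mulrA divff// mul1r.
apply: cvgM; first exact: cvg_cst.
apply: cvgV; first by rewrite addr0 sqrf_eq0.
by apply: cvgD; [exact: cvg_cst|exact: cvg_harmonic].
Qed.

Lemma measurable_funV (f : T -> R) : measurable_fun setT f ->
  measurable_fun setT (fun x => (f x)^-1).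
Proof. by move=> mf; exact: (measurableT_comp measurable_invr mf). Qed.

Definition mmx m n (M : T -> 'M[R]_(m, n)) :=
  forall i j, measurable_fun setT (fun x => M x i j).

Lemma mmx_mul m n q (M : T -> 'M[R]_(m, n)) (N : T -> 'M[R]_(n, q)) :
  mmx M -> mmx N -> mmx (fun x => M x *m N x).
Proof.
move=> mM mN i j; under eq_fun do rewrite mxE.
by apply: measurable_sum => l; exact: measurable_funM.
Qed.

Lemma mmx_sum m n (J : Type) (s : seq J) (M : J -> T -> 'M[R]_(m, n)) :
  (forall l, mmx (M l)) -> mmx (fun x => \sum_(l <- s) M l x).
Proof.
by move=> mM i j; under eq_fun do rewrite summxE; apply: measurable_sum => l; exact: mM.
Qed.

Lemma mmxZ m n (f : T -> R) (M : T -> 'M[R]_(m, n)) :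
  measurable_fun setT f -> mmx M -> mmx (fun x => f x *: M x).
Proof. by move=> mf mM i j; under eq_fun do rewrite mxE; exact: measurable_funM. Qed.

Lemma mmxB m n (M N : T -> 'M[R]_(m, n)) : mmx M -> mmx N -> mmx (fun x => M x - N x).
Proof.
by move=> mM mN i j; under eq_fun do rewrite 2!mxE; exact: measurable_funB.
Qed.

Lemma mmxT m n (M : T -> 'M[R]_(m, n)) : mmx M -> mmx (fun x => (M x)^T).
Proof. by move=> mM i j; under eq_fun do rewrite mxE; exact: mM. Qed.

Lemma mmx_det n (M : T -> 'M[R]_n) : mmx M -> measurable_fun setT (fun x => \det (M x)).
Proof.
move=> mM; rewrite /determinant; apply: measurable_sum => s; apply: measurable_funM => //.
by apply: measurable_prod => i _; exact: mM.
Qed.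

Lemma mmx_inv n (M : T -> 'M[R]_n) : mmx M -> mmx (fun x => invmx (M x)).
Proof.
move=> mM i j.
have madj : measurable_fun setT (fun x => (\adj (M x)) i j).
  under eq_fun do rewrite mxE /cofactor; apply: measurable_funM => //.
  by apply: mmx_det => a b; under eq_fun do rewrite !mxE; exact: mM.
rewrite (_ : (fun x => _) = fun x => if \det (M x) == 0 then M x i j else
    (\det (M x))^-1 * (\adj (M x)) i j); last first.
  apply/funext => x; rewrite /invmx unitmxE unitfE.
  by case: eqP => //= _; rewrite mxE.
apply: measurable_fun_ifT.
- by apply: measurable_fun_eqr => //; exact: mmx_det.
- exact: mM.
- by apply: measurable_funM => //; apply: measurable_funV; exact: mmx_det.
Qed.

Variable P : probability T R.

Definition cvmx m n (M : nat -> T -> 'M[R]_(m, n)) (L : 'M[R]_(m, n)) :=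
  forall i j, cvP P (fun n x => M n x i j) (L i j).

Lemma cvmx_mul m n q (M : nat -> T -> 'M[R]_(m, n)) (N : nat -> T -> 'M[R]_(n, q)) L K :
  cvmx M L -> cvmx N K -> cvmx (fun r x => M r x *m N r x) (L *m K).
Proof.
move=> hM hN i j; rewrite mxE.
have := cvP_sum (index_enum 'I_n) (fun l => cvPM (hM i l) (hN l j)).
by apply: eq_cvP => r x; rewrite mxE.
Qed.

Lemma cvmx_det n (M : nat -> T -> 'M[R]_n) L : cvmx M L ->
  cvP P (fun r x => \det (M r x)) (\det L).
Proof.
move=> hM; rewrite /determinant; apply: cvP_sum => s; apply: cvPZ.
by apply: cvP_prod => i; exact: hM.
Qed.

Lemma cvmx_inv n (M : nat -> T -> 'M[R]_n) L : cvmx M L -> L \in unitmx ->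
  cvmx (fun r x => invmx (M r x)) (invmx L) /\ whp P (fun r x => M r x \in unitmx).
Proof.
move=> hM uL; have dL : \det L != 0 by rewrite -unitfE -unitmxE.
have hd := cvmx_det hM; have hn := cvP_neq0 hd dL.
have hu : whp P (fun r x => M r x \in unitmx).
  by apply: (whp_imply hn) => r x; rewrite unitmxE unitfE.
split=> // i j; rewrite /invmx uL mxE.
have hadj : cvP P (fun r x => (\adj (M r x)) i j) (\adj L i j).
  rewrite mxE /cofactor.
  have : cvmx (fun r x => row' j (col' i (M r x))) (row' j (col' i L)).
    by move=> a b; rewrite !mxE; apply: (eq_cvP _ (hM _ _)) => r x; rewrite !mxE.
  move=> /cvmx_det /(cvPZ ((-1) ^+ (j + i))).
  by apply: eq_cvP => r x; rewrite mxE.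
apply: (cvP_whp_eq (cvPM (cvP_inv hd dL) hadj)).
by apply: (whp_imply hu) => r x u; rewrite u [RHS]mxE.
Qed.

Lemma cvmx_whp_eq m n (M N : nat -> T -> 'M[R]_(m, n)) L : cvmx M L ->
  whp P (fun r x => M r x = N r x) -> cvmx N L.
Proof.
by move=> hM e i j; apply: (cvP_whp_eq (hM i j)); apply: (whp_imply e) => r x ->.
Qed.

Lemma pd_unitmx n (M : 'M[R]_n) : pd M -> M \in unitmx.
Proof.
move=> [_ pM]; rewrite -row_free_unit -kermx_eq0; apply: contraT => /rowV0Pn[v vk v0].
have vM : v *m M = 0 by apply/sub_kermxP.
have := pM v^T; rewrite trmxK vM mul0mx mxE ltxx; apply.
by rewrite trmx_eq0.
Qed.

Lemma cvg_in_prob_cvP n (bh : nat -> T -> 'cV[R]_n) (b : 'cV[R]_n) :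
  (forall r j, measurable_fun setT (fun x => bh r x j 0)) ->
  cvg_in_prob P bh b -> cvmx bh b.
Proof.
move=> mb hb i j; rewrite (ord1 j) => e e0 e' e'0.
have /cvgrPdist_le /(_ _ e'0) [N _ hN] := hb e e0.
exists N => r /hN; rewrite sub0r normrN => hr.
have mc l : measurable [set x | e < `|bh r x l 0 - b l 0|].
  by apply: norm_superlevel_measurable; exact: measurable_funB.
have le_norm l x : `|bh r x l 0 - b l 0| <= `|bh r x - b|.
  rewrite [leRHS]mx_normrE.
  have := le_bigmax (0 : R) (fun ij : 'I_n * 'I_1 => `|(bh r x - b) ij.1 ij.2|) (l, 0).
  by rewrite /= !mxE.
have mE : measurable [set x | e < `|bh r x - b|].
  rewrite (_ : [set x | _] = \big[setU/set0]_l [set x | e < `|bh r x l 0 - b l 0|]).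
    by apply: bigsetU_measurable => l _.
  rewrite -bigcup_seq; apply/seteqP; split => x /=.
    move=> ex; have nz : mx_norm (bh r x - b) != 0 by rewrite gt_eqF// (lt_trans e0).
    have [[l l1] /= ll] := mx_norm_neq0 nz.
    exists l; first by rewrite /= mem_index_enum.
    by move: ll; rewrite (ord1 l1) !mxE => ll; rewrite /= -ll.
  by move=> [l _ /=] /lt_le_trans; apply.
exists [set x | e < `|bh r x i 0 - b i 0|]; split => //.
  apply: le_trans (le_trans (ler_norm _) hr); apply: fineP_le => //.
  by move=> x /= /lt_le_trans; apply.
by move=> x /negP; rewrite -leNgt.
Qed.

End MeasurableMatrices.

Section SquareIntegrable.
Context {R : realType} {d : measure_display} {T : measurableType d}.
Variable P : probability T R.

Definition L2 (f : T -> R) := measurable_fun setT f /\ Int P (fun x => f x ^+ 2).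

Lemma L2_Int f : L2 f -> Int P f.
Proof. by move=> [mf f2]; exact: Int_of_sq. Qed.

Lemma L2M_Int f g : L2 f -> L2 g -> Int P (fun x => f x * g x).
Proof. by move=> [mf f2] [mg g2]; exact: IntM_sq. Qed.

Lemma L2_cst c : L2 (fun=> c).
Proof. by split=> //; exact: Int_cst. Qed.

Lemma L2D f g : L2 f -> L2 g -> L2 (fun x => f x + g x).
Proof.
move=> Lf Lg; split; first by apply: measurable_funD; [case: Lf|case: Lg].
have := IntD (IntD Lf.2 Lg.2) (IntZ 2 (L2M_Int Lf Lg)).
by apply: eq_integrable => // x _ /=; congr EFin; ring.
Qed.

Lemma L2Z c f : L2 f -> L2 (fun x => c * f x).
Proof.
move=> [mf f2]; split; first exact: measurable_funM.
by have := IntZ (c ^+ 2) f2; apply: eq_integrable => // x _ /=; rewrite exprMn.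
Qed.

Lemma eq_L2 f g : f =1 g -> L2 f -> L2 g.
Proof. by move=> /funext ->. Qed.

Lemma L2B f g : L2 f -> L2 g -> L2 (fun x => f x - g x).
Proof.
by move=> Lf /(L2Z (-1)) Lg; apply: (eq_L2 _ (L2D Lf Lg)) => x; rewrite mulN1r.
Qed.

Lemma L2_sum (J : Type) (s : seq J) (h : J -> T -> R) :
  (forall j, L2 (h j)) -> L2 (fun x => \sum_(j <- s) h j x).
Proof.
move=> Lh; elim: s => [|j s ih].
  by apply: (eq_L2 _ (L2_cst 0)) => x; rewrite big_nil.
by apply: (eq_L2 _ (L2D (Lh j) ih)) => x; rewrite big_cons.
Qed.

Lemma L2_bounded_mul (a f : T -> R) : measurable_fun setT a -> (forall x, `|a x| <= 1) -> L2 f ->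
  L2 (fun x => a x * f x).
Proof.
move=> ma a1 [mf f2]; split; first exact: measurable_funM.
apply: (Int_le _ f2); first by apply: measurable_funX; exact: measurable_funM.
move=> x; rewrite ger0_norm ?sqr_ge0// exprMn ler_piMl ?sqr_ge0//.
by rewrite -[leLHS]real_normK ?num_real// exprn_ile1.
Qed.

End SquareIntegrable.

Section Trial.
Context {R : realType} {d : measure_display} {T : measurableType d}.
Variables (P : probability T R) (k p : nat) (pi : 'I_k -> R)
  (Y : nat -> 'I_k -> T -> R) (X : nat -> 'I_p -> T -> R) (A : nat -> T -> 'I_k).
Hypothesis pi01 : forall t, 0 < pi t < 1.
Hypothesis pi1 : \sum_t pi t = 1.
Hypothesis mY : forall i t, measurable_fun setT (Y i t).
Hypothesis mX : forall i j, measurable_fun setT (X i j).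
Hypothesis mA : forall i t, measurable [set x | A i x = t].
Hypothesis sameYX : forall i, same_law P (data_vec Y X i) (data_vec Y X 0).
Hypothesis sqYX : forall c, P.-integrable setT (fun x => ((data_vec Y X 0 c x) ^+ 2)%:E).
Hypothesis pdX : pd (SigmaX P X).
Hypothesis piA : forall i t, P [set x | A i x = t] = (pi t)%:E.
Hypothesis indYXA : mutually_independent P (trial_family Y X A).

Local Notation C := ('I_k + 'I_p)%type.
Local Notation W := (trial_family Y X A).
Local Notation a := (@ind R d T k A).

Let pi_neq0 t : pi t != 0.
Proof. by case/andP : (pi01 t) => h _; rewrite gt_eqF. Qed.

Lemma ind_indic i t : a i t = (\1_[set x | A i x = t] : T -> R).
Proof.
apply/funext => x; rewrite /ind indicE; congr (nat_of_bool _)%:R.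
by apply/eqP/idP => [h|]; [rewrite inE|rewrite inE].
Qed.

Lemma measurable_ind i t : measurable_fun setT (a i t).
Proof. by rewrite ind_indic; exact: measurable_indic. Qed.

Lemma norm_ind_le1 i t x : `|a i t x| <= 1.
Proof. by rewrite /ind; case: (_ == _); rewrite ?normr1 ?normr0. Qed.

Lemma Int_ind i t : Int P (a i t).
Proof. by rewrite ind_indic; exact: Int_indic. Qed.

Lemma Ex_ind i t : Ex P (a i t) = pi t.
Proof. by rewrite ind_indic Ex_indic// piA. Qed.

Lemma ind_mul i t s x : a i t x * a i s x = (t == s)%:R * a i t x.
Proof.
rewrite /ind; case: (eqVneq t s) => [->|ts]; last first.
  rewrite mul0r; case: (eqVneq (A i x) t) => [->|_]; last by rewrite mul0r.
  by rewrite (negbTE ts) mulr0.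
by case: (_ == _); rewrite ?mul1r ?mul0r.
Qed.

Let mW s c : measurable_fun setT (W s c).
Proof.
case: s => i; case: c => [t|j] /=; [exact: mY|exact: mX|exact: measurable_ind|exact: measurable_cst].
Qed.

Let data (i : nat) (x : T) : C -> R := fun c => data_vec Y X i c x.
Let patient (i : nat) (x : T) : C + C -> R :=
  fun c => match c with inl c => W (inl i) c x | inr c => W (inr i) c x end.

Let arm_val (t : 'I_k) (c : C) : R := match c with inl s => (t == s)%:R | inr _ => 0 end.

Let fineP_arm i (B : C -> set R) : (forall c, measurable (B c)) ->
  fine (P (rect_event (W (inr i)) B)) =
  \sum_t (`[< forall c, B c (arm_val t c) >])%:R * pi t.
Proof.
move=> mB.
have mE : measurable (rect_event (W (inr i)) B).
  rewrite (_ : rect_event _ _ = \bigcap_(c in setT) ((W (inr i) c) @^-1` (B c))); last first.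
    by apply/seteqP; split => x h c; [move=> _; exact: h|exact: (h c Logic.I)].
  apply: fin_bigcap_measurable; first exact: finite_finset.
  by move=> c _; rewrite -[X in measurable X]setTI; exact: mW.
rewrite -Ex_indic//.
rewrite (@eq_Ex _ _ _ _ _ (fun x => \sum_t (`[< forall c, B c (arm_val t c) >])%:R * a i t x)).
  rewrite Ex_sum; last by move=> t _; apply: IntZ; exact: Int_ind.
  by apply: eq_bigr => t _; rewrite ExZ ?Ex_ind//; exact: Int_ind.
move=> x; rewrite (bigD1 (A i x))//= big1 ?addr0; last first.
  by move=> t tA; rewrite /ind eq_sym (negbTE tA) mulr0.
rewrite /ind eqxx mulr1 indicE; congr (nat_of_bool _)%:R.
apply/idP/asboolP; rewrite inE => h c; have := h c;
by case: c.
Qed.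

Let patient_same i : same_dist P (patient i : T -> fspace R (C + C)%type) P (patient 0).
Proof.
apply: same_dist_rects => [c|c|B mB]; [by case: c => c; exact: mW|by case: c => c; exact: mW|].
pose B' (s : nat + nat) : C -> set R := fun c => match s with inl _ => B (inl c) | inr _ => B (inr c) end.
have mB' s c : measurable (B' s c) by rewrite /B'; case: s => _; exact: mB.
have ev j : [set x | forall c, B c (patient j x c)] =
    [set x | forall s, s \in [:: inl j; inr j] -> rect_event (W s) (B' s) x].
  apply/seteqP; split => x /= h.
    by move=> s; rewrite !inE => /orP[/eqP ->|/eqP ->] c; [exact: (h (inl c))|exact: (h (inr c))].
  case=> c; first by apply: (h (inl j)); rewrite inE eqxx.
  by apply: (h (inr j)); rewrite !inE eqxx orbT.
have fin j : P [set x | forall c, B c (patient j x c)] =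
    (fine (P (rect_event (data_vec Y X j) (B' (inl j)))) *
     fine (P (rect_event (W (inr j)) (B' (inr j)))))%:E.
  rewrite ev -[LHS]fineK; last first.
    rewrite -ev fin_num_measure//.
    rewrite (_ : [set x | _] = \bigcap_(c in setT) ((fun x => patient j x c) @^-1` (B c))); last first.
      by apply/seteqP; split => x h c; [move=> _; exact: h|exact: (h c Logic.I)].
    apply: fin_bigcap_measurable; first exact: finite_finset.
    by move=> c _; rewrite -[X in measurable X]setTI; case: c => c; exact: mW.
  by have := @indYXA [:: inl j; inr j] B' erefl mB'; rewrite !big_cons big_nil mulr1 => ->.
rewrite !fin sameYX; last by move=> c; exact: (mB' (inl i)).
by rewrite !fineP_arm.
Qed.

(* [pfun]: a fixed measurable function of patient [i]'s data and assignment;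
   [dfun]: of the data only, hence independent of the assignment. *)
Definition pfun (eta : nat -> T -> R) :=
  exists2 g : fspace R (C + C)%type -> R, measurable_fun setT g
    & forall i x, eta i x = g (patient i x).

Definition dfun (h : nat -> T -> R) :=
  exists2 g : fspace R C -> R, measurable_fun setT g & forall i x, h i x = g (data i x).

Lemma dfun_pfun h : dfun h -> pfun h.
Proof.
move=> [g mg hg]; exists (fun z : fspace R (C + C)%type => g (fun c => z (inl c))) => //.
apply: (measurableT_comp mg); apply: measurable_to_fspace => c.
exact: measurable_fspace_coord.
Qed.

Lemma dfun_cst c : dfun (fun _ _ => c).
Proof. by exists (fun=> c). Qed.

Lemma dfun_Y t : dfun (fun i => Y i t).
Proof. by exists (fun z : fspace R C => z (inl t)) => //; exact: measurable_fspace_coord. Qed.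

Lemma dfun_X j : dfun (fun i => X i j).
Proof. by exists (fun z : fspace R C => z (inr j)) => //; exact: measurable_fspace_coord. Qed.

Lemma dfunM f g : dfun f -> dfun g -> dfun (fun i x => f i x * g i x).
Proof.
move=> [f' mf hf] [g' mg hg]; exists (fun z => f' z * g' z); first exact: measurable_funM.
by move=> i x; rewrite hf hg.
Qed.

Lemma dfunB f g : dfun f -> dfun g -> dfun (fun i x => f i x - g i x).
Proof.
move=> [f' mf hf] [g' mg hg]; exists (fun z => f' z - g' z); first exact: measurable_funB.
by move=> i x; rewrite hf hg.
Qed.

Lemma dfun_sum (J : Type) (s : seq J) (h : J -> nat -> T -> R) :
  (forall j, dfun (h j)) -> dfun (fun i x => \sum_(j <- s) h j i x).
Proof.
move=> /(_ _)/cid2-/all_sig2[g mg hg]; exists (fun z => \sum_(j <- s) g j z).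
  exact: measurable_sum.
by move=> i x; apply: eq_bigr => j _; rewrite hg.
Qed.

Lemma pfun_ind t : pfun (fun i => a i t).
Proof.
by exists (fun z : fspace R (C + C)%type => z (inr (inl t))) => //; exact: measurable_fspace_coord.
Qed.

Lemma pfunD f g : pfun f -> pfun g -> pfun (fun i x => f i x + g i x).
Proof.
move=> [f' mf hf] [g' mg hg]; exists (fun z => f' z + g' z); first exact: measurable_funD.
by move=> i x; rewrite hf hg.
Qed.

Lemma pfunM f g : pfun f -> pfun g -> pfun (fun i x => f i x * g i x).
Proof.
move=> [f' mf hf] [g' mg hg]; exists (fun z => f' z * g' z); first exact: measurable_funM.
by move=> i x; rewrite hf hg.
Qed.

Lemma pfun_sum (J : Type) (s : seq J) (h : J -> nat -> T -> R) :
  (forall j, pfun (h j)) -> pfun (fun i x => \sum_(j <- s) h j i x).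
Proof.
move=> /(_ _)/cid2-/all_sig2[g mg hg]; exists (fun z => \sum_(j <- s) g j z).
  exact: measurable_sum.
by move=> i x; apply: eq_bigr => j _; rewrite hg.
Qed.

Let pfun_sys eta (J : seq (nat + nat)) i : pfun eta -> inl i \in J -> inr i \in J ->
  measurable_fun setT (eta i : g_sigma_algebraType (rect_system W J) -> R).
Proof.
move=> [g mg hg] lJ rJ.
rewrite (_ : eta i = g \o patient i); last by apply/funext => x; rewrite hg.
apply: (measurableT_comp mg).
apply: (@measurable_to_fspace R (C + C)%type _ (g_sigma_algebraType (rect_system W J)) (patient i)).
by case=> c; exact: measurable_rect_system.
Qed.

Lemma pfun_measurable eta i : pfun eta -> measurable_fun setT (eta i).
Proof.
move=> [g mg hg]; rewrite (_ : eta i = g \o patient i); last by apply/funext => x; rewrite hg.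
apply: (measurableT_comp mg).
by apply: (@measurable_to_fspace R (C + C)%type _ T (patient i)) => -[] c; exact: mW.
Qed.

Lemma pfun_same eta i : pfun eta -> same_dist P (eta i) P (eta 0%N).
Proof.
move=> [g mg hg]; have := same_dist_comp mg (patient_same i).
rewrite (_ : eta i = g \o patient i); last by apply/funext => x; rewrite hg.
by rewrite (_ : eta 0%N = g \o patient 0)//; apply/funext => x; rewrite hg.
Qed.

Lemma pfun_indep eta i j : pfun eta -> i != j -> indep2 P (eta i) (eta j).
Proof.
move=> pe ij; apply: (@indep2_rect_system _ _ _ P _ _ W mW indYXA [:: inl i; inr i] [:: inl j; inr j]).
- by rewrite /= !inE/= !(inj_eq (@inl_inj _ _)) !(inj_eq (@inr_inj _ _)) !negb_or/= ij.
- by apply: pfun_sys; rewrite // !inE eqxx ?orbT.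
- by apply: pfun_sys; rewrite // !inE eqxx ?orbT.
Qed.

Lemma pfun_indep_sum eta m : pfun eta -> indep2 P (fun x => \sum_(i < m) eta i x) (eta m).
Proof.
move=> pe; apply: (@indep2_rect_system _ _ _ P _ _ W mW indYXA
  ([seq inl i | i <- iota 0 m] ++ [seq inr i | i <- iota 0 m]) [:: inl m; inr m]).
- have ui (f : nat -> nat + nat) : injective f -> uniq [seq f i | i <- iota 0 m].
    by move=> fi; rewrite map_inj_uniq ?iota_uniq.
  rewrite !cat_uniq ui ?ui; [|exact: inr_inj|exact: inl_inj].
  have d1 : ~~ has (mem [seq inl i | i <- iota 0 m]) [seq inr i | i <- iota 0 m].
    by apply/hasPn => _ /mapP[i _ ->]; apply/mapP => -[].
  rewrite d1 (_ : uniq [:: inl m; inr m])// !andbT; apply/hasPn => s sm; apply/negP; move: sm; rewrite /= mem_cat => sm /orP[] /mapP[i];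
    by rewrite mem_iota => /andP[_ im] si; move: sm im; rewrite si !inE => /orP[] /eqP // [->];
    rewrite add0n ltnn.
- apply: (@measurable_sum _ (g_sigma_algebraType _) R setT 'I_m (index_enum 'I_m) (fun i => eta i)) => i.
  apply: pfun_sys => //; rewrite mem_cat; apply/orP; [left|right]; apply/mapP; exists (nat_of_ord i);
    by rewrite // mem_iota add0n ltn_ord.
- by apply: pfun_sys; rewrite // !inE eqxx ?orbT.
Qed.

Lemma Ex_ind_mul h t : dfun h -> Int P (h 0%N) ->
  Int P (fun x => a 0 t x * h 0%N x) /\ Ex P (fun x => a 0 t x * h 0%N x) = pi t * Ex P (h 0%N).
Proof.
move=> [g mg hg] ih.
have ind : indep2 P (a 0 t) (h 0%N).
  apply: (@indep2_rect_system _ _ _ P _ _ W mW indYXA [:: inr 0%N] [:: inl 0%N]) => //.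
    by apply: (@measurable_rect_system R d T _ _ W [:: inr 0%N] (inr 0%N) (inl t)); rewrite inE.
  rewrite (_ : h 0%N = g \o data 0); last by apply/funext => x; rewrite hg.
  apply: (measurableT_comp mg).
  apply: (@measurable_to_fspace R C _ (g_sigma_algebraType (rect_system W [:: inl 0%N])) (data 0)) => c.
  by apply: (@measurable_rect_system R d T _ _ W [:: inl 0%N] (inl 0%N) c); rewrite inE.
by have := Ex_indepM (Int_ind 0 t) ih ind; rewrite Ex_ind.
Qed.

Lemma pfun_wlln eta : pfun eta -> Int P (eta 0%N) ->
  cvP P (fun n x => n%:R^-1 * \sum_(i < n) eta i x) (Ex P (eta 0%N)).
Proof.
move=> pe ie; apply: wlln => //.
- by move=> i; exact: pfun_measurable.
- by move=> i; exact: pfun_same.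
- by move=> i j; exact: pfun_indep.
Qed.

Lemma pfun_bddP eta : pfun eta -> L2 P (eta 0%N) -> Ex P (eta 0%N) = 0 ->
  bddP P (fun n x => (\sum_(i < n) eta i x) / Num.sqrt n%:R).
Proof.
move=> pe [_ e2] e0; apply: bddP_normalized_sum => //.
- by move=> i; exact: pfun_measurable.
- by move=> i; exact: pfun_same.
- by move=> i j; exact: pfun_indep.
Qed.

Local Notation th t := (theta P Y t 0).
Local Notation mu j := (muX P X j 0).
Local Notation Sig := (SigmaX P X).

Let Yc t i x := Y i t x - th t.
Let Xc j i x := X i j x - mu j.

Lemma L2_Y t : L2 P (Y 0%N t).
Proof. by split=> //; exact: (sqYX (inl t)). Qed.

Lemma L2_X j : L2 P (X 0%N j).
Proof. by split=> //; exact: (sqYX (inr j)). Qed.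

Let L2_Yc t : L2 P (Yc t 0%N). Proof. exact: (L2B (L2_Y t) (L2_cst _ _)). Qed.
Let L2_Xc j : L2 P (Xc j 0%N). Proof. exact: (L2B (L2_X j) (L2_cst _ _)). Qed.
Let dfun_Yc t : dfun (Yc t). Proof. exact: (dfunB (dfun_Y t) (dfun_cst _)). Qed.
Let dfun_Xc j : dfun (Xc j). Proof. exact: (dfunB (dfun_X j) (dfun_cst _)). Qed.

Let Ex_Yc t : Ex P (Yc t 0%N) = 0.
Proof.
rewrite /Yc ExB; [|exact: L2_Int (L2_Y t)|exact: Int_cst].
by rewrite Ex_cst mxE subrr.
Qed.

Let Ex_Xc j : Ex P (Xc j 0%N) = 0.
Proof.
rewrite /Xc ExB; [|exact: L2_Int (L2_X j)|exact: Int_cst].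
by rewrite Ex_cst mxE subrr.
Qed.

Let Ex_XcXc j l : Ex P (fun x => Xc j 0 x * Xc l 0 x) = Sig j l.
Proof. by rewrite mxE. Qed.

Let Ex_XcYc j t : Ex P (fun x => Xc j 0 x * Yc t 0 x) = covXY P Y X t j 0.
Proof. by rewrite mxE. Qed.

Let Sig_unit : Sig \in unitmx.
Proof. exact: pd_unitmx. Qed.

Let covE t : covXY P Y X t = Sig *m beta_t P Y X t.
Proof. by rewrite /beta_t mulKVmx. Qed.

Let nt t n x := n%:R^-1 * n_t A n t x : R.

Let nt_cv t : cvP P (nt t) (pi t).
Proof.
rewrite -(Ex_ind 0 t).
by apply: (@pfun_wlln (fun i => a i t)); [exact: pfun_ind|exact: Int_ind].
Qed.

Let measurable_n_t n t : measurable_fun setT (n_t A n t : T -> R).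
Proof.
by apply: (@measurable_sum _ T R setT 'I_n _ (fun i => a i t)) => i; exact: measurable_ind.
Qed.

Let ind_Yobs i t x : a i t x * Yobs Y A i x = a i t x * Y i t x.
Proof. by rewrite /ind /Yobs; case: eqP => [->//|_]; rewrite !mul0r. Qed.

Let measurable_ind_Yobs i t : measurable_fun setT (fun x => a i t x * Yobs Y A i x).
Proof.
under eq_fun do rewrite ind_Yobs.
by apply: measurable_funM => //; exact: measurable_ind.
Qed.

Let mmx_Xv i : mmx (Xv X i).
Proof. by move=> j l; under eq_fun do rewrite mxE; exact: mX. Qed.

Let mmx_Xbar_t n t : mmx (Xbar_t X A n t : T -> 'cV[R]_p).
Proof.
apply: mmxZ; first exact: measurable_funV.
by apply: mmx_sum => i; apply: mmxZ => //; exact: measurable_ind.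
Qed.

Let mmx_Xbar n : mmx (Xbar X n : T -> 'cV[R]_p).
Proof. by apply: mmxZ => //; exact: mmx_sum. Qed.

Let sb (u v : 'cV[R]_p) := (u^T *m Sig *m v) 0 0.

Let sbC u v : sb u v = sb v u.
Proof.
have Sigs : Sig^T = Sig by case: pdX.
rewrite /sb; have -> : u^T *m Sig *m v = (v^T *m Sig *m u)^T.
  by rewrite !trmx_mul trmxK Sigs mulmxA.
by rewrite mxE.
Qed.

Section LinearRepresentation.
Variable b : 'I_k -> 'cV[R]_p.

Let q t i x := \sum_j b t j 0 * Xc j i x.
Let r t i x := Yc t i x - q t i x.
(* Influence function: up to [o_P(1)], [root_n_err] at arm [t] is the normalized sum of [xi t i],
   and the covariance matrix of [xi] is [V_SR]. *)
Let xi t i x := (pi t)^-1 * (a i t x * r t i x) + q t i x.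

Let dfun_q t : dfun (q t).
Proof. by apply: dfun_sum => j; apply: dfunM; [exact: dfun_cst|exact: dfun_Xc]. Qed.

Let dfun_r t : dfun (r t). Proof. exact: dfunB. Qed.

Let L2_q t : L2 P (q t 0%N).
Proof. by apply: L2_sum => j; apply: L2Z. Qed.

Let L2_r t : L2 P (r t 0%N). Proof. exact: L2B. Qed.

Let Ex_q t : Ex P (q t 0%N) = 0.
Proof.
rewrite /q Ex_sum; last by move=> j _; apply: IntZ; exact: L2_Int (L2_Xc j).
apply: big1 => j _; rewrite ExZ ?Ex_Xc ?mulr0//; exact: L2_Int (L2_Xc j).
Qed.

Let Ex_r t : Ex P (r t 0%N) = 0.
Proof.
rewrite /r ExB; [|exact: L2_Int (L2_Yc t)|exact: L2_Int (L2_q t)].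
by rewrite Ex_Yc Ex_q subrr.
Qed.

Let Ex_qq t s : Ex P (fun x => q t 0%N x * q s 0%N x) = sb (b t) (b s).
Proof.
rewrite /sb quad_formE.
rewrite (@eq_Ex _ _ _ _ _ (fun x => \sum_i \sum_j (b t i 0 * b s j 0) * (Xc i 0%N x * Xc j 0%N x))).
  rewrite Ex_sum; last by move=> i _; apply: Int_sum => j _; apply: IntZ; exact: L2M_Int.
  apply: eq_bigr => i _; rewrite Ex_sum; last by move=> j _; apply: IntZ; exact: L2M_Int.
  apply: eq_bigr => j _; rewrite ExZ ?Ex_XcXc; last exact: L2M_Int.
  by ring.
move=> x; rewrite /q big_distrl; apply: eq_bigr => i _; rewrite big_distrr/=.
by apply: eq_bigr => j _; ring.
Qed.

Let Ex_Yq t s : Ex P (fun x => Yc t 0%N x * q s 0%N x) = sb (beta_t P Y X t) (b s).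
Proof.
have Sigs : Sig^T = Sig by case: pdX.
have -> : sb (beta_t P Y X t) (b s) = ((covXY P Y X t)^T *m b s) 0 0.
  by rewrite /sb [in RHS]covE [in RHS]trmx_mul Sigs.
rewrite mxE.
rewrite (@eq_Ex _ _ _ _ _ (fun x => \sum_j b s j 0 * (Xc j 0%N x * Yc t 0%N x))).
  rewrite Ex_sum; last by move=> j _; apply: IntZ; exact: L2M_Int.
  apply: eq_bigr => j _; rewrite ExZ ?Ex_XcYc; last exact: L2M_Int.
  by rewrite [in RHS]mxE mulrC.
by move=> x; rewrite /q big_distrr/=; apply: eq_bigr => j _; ring.
Qed.

Let Ex_rq t s : Ex P (fun x => r t 0%N x * q s 0%N x) = sb (beta_t P Y X t) (b s) - sb (b t) (b s).
Proof.
rewrite -Ex_Yq -Ex_qq -ExB; [|exact: L2M_Int|exact: L2M_Int].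
by apply: eq_Ex => x; rewrite /r; ring.
Qed.

Let var_residE t : var_resid P Y X t (b t) = Ex P (fun x => r t 0%N x ^+ 2).
Proof.
rewrite /var_resid.
have ZE x : Y 0%N t x - ((b t)^T *m Xv X 0 x) 0 0 = r t 0%N x + (th t - \sum_j b t j 0 * mu j).
  rewrite mxE (eq_bigr (fun j => b t j 0 * Xc j 0%N x + b t j 0 * mu j)); last first.
    by move=> j _; rewrite [(b t)^T _ _]mxE [Xv _ _ _ _ _]mxE /Xc; ring.
  by rewrite big_split/= /r /Yc /q; ring.
have EZ : Ex P (fun x => Y 0%N t x - ((b t)^T *m Xv X 0 x) 0 0) = th t - \sum_j b t j 0 * mu j.
  rewrite (eq_Ex P ZE) ExD; [|exact: L2_Int (L2_r t)|exact: Int_cst].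
  by rewrite Ex_r Ex_cst add0r.
by rewrite EZ; apply: eq_Ex => x; rewrite ZE addrK.
Qed.

Let V := V_SR P pi Y X (mx_of_cols b).

Let V_entry t s : V t s = (t == s)%:R * ((pi t)^-1 * Ex P (fun x => r t 0%N x ^+ 2)) +
  (sb (beta_t P Y X t) (b s) + sb (b t) (beta_t P Y X s) - sb (b t) (b s)).
Proof.
have ent (N M : 'M[R]_(p, k)) : (N^T *m Sig *m M) t s = sb (col t N) (col s M).
  rewrite /sb mxE [RHS]mxE; apply: eq_bigr => l _; rewrite [col s M l 0]mxE; congr (_ * _).
  by rewrite mxE [RHS]mxE; apply: eq_bigr => j _; rewrite !mxE.
have cb i : col i (mx_of_cols b) = b i by apply/matrixP => u v; rewrite !mxE (ord1 v).
have cB i : col i (Bscr P Y X) = beta_t P Y X i.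
  by apply/matrixP => u v; rewrite mxE [LHS]mxE (ord1 v).
rewrite /V /V_SR.
have mxD (M N : 'M[R]_k) : (M + N) t s = M t s + N t s by rewrite mxE.
have mxN (M : 'M[R]_k) : (- M) t s = - M t s by rewrite mxE.
rewrite !mxD mxN !ent !cb !cB mxE [in X in X *+ _]mxE cb var_residE.
by case: (t == s); rewrite ?mulr1n ?mulr0n; ring.
Qed.

Lemma V_SR_entry t s : V t s = (t == s)%:R * ((pi t)^-1 *
    (Ex P (fun x => Yc t 0%N x ^+ 2) - 2 * sb (beta_t P Y X t) (b t) + sb (b t) (b t))) +
  (sb (beta_t P Y X t) (b s) + sb (b t) (beta_t P Y X s) - sb (b t) (b s)).
Proof.
rewrite V_entry; congr (_ * (_ * _) + _).
rewrite -Ex_qq -Ex_Yq -ExZ; last exact: L2M_Int.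
rewrite -ExB; [|exact: (L2_Yc t).2|by apply: IntZ; exact: L2M_Int].
rewrite -ExD; [|by apply: IntB; [exact: (L2_Yc t).2|by apply: IntZ; exact: L2M_Int]|exact: L2M_Int].
by apply: eq_Ex => x; rewrite /r; ring.
Qed.

Let pfun_xi t : pfun (xi t).
Proof.
apply: pfunD; last exact: dfun_pfun.
apply: pfunM; first exact/dfun_pfun/dfun_cst.
by apply: pfunM; [exact: pfun_ind|exact: dfun_pfun].
Qed.

Let L2_xi t : L2 P (xi t 0%N).
Proof.
apply: L2D; last exact: L2_q.
by apply/L2Z/L2_bounded_mul; [exact: measurable_ind|exact: norm_ind_le1|exact: L2_r].
Qed.

Let Ex_xi t : Ex P (xi t 0%N) = 0.
Proof.
have [i1 e1] := Ex_ind_mul t (dfun_r t) (L2_Int (L2_r t)).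
rewrite /xi ExD; [|exact: IntZ|exact: L2_Int (L2_q t)].
by rewrite ExZ// e1 Ex_r Ex_q !mulr0 addr0.
Qed.

Let Ex_xixi t s : Ex P (fun x => xi t 0%N x * xi s 0%N x) = V t s.
Proof.
have drr u : dfun (fun i x => r u i x ^+ 2).
  by have := dfunM (dfun_r u) (dfun_r u); congr dfun.
have drq u v : dfun (fun i x => r u i x * q v i x) by exact: dfunM.
have [i1 e1] := Ex_ind_mul t (drr t) (L2_r t).2.
have [i2 e2] := Ex_ind_mul t (drq t s) (L2M_Int (L2_r t) (L2_q s)).
have [i3 e3] := Ex_ind_mul s (drq s t) (L2M_Int (L2_r s) (L2_q t)).
have i4 := L2M_Int (L2_q t) (L2_q s).
rewrite (@eq_Ex _ _ _ _ _ (fun x => (t == s)%:R * (pi t)^-1 ^+ 2 * (a 0 t x * r t 0%N x ^+ 2) +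
   (pi t)^-1 * (a 0 t x * (r t 0%N x * q s 0%N x)) +
   (pi s)^-1 * (a 0 s x * (r s 0%N x * q t 0%N x)) + q t 0%N x * q s 0%N x)).
  rewrite ExD//; last by apply: IntD; [apply: IntD|]; exact: IntZ.
  rewrite ExD; [|by apply: IntD; exact: IntZ|exact: IntZ].
  rewrite ExD; [|exact: IntZ|exact: IntZ].
  rewrite !ExZ// e1 e2 e3 !Ex_rq Ex_qq V_entry (sbC (b s) (b t)) (sbC (beta_t P Y X s) (b t)).
  by field; rewrite !pi_neq0.
move=> x; rewrite /xi.
have [->|ts] := eqVneq t s.
  have h : a 0 s x * a 0 s x = a 0 s x by rewrite ind_mul eqxx mul1r.
  rewrite mul1r -{1}h; ring: h.
have h : a 0 t x * a 0 s x = 0 by rewrite ind_mul (negbTE ts) mul0r.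
by rewrite !mul0r add0r; ring: h.
Qed.

Let lin_xi (u : 'cV[R]_k) i x := \sum_t u t 0 * xi t i x.

Let Ex_lin_sq (u : 'cV[R]_k) : Ex P (fun x => lin_xi u 0%N x ^+ 2) = (u^T *m V *m u) 0 0.
Proof.
rewrite quad_formE.
rewrite (@eq_Ex _ _ _ _ _ (fun x => \sum_i \sum_j (u i 0 * u j 0) * (xi i 0%N x * xi j 0%N x))).
  rewrite Ex_sum; last by move=> i _; apply: Int_sum => j _; apply: IntZ; exact: L2M_Int.
  apply: eq_bigr => i _; rewrite Ex_sum; last by move=> j _; apply: IntZ; exact: L2M_Int.
  apply: eq_bigr => j _; rewrite ExZ ?Ex_xixi; last exact: L2M_Int.
  by ring.
move=> x; rewrite /lin_xi expr2 big_distrl; apply: eq_bigr => i _; rewrite big_distrr/=.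
by apply: eq_bigr => j _; ring.
Qed.

Lemma V_SR_psd : psd V.
Proof.
split; last by move=> u; rewrite -Ex_lin_sq; apply: Ex_ge0 => x; exact: sqr_ge0.
by apply/matrixP => t s; rewrite mxE -!Ex_xixi; apply: eq_Ex => x; rewrite mulrC.
Qed.

Let S t n x := (\sum_(i < n) xi t i x) / Num.sqrt n%:R.

Let S_bddP t : bddP P (S t).
Proof. exact: pfun_bddP. Qed.

Let S_cos (u : 'cV[R]_k) (y : R) : Ex P (fun x => cos (\sum_t u t 0 * S t n x + y)) @[n --> \oo] -->
  expR (- ((u^T *m V *m u) 0 0 / 2)) * cos y.
Proof.
have pl : pfun (lin_xi u).
  by apply: pfun_sum => t; apply: pfunM; [exact/dfun_pfun/dfun_cst|exact: pfun_xi].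
have Ll : L2 P (lin_xi u 0%N) by apply: L2_sum => t; exact: L2Z.
have El : Ex P (lin_xi u 0%N) = 0.
  rewrite /lin_xi Ex_sum; last by move=> t _; apply: IntZ; exact: L2_Int (L2_xi t).
  apply: big1 => t _; rewrite ExZ ?Ex_xi ?mulr0//; exact: L2_Int (L2_xi t).
have := @clt_cos R d T P (lin_xi u) (fun i => pfun_measurable i pl) (fun i => pfun_same i pl)
  (fun m => pfun_indep_sum m pl) Ll.2 El y.
rewrite Ex_lin_sq; apply: cvg_trans; apply: near_eq_cvg; apply: nearW => n.
apply: eq_Ex => x; congr (cos (_ + _)).
rewrite /S /lin_xi [in LHS]exchange_big big_distrl/=; apply: eq_bigr => t _.
by rewrite -mulr_sumr mulrA.
Qed.

Variable bh : nat -> T -> 'I_k -> 'cV[R]_p.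
Hypothesis mbh : forall n t j, measurable_fun setT (fun x => bh n x t j 0).
Hypothesis cbh : forall t, cvmx P (fun n x => bh n x t) (b t).

Let err := root_n_err P Y X A bh.

Let D t n x := (\sum_(i < n) a i t x * Yc t i x) / Num.sqrt n%:R.
Let E t j n x := (\sum_(i < n) a i t x * Xc j i x) / Num.sqrt n%:R.
Let F j n x := (\sum_(i < n) Xc j i x) / Num.sqrt n%:R.

Let ind_bddP t h : dfun h -> L2 P (h 0%N) -> Ex P (h 0%N) = 0 ->
  bddP P (fun n x => (\sum_(i < n) a i t x * h i x) / Num.sqrt n%:R).
Proof.
move=> dh Lh h0; apply: (@pfun_bddP (fun i x => a i t x * h i x)).
- by apply: pfunM; [exact: pfun_ind|exact: dfun_pfun].
- by apply: L2_bounded_mul => //; [exact: measurable_ind|exact: norm_ind_le1].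
- by have [_ ->] := Ex_ind_mul t dh (L2_Int Lh); rewrite h0 mulr0.
Qed.

Let errE t n x : (0 < n)%N -> nt t n x != 0 ->
  err n x t 0 = (nt t n x)^-1 * D t n x
    - \sum_j bh n x t j 0 * ((nt t n x)^-1 * E t j n x - F j n x).
Proof.
move=> n0; rewrite /nt mulf_eq0 negb_or => /andP[_ nt0].
rewrite /err /root_n_err mxE [in X in _ * X]mxE [in X in _ + X]mxE [theta_hat _ _ _ _ _ _ _ _]mxE.
rewrite [((_)^T *m _) 0 0]mxE /D /E /F /Ybar.
set s := Num.sqrt n%:R; set m := n_t A n t x.
have s0 : s != 0 by rewrite gt_eqF// sqrtr_gt0 ltr0n.
have nE : (n%:R : R) = s ^+ 2 by rewrite sqr_sqrtr.
have -> : \sum_(i < n) a i t x * Yobs Y A i x = \sum_(i < n) a i t x * Yc t i x + th t * m.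
  rewrite /m /n_t mulr_sumr -big_split/=; apply: eq_bigr => i _.
  by rewrite /Yobs /Yc /ind; case: eqP => [->|_]; rewrite ?mulr1n ?mulr0n; ring.
rewrite (eq_bigr (fun j => bh n x t j 0 * (m^-1 * (\sum_(i < n) a i t x * Xc j i x + mu j * m)
   - (s ^+ 2)^-1 * (\sum_(i < n) Xc j i x + mu j * s ^+ 2)))); last first.
  move=> j _; rewrite mxE; congr (_ * _).
  rewrite 2!mxE [in X in _ + X]mxE [in X in _ + X]mxE -/m nE; congr (_ * _ - _ * _).
    rewrite summxE /m /n_t mulr_sumr -big_split/=; apply: eq_bigr => i _.
    by rewrite [LHS]mxE [Xv _ _ _ _ _]mxE /Xc; ring.
  rewrite summxE -nE mulr_natr -[X in _ *+ X](card_ord n) -sumr_const -big_split/=; apply: eq_bigr => i _.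
  by rewrite mxE /Xc; ring.
have m0 : m != 0 by []; clearbody m s.
rewrite nE mulrBr mulrBr mulr_sumr; rewrite -addrA [- _ - _]addrC addrA; congr (_ - _).
  by field; rewrite s0 m0.
apply: eq_bigr => j _; rewrite mulrCA; congr (_ * _).
by field; rewrite s0 m0.
Qed.

Let SE t n x : S t n x = (pi t)^-1 * D t n x
  - \sum_j b t j 0 * ((pi t)^-1 * E t j n x - F j n x).
Proof.
rewrite /S /D /E /F.
rewrite (eq_bigr (fun i : 'I_n => (pi t)^-1 * (a i t x * Yc t i x)
   - \sum_j b t j 0 * ((pi t)^-1 * (a i t x * Xc j i x) - Xc j i x))); last first.
  move=> i _; rewrite /xi /r /q.
  rewrite [in RHS](eq_bigr (fun j => (pi t)^-1 * a i t x * (b t j 0 * Xc j i x) - b t j 0 * Xc j i x)); last first.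
    by move=> j _; ring.
  by rewrite sumrB -mulr_sumr; ring.
rewrite sumrB exchange_big/= mulrBl -mulr_sumr -mulrA; congr (_ - _).
rewrite mulr_suml; apply: eq_bigr => j _.
by rewrite -mulr_sumr sumrB -mulr_sumr; ring.
Qed.

Let err_lito t : litoP P (fun n x => err n x t 0 - S t n x).
Proof.
have inv := cvP_inv (nt_cv t) (pi_neq0 t).
have hD : bddP P (D t) by apply: ind_bddP.
have hE j : bddP P (E t j) by apply: ind_bddP.
have hF j : bddP P (F j) by apply: (@pfun_bddP (Xc j)) => //; exact: dfun_pfun.
have h1 := bddP_litoPM hD inv.
have h2 j : litoP P (fun n x => E t j n x * (bh n x t j 0 * (nt t n x)^-1 - b t j 0 * (pi t)^-1)).
  exact: (bddP_litoPM (hE j) (cvPM (cbh t j 0) inv)).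
have h3 j : litoP P (fun n x => F j n x * (bh n x t j 0 - b t j 0)).
  exact: (bddP_litoPM (hF j) (cbh t j 0)).
have h4 : litoP P (fun n x => \sum_j (F j n x * (bh n x t j 0 - b t j 0) -
     E t j n x * (bh n x t j 0 * (nt t n x)^-1 - b t j 0 * (pi t)^-1))).
  have cv0 u : litoP P u -> cvP P u 0 by apply: eq_litoP => n x; rewrite subr0.
  have := cvP_sum (index_enum 'I_p) (fun j => cvPB (cv0 _ (h3 j)) (cv0 _ (h2 j))).
  by apply: eq_litoP => n x; rewrite [X in _ - X]big1 ?subr0// => j _; rewrite subr0.
apply: (litoP_whp_eq (litoPD h1 h4)).
apply: (whp_mono (cvP_neq0 (nt_cv t) (pi_neq0 t))); exists 1%N => n n0 x nz.
rewrite errE// SE.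
rewrite (_ : forall u v w z : R, (u - v) - (w - z) = (u - w) + (z - v)); last by move=> *; ring.
congr (_ + _); first by ring.
by rewrite -sumrB; apply: eq_bigr => j _; ring.
Qed.

Let measurable_err n t : measurable_fun setT (fun x => err n x t 0).
Proof.
under eq_fun do rewrite /err /root_n_err mxE.
apply: measurable_funM => //.
under eq_fun do rewrite 2!mxE.
apply: measurable_funD => //.
apply: measurable_funB.
  apply: measurable_funM; first exact: measurable_funV.
  by apply: measurable_sum => i; exact: measurable_ind_Yobs.
apply: (@mmx_mul _ _ _ _ _ _ (fun x => (bh n x t)^T) (fun x => Xbar_t X A n t x - Xbar X n x)).
  by move=> i j; under eq_fun do rewrite mxE; rewrite (ord1 i); exact: mbh.
by apply: mmxB; [exact: mmx_Xbar_t|exact: mmx_Xbar].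
Qed.

Lemma trial_clt : cvg_dist_normal P err V.
Proof.
apply: cvg_dist_of_cos.
- exact: V_SR_psd.
- exact: measurable_err.
- move=> u y.
  pose Un n x := (u^T *m err n x) 0 0; pose Vn n x := \sum_t u t 0 * S t n x.
  apply: (@Ex_cos_slutsky _ _ _ P Un Vn _ y); last exact: S_cos.
  + by move=> n; apply: measurable_lincomb => t; exact: measurable_err.
  + move=> n; apply: measurable_sum => t; apply: measurable_funM => //.
    apply: measurable_funM => //; apply: measurable_sum => i.
    exact: pfun_measurable.
  + have cv0 w : litoP P w -> cvP P w 0 by apply: eq_litoP => n x; rewrite subr0.
    have := cvP_sum (index_enum 'I_k) (fun t => cvPZ (u t 0) (cv0 _ (err_lito t))).
    apply: eq_litoP => n x; rewrite [X in _ - X]big1 ?subr0; last by move=> t _; rewrite mulr0.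
    rewrite /Un /Vn mxE -sumrB; apply: eq_bigr => t _.
    by rewrite [u^T _ _]mxE mulrBr.
- have oe t : bddP P (fun n x => err n x t 0).
    apply: (eq_bddP _ (bddPD (litoP_bddP (err_lito t)) (S_bddP t))) => n x.
    by rewrite subrK.
  have oe' : bddP P (fun n x => \sum_t `|err n x t 0|).
    elim: (index_enum 'I_k) => [|t s ih].
      by apply: (eq_bddP _ (bddP_cst P 0)) => n x; rewrite big_nil.
    have on : bddP P (fun n x => `|err n x t 0|).
      move=> e /(oe t)[L [N h]]; exists L, N => n /h[G [mG pG hG]].
      by exists G; split => // x /hG; rewrite normr_id.
    by apply: (eq_bddP _ (bddPD on ih)) => n x; rewrite big_cons.
  move=> e /oe'[L [N h]]; exists L, N => n /h[G [mG pG hG]]; exists G; split => // x /hG hx t.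
  apply: le_trans (le_trans (ler_norm _) hx).
  by rewrite (bigD1 t)//= lerDl sumr_ge0.
Qed.

End LinearRepresentation.

Let sbDr u v w : sb u (v + w) = sb u v + sb u w.
Proof. by rewrite /sb mulmxDr mxE. Qed.

Let sbZr u c v : sb u (c *: v) = c * sb u v.
Proof. by rewrite /sb -scalemxAr mxE. Qed.

Let sbBr u v w : sb u (v - w) = sb u v - sb u w.
Proof. by rewrite -scaleN1r sbDr sbZr mulN1r. Qed.

Let sb_sumr (J : Type) (s : seq J) (v : J -> 'cV[R]_p) u :
  sb u (\sum_(j <- s) v j) = \sum_(j <- s) sb u (v j).
Proof. by rewrite /sb mulmx_sumr summxE. Qed.

Let sb_ge0 u : 0 <= sb u u.
Proof.
have [->|u0] := eqVneq u 0; first by rewrite /sb mulmx0 mxE.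
by case: pdX => _ h; exact: ltW (h u u0).
Qed.

(* The quadratic form at [u] is the [pi]-weighted variance, in the metric [SigmaX], of the
   vectors [(u t / pi t) *: (beta_t t - b t)]. *)
Lemma V_SR_optimal (B : 'M[R]_(p, k)) :
  psd (V_SR P pi Y X B - V_SR P pi Y X (Bscr P Y X)).
Proof.
have -> : B = mx_of_cols (fun t => col t B) by apply/matrixP => j t; rewrite !mxE.
have -> : Bscr P Y X = mx_of_cols (beta_t P Y X) by [].
pose b t := col t B; rewrite -/b; pose e t := beta_t P Y X t - b t.
set M := (V_SR _ _ _ _ _ - _).
have ME t s : M t s = (t == s)%:R * ((pi t)^-1 * sb (e t) (e t)) - sb (e t) (e s).
  rewrite /M mxE [X in _ + X]mxE !V_SR_entry /e !sbBr !(sbC (_ - _)) !sbBr.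
  by rewrite (sbC (b t) (beta_t _ _ _ t)) (sbC (b s) (beta_t _ _ _ t))
    (sbC (beta_t _ _ _ s) (b t)) (sbC (beta_t _ _ _ s) (beta_t _ _ _ t)) (sbC (b s) (b t)); ring.
split.
  apply/matrixP => t s; rewrite mxE !ME (sbC (e s)) eq_sym.
  by case: (eqVneq t s) => [->//|_]; rewrite !mul0r.
move=> u; rewrite quad_formE.
pose w := \sum_t u t 0 *: e t; pose v t := (u t 0 / pi t) *: e t.
have -> : \sum_i \sum_j u i 0 * M i j * u j 0 = \sum_t pi t * sb (v t - w) (v t - w).
  have -> : \sum_t pi t * sb (v t - w) (v t - w) = \sum_t pi t * sb (v t) (v t) - sb w w.
    rewrite (eq_bigr (fun t => pi t * sb (v t) (v t) + (- (2 * sb w (u t 0 *: e t)) + pi t * sb w w))).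
      rewrite big_split big_split/= -mulr_suml pi1 sumrN -mulr_sumr -sb_sumr -/w.
      by ring.
    move=> t _; rewrite sbBr !(sbC (_ - _)) !sbBr (sbC (v t) w).
    have -> : u t 0 *: e t = pi t *: v t by rewrite /v scalerA mulrCA divff// mulr1.
    by rewrite sbZr; ring.
  rewrite {2}/w sb_sumr -sumrB; apply: eq_bigr => t _.
  rewrite (eq_bigr (fun s => u t 0 * u s 0 * ((t == s)%:R * ((pi t)^-1 * sb (e t) (e t)))
      - u t 0 * (u s 0 * sb (e t) (e s)))); last by move=> s _; rewrite ME; ring.
  rewrite sumrB -mulr_sumr; congr (_ - _).
    rewrite (bigD1 t)//= eqxx big1 ?addr0; last first.
      by move=> s st; rewrite eq_sym (negbTE st) mul0r mulr0.
    by rewrite mul1r /v sbZr [sb (_ *: _) _]sbC sbZr; field; rewrite pi_neq0.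
  rewrite sbZr (sbC w) /w sb_sumr; congr (_ * _).
  by apply: eq_bigr => s _; rewrite sbZr.
by apply: sumr_ge0 => t _; rewrite mulr_ge0// ltW//; case/andP: (pi01 t).
Qed.

Let Ex_XX j l : Sig j l = Ex P (fun x => X 0%N j x * X 0%N l x) - mu j * mu l.
Proof.
have LX i := L2_X i; have IX i := L2_Int (LX i).
rewrite -Ex_XcXc (@eq_Ex _ _ _ _ _ (fun x => X 0%N j x * X 0%N l x - mu j * Xc l 0%N x - mu l * X 0%N j x)).
  rewrite ExB; [|apply: IntB; [exact: L2M_Int|exact/IntZ/L2_Int]|exact: IntZ].
  rewrite ExB; [|exact: L2M_Int|exact/IntZ/L2_Int].
  rewrite ExZ; last exact/L2_Int.
  by rewrite ExZ// Ex_Xc mulr0 subr0 [mu j]mxE mulrC.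
by move=> x; rewrite /Xc; ring.
Qed.

Let Ex_XY j t : covXY P Y X t j 0 = Ex P (fun x => X 0%N j x * Y 0%N t x) - mu j * th t.
Proof.
have LX := L2_X j; have LY := L2_Y t.
rewrite -Ex_XcYc (@eq_Ex _ _ _ _ _ (fun x => X 0%N j x * Y 0%N t x - mu j * Yc t 0%N x - th t * X 0%N j x)).
  rewrite ExB; [|apply: IntB; [exact: L2M_Int|exact/IntZ/L2_Int]|exact/IntZ/L2_Int].
  rewrite ExB; [|exact: L2M_Int|exact/IntZ/L2_Int].
  rewrite ExZ; last exact/L2_Int.
  by rewrite ExZ ?Ex_Yc; [rewrite mulr0 subr0 [mu j]mxE mulrC|exact: L2_Int].
by move=> x; rewrite /Xc /Yc; ring.
Qed.

Lemma ind_wlln t h : dfun h -> Int P (h 0%N) ->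
  cvP P (fun n x => n%:R^-1 * \sum_(i < n) a i t x * h i x) (pi t * Ex P (h 0%N)).
Proof.
move=> dh ih; have [ia <-] := Ex_ind_mul t dh ih.
apply: (@pfun_wlln (fun i x => a i t x * h i x)) => //.
by apply: pfunM; [exact: pfun_ind|exact: dfun_pfun].
Qed.

Section WeightedScatter.
Variables (w : nat -> T -> R) (c : R).
Hypothesis c0 : c != 0.
Hypothesis cw : cvP P (fun n x => n%:R^-1 * \sum_(i < n) w i x) c.
Hypothesis cwX : forall j, cvP P (fun n x => n%:R^-1 * \sum_(i < n) w i x * X i j x) (c * mu j).
Hypothesis cwXX : forall j l, cvP P (fun n x => n%:R^-1 * \sum_(i < n) w i x * (X i j x * X i l x))
  (c * Ex P (fun x => X 0%N j x * X 0%N l x)).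

Definition wmean n x : 'cV[R]_p := (\sum_(i < n) w i x)^-1 *: \sum_(i < n) w i x *: Xv X i x.

Lemma wmeanE n x j : wmean n x j 0 = (\sum_(i < n) w i x)^-1 * \sum_(i < n) w i x * X i j x.
Proof.
rewrite mxE summxE; congr (_ * _); apply: eq_bigr => i _.
by rewrite mxE [Xv _ _ _ _ _]mxE.
Qed.

Lemma wmean_cv j : cvP P (fun n x => wmean n x j 0) (mu j).
Proof.
have := cvPM (cvP_inv cw c0) (cwX j); rewrite mulKf//.
apply: eq_cvP => n x; rewrite wmeanE; case: n => [|n]; first by rewrite !big_ord0 !mulr0.
by rewrite invfM invrK mulrACA mulfV ?mul1r// pnatr_eq0.
Qed.

Lemma wscatter_cv :
  cvmx P (fun n x => n%:R^-1 *: \sum_(i < n) w i x *: ((Xv X i x - wmean n x) *m (Xv X i x - wmean n x)^T))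
    (c *: Sig).
Proof.
move=> j l.
have := cvPD (cvPB (cvPB (cwXX j l) (cvPM (wmean_cv j) (cwX l))) (cvPM (wmean_cv l) (cwX j)))
  (cvPM cw (cvPM (wmean_cv j) (wmean_cv l))).
rewrite (_ : _ + _ = (c *: Sig) j l); last by rewrite [RHS]mxE Ex_XX; ring.
apply: eq_cvP => n x; rewrite [RHS]mxE summxE.
rewrite [in RHS](eq_bigr (fun i : 'I_n => w i x * (X i j x * X i l x) - wmean n x j 0 * (w i x * X i l x)
   - wmean n x l 0 * (w i x * X i j x) + w i x * (wmean n x j 0 * wmean n x l 0))); last first.
  move=> i _; rewrite mxE mxE big_ord1 [_^T _ _]mxE.
  have mB (u v : 'cV[R]_p) m : (u - v) m 0 = u m 0 - v m 0 by rewrite !mxE.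
  by rewrite !mB ![Xv _ _ _ _ _]mxE; ring.
by rewrite big_split/= sumrB sumrB -!mulr_sumr -mulr_suml; ring.
Qed.

End WeightedScatter.

Let Sxx_cv t : cvmx P (fun n x => n%:R^-1 *: Sxx_t X A n t x) (pi t *: Sig).
Proof.
apply: (@wscatter_cv (fun i => a i t)) => //.
- exact: (nt_cv t).
- by move=> j; rewrite [mu j]mxE; apply: (@ind_wlln t (fun i => X i j)); [exact: dfun_X|exact: L2_Int (L2_X j)].
- move=> j l; apply: (@ind_wlln t (fun i x => X i j x * X i l x)).
    by apply: dfunM; exact: dfun_X.
  by apply: L2M_Int; exact: L2_X.
Qed.

Let total_cv : cvmx P (fun n x => n%:R^-1 *:
  \sum_(i < n) (Xv X i x - Xbar X n x) *m (Xv X i x - Xbar X n x)^T) Sig.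
Proof.
have wl h : dfun h -> Int P (h 0%N) ->
    cvP P (fun n x => n%:R^-1 * \sum_(i < n) 1 * h i x) (1 * Ex P (h 0%N)).
  move=> dh ih; rewrite mul1r; apply: (eq_cvP _ (pfun_wlln (dfun_pfun dh) ih)) => n x.
  by under [in RHS]eq_bigr do rewrite mul1r.
rewrite -[Sig]scale1r => j l.
have cw : cvP P (fun n x => n%:R^-1 * \sum_(i < n) (1 : R)) 1.
  by rewrite -[X in cvP _ _ X](Ex_cst P 1); apply: (@pfun_wlln (fun _ _ => 1)); [exact/dfun_pfun/dfun_cst|exact: Int_cst].
have := @wscatter_cv (fun _ _ => 1) 1 (oner_neq0 _) cw _ _ j l.
move=> h; apply: (eq_cvP _ (h _ _)).
- move=> n x; have e : wmean (fun _ _ => 1) n x = Xbar X n x.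
    rewrite /wmean /Xbar sumr_const card_ord; congr (_ *: _).
    by apply: eq_bigr => i _; rewrite scale1r.
  by rewrite e; under eq_bigr do rewrite scale1r.
- by move=> m; rewrite [mu m]mxE; apply: (@wl (fun i => X i m)); [exact: dfun_X|exact: L2_Int (L2_X m)].
- move=> m m'; apply: (@wl (fun i x => X i m x * X i m' x)).
    by apply: dfunM; exact: dfun_X.
  by apply: L2M_Int; exact: L2_X.
Qed.

Let Sxy_cv t : cvmx P (fun n x => n%:R^-1 *: Sxy_t Y X A n t x) (pi t *: covXY P Y X t).
Proof.
move=> j l; rewrite (ord1 l).
have mc : cvP P (fun n x => Xbar_t X A n t x j 0) (mu j).
  apply: (@wmean_cv (fun i => a i t) (pi t)) => //; first exact: (nt_cv t).
  by move=> m; rewrite [mu m]mxE; apply: (@ind_wlln t (fun i => X i m)); [exact: dfun_X|exact: L2_Int (L2_X m)].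
have cXY := @ind_wlln t (fun i x => X i j x * Y i t x) (dfunM (dfun_X j) (dfun_Y t))
  (L2M_Int (L2_X j) (L2_Y t)).
have cY := @ind_wlln t _ (dfun_Y t) (L2_Int (L2_Y t)).
have := cvPB cXY (cvPM mc cY).
rewrite (_ : _ - _ = (pi t *: covXY P Y X t) j 0); last first.
  by rewrite [RHS]mxE Ex_XY [th t]mxE; ring.
apply: eq_cvP => n x; rewrite [RHS]mxE summxE.
rewrite [in RHS](eq_bigr (fun i : 'I_n => a i t x * (X i j x * Y i t x)
   - Xbar_t X A n t x j 0 * (a i t x * Y i t x))); last first.
  move=> i _; rewrite scalerA ind_Yobs mxE.
  have mB (u v : 'cV[R]_p) m : (u - v) m 0 = u m 0 - v m 0 by rewrite !mxE.
  by rewrite mB [Xv _ _ _ _ _]mxE; ring.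
by rewrite sumrB -mulr_sumr; ring.
Qed.

Let mmx_Sxx n t : mmx (Sxx_t X A n t : T -> 'M[R]_p).
Proof.
apply: mmx_sum => i; apply: mmxZ; first exact: measurable_ind.
by apply: mmx_mul; [exact: mmxB|apply: mmxT; exact: mmxB].
Qed.

Let mmx_Sxy n t : mmx (Sxy_t Y X A n t : T -> 'cV[R]_p).
Proof.
rewrite (_ : Sxy_t Y X A n t = fun x => \sum_(i < n) (a i t x * Yobs Y A i x) *: (Xv X i x - Xbar_t X A n t x)).
  by apply: mmx_sum => i; apply: mmxZ; [exact: measurable_ind_Yobs|exact: mmxB].
by apply/funext => x; apply: eq_bigr => i _; rewrite scalerA.
Qed.

Lemma mmx_beta_hat n : mmx (beta_hat Y X A n : T -> 'cV[R]_p).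
Proof. by apply: mmx_mul; [apply: mmx_inv|]; apply: mmx_sum. Qed.

Lemma mmx_beta_hat_t n t : mmx (beta_hat_t Y X A n t : T -> 'cV[R]_p).
Proof. by apply: mmx_mul => //; exact: mmx_inv. Qed.

Lemma mmx_beta_hat_t_alt n t : mmx (beta_hat_t_alt Y X A n t : T -> 'cV[R]_p).
Proof.
apply: mmxZ; first by apply: measurable_funM => //; exact: measurable_funV.
apply: mmx_mul => //; apply: mmx_inv; apply: mmx_sum => i.
by apply: mmx_mul; [exact: mmxB|apply: mmxT; exact: mmxB].
Qed.

Let solve_cv (M : nat -> T -> 'M[R]_p) (m : nat -> T -> 'cV[R]_p) L l : L \in unitmx ->
  cvmx P (fun n x => n%:R^-1 *: M n x) L -> cvmx P (fun n x => n%:R^-1 *: m n x) l ->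
  cvmx P (fun n x => invmx (M n x) *m m n x) (invmx L *m l).
Proof.
move=> uL cM cm; have [ci un] := cvmx_inv cM uL.
apply: (cvmx_whp_eq (cvmx_mul ci cm)).
apply: (whp_mono un); exists 1%N => n n0 x ux; rewrite invmxZ// invrK -scalemxAl -scalemxAr.
by rewrite scalerA mulfV ?scale1r// pnatr_eq0 -lt0n.
Qed.

Let Z_unit c : c != 0 -> c *: Sig \in unitmx.
Proof. by move=> c0; rewrite unitmxZ// unitfE. Qed.

Lemma beta_hat_t_cv t : cvmx P (fun n x => beta_hat_t Y X A n t x) (beta_t P Y X t).
Proof.
have := solve_cv (Z_unit (pi_neq0 t)) (Sxx_cv t) (Sxy_cv t).
by rewrite invmxZ ?Z_unit// -scalemxAl -scalemxAr scalerA mulVf// scale1r.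
Qed.

Lemma beta_hat_cv : cvmx P (beta_hat Y X A) (beta P pi Y X).
Proof.
have sumcv q r (M : 'I_k -> nat -> T -> 'M[R]_(q, r)) L : (forall t, cvmx P (fun n x => n%:R^-1 *: M t n x) (L t)) ->
    cvmx P (fun n x => n%:R^-1 *: \sum_t M t n x) (\sum_t L t).
  move=> h i j; rewrite summxE; apply: (eq_cvP _ (cvP_sum _ (fun t => h t i j))) => n x.
  by rewrite scaler_sumr summxE.
have := solve_cv _ (sumcv _ _ _ _ Sxx_cv) (sumcv _ _ _ _ Sxy_cv).
rewrite -scaler_suml pi1 scale1r mulmx_sumr => /(_ Sig_unit).
rewrite (_ : \sum_t _ = beta P pi Y X)//; apply: eq_bigr => t _.
by rewrite -scalemxAr.
Qed.

Lemma beta_hat_t_alt_cv t : cvmx P (fun n x => beta_hat_t_alt Y X A n t x) (beta_t P Y X t).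
Proof.
have h := solve_cv Sig_unit total_cv (Sxy_cv t).
move=> i j; have := cvPM (cvP_inv (nt_cv t) (pi_neq0 t)) (h i j).
rewrite (_ : (invmx Sig *m _) i j = pi t * beta_t P Y X t i j) ?mulKf//; last first.
  by rewrite -scalemxAr mxE.
by apply: eq_cvP => n x; rewrite [RHS]mxE /nt invfM invrK.
Qed.

End Trial.

Theorem theorem1 (R : realType) (d : measure_display) (T : measurableType d)
  (P : probability T R) (k p : nat) (pi : 'I_k -> R)
  (Y : nat -> 'I_k -> T -> R) (X : nat -> 'I_p -> T -> R) (A : nat -> T -> 'I_k) :
  (* fixed assignment proportions *)
  (forall t, 0 < pi t < 1) -> \sum_t pi t = 1 ->
  (* measurability *)
  (forall i t, measurable_fun setT (Y i t)) ->
  (forall i j, measurable_fun setT (X i j)) ->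
  (forall i t, measurable [set x | A i x = t]) ->
  (* (C1): identically distributed, finite second moments, Sigma_X p.d. *)
  (forall i, same_law P (data_vec Y X i) (data_vec Y X 0)) ->
  (forall c, P.-integrable setT (fun x => ((data_vec Y X 0 c x) ^+ 2)%:E)) ->
  pd (SigmaX P X) ->
  (* simple randomization: P(A_i = a_t) = pi_t, and all data vectors and
     all assignments are mutually independent *)
  (forall i t, P [set x | A i x = t] = (pi t)%:E) ->
  mutually_independent P (trial_family Y X A) ->
  (* (i) general consistent coefficient vectors *)
  (forall (bh : nat -> T -> 'I_k -> 'cV[R]_p) (b : 'I_k -> 'cV[R]_p),
     (forall n t j, measurable_fun setT (fun x => bh n x t j 0)) ->
     (forall t, cvg_in_prob P (fun n x => bh n x t) (b t)) ->
     cvg_dist_normal P (root_n_err P Y X A bh)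
       (V_SR P pi Y X (mx_of_cols b))) /\
  (* (i), in particular: AN, ANC, ANHC (both versions) *)
  cvg_dist_normal P (root_n_err P Y X A (fun _ _ _ => 0))
    (V_SR P pi Y X (mx_of_cols (fun _ => 0))) /\
  cvg_dist_normal P (root_n_err P Y X A (fun n x _ => beta_hat Y X A n x))
    (V_SR P pi Y X (mx_of_cols (fun _ => beta P pi Y X))) /\
  cvg_dist_normal P (root_n_err P Y X A (fun n x t => beta_hat_t Y X A n t x))
    (V_SR P pi Y X (mx_of_cols (beta_t P Y X))) /\
  cvg_dist_normal P (root_n_err P Y X A (fun n x t => beta_hat_t_alt Y X A n t x))
    (V_SR P pi Y X (mx_of_cols (beta_t P Y X))) /\
  (* (ii) *)
  (forall B : 'M[R]_(p, k),
     psd (V_SR P pi Y X B - V_SR P pi Y X (Bscr P Y X))).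
Proof.
move=> pi01 pi1 mY mX mA same sq pdX piA indA.
have clt (bh : nat -> T -> 'I_k -> 'cV[R]_p) (b : 'I_k -> 'cV[R]_p) :
    (forall n t, mmx (fun x => bh n x t)) -> (forall t, cvmx P (fun n x => bh n x t) (b t)) ->
    cvg_dist_normal P (root_n_err P Y X A bh) (V_SR P pi Y X (mx_of_cols b)).
  by move=> mbh cbh; apply: trial_clt => // n t j; exact: mbh.
split=> [bh b mbh cbh|].
  have mbh' n t : mmx (fun x => bh n x t) by move=> i j; rewrite (ord1 j).
  by apply: clt => // t; apply: cvg_in_prob_cvP => // r j; exact: mbh.
split; first by apply: clt => [n t i j|t i j]; [exact: measurable_cst|exact: cvP_cst].
split; first by apply: clt => [n t|t]; [exact: mmx_beta_hat|exact: beta_hat_cv].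
split; first by apply: clt => [n t|t]; [exact: mmx_beta_hat_t|exact: beta_hat_t_cv].
split; first by apply: clt => [n t|t]; [exact: mmx_beta_hat_t_alt|exact: beta_hat_t_alt_cv].
by move=> B; exact: V_SR_optimal.
Qed.
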